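(* Let $\Omega\subset\mathbb{R}^3$ be a bounded open set with smooth boundary $\Gamma$, and let $(\Omega_h,\Gamma_h)$ be a polyhedral bulk-surface mesh with map $G$ and inverse lifts as in the context. For a function $u$ on $\Omega$ let $\tilde u$ be its Sobolev extension to $\mathbb{R}^3$. There exists $C>0$, independent of $h$ and $u$, such that $$\|\tilde u-u^{-\ell}\|_{L^2(\Omega_h)}\le Ch^2\|u\|_{H^{2+1/4}(\Omega)}\qquad\forall\,u\in H^{2+1/4}(\Omega),$$ $$|\tilde u-u^{-\ell}|_{H^1(\Omega_h)}\le Ch^{3/2}\|u\|_{H^2(\Omega)}+Ch\,\|u\|_{H^{2+3/4}(\Omega)}\qquad\forall\,u\in H^{2+3/4}(\Omega).$$
   Context: $H^s$ with non-integer $s$ is the fractional Sobolev space $W^{s,2}$. The Sobolev extension is $u\mapsto\tilde u$, a fixed (Stein) linear extension operator with $\tilde u|_\Omega=u$ and $\|\tilde u\|_{H^s(\mathbb{R}^3)}\le C\|u\|_{H^s(\Omega)}$ for all the orders $s$ used, $C$ depending on $\Omega$ and $s$. $d$ is the oriented distance to $\Gamma$ (negative inside $\Omega$), $\boldsymbol\nu$ the outward unit normal. The Fermi stripe $U$ is the maximal open neighbourhood of $\Gamma$ on which every $x$ has a unique decomposition $x=\boldsymbol a(x)+d(x)\boldsymbol\nu(\boldsymbol a(x))$, $\boldsymbol a(x)\in\Gamma$. For meshsize $h>0$, $\Omega_h=\bigcup_{E\in\mathcal{E}_h}E$ is a polyhedral approximation of $\Omega$, $\mathcal{E}_h$ a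 finite set of non-degenerate compact polyhedra; $\Gamma_h=\partial\Omega_h=\bigcup_{F\in\mathcal{F}_h}F$, $\mathcal{F}_h$ the set of faces constituting $\Gamma_h$. Assumptions, with $\gamma_1,\gamma_2>0$ independent of $h$: (F1) each $E\in\mathcal{E}_h$ has diameter at most $h$; (F2) two distinct elements or faces intersect in the empty set, a common vertex, a common edge or a common face; (F3) all nodes of $\Gamma_h$ lie on $\Gamma$; (F4) every $F\in\mathcal{F}_h$ is contained in $U$; (V1) every $E\in\mathcal{E}_h$ and every face $F$ of $E$ is star-shaped with respect to a ball of radius $\gamma_1h_E$, resp. $\gamma_1h_F$ ($h_E,h_F$ the diameters); (V2) the distance between any two nodes of $E$ (resp. of a face $F$ of $E$) is at least $\gamma_2h_E$ (resp. $\gamma_2h_F$). An element is exterior if it has at least a face or an edge contained in $\Gamma_h$; $\Omega_B$ is the union of the exterior elements. $h$ is assumed sufficiently small (in particular $\Omega_B\subset U$). $G:\Omega_h\to\Omega$ (onto the closed bulk) is a fixed homeomorphism in $W^{1,\infty}(\Omega_h)$ with $G=\boldsymbol a$ on $\Gamma_h$, $G=\mathrm{Id}$ on $\Omega_h\setminus\Omega_B$, and $\|JG-\mathrm{Id}\|_{L^\infty(\Omega_B)}\le Ch$, $\|\det JG-1\|_{L^\infty(\Omega_B)}\le Ch$, $\|G-\mathrm{Id}\|_{L^\infty(\Omega_B)}\le Ch^2$ ($JG$ the Jacobian, $C$ depending only on $\Gamma,\gamma_1,\gamma_2$). Inverse lift: $u^{-\ell}=u\circ G$. *)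

(* Defs.v *)
From HB Require Import structures.
From mathcomp Require Import all_boot all_order all_algebra.
From mathcomp Require Import all_classical all_reals all_analysis.

Set Implicit Arguments.
Unset Strict Implicit.
Unset Printing Implicit Defensive.
Import Order.TTheory GRing.Theory Num.Theory.
Import numFieldNormedType.Exports.
Local Open Scope classical_set_scope.
Local Open Scope ring_scope.

(* The norm that the library puts on a product is the maximum norm: it is only
   used for the topology, for boundedness and for differentiability, and every
   metric quantity below is expressed with [enorm]. *)
Notation R3 R := ((R : realType) * R * R)%type.

Section Euclidean.
Context {R : realType}.
Implicit Types (x y a b c n : R3 R) (A : set (R3 R)).

Definition vec3 (f : 'I_3 -> R) : R3 R :=
  (f ord0, f (inord 1), f ord_max).

Definition coord (i : 'I_3) x : R :=
  if i == ord0 then x.1.1 else if i == ord_max then x.2 else x.1.2.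

Definition basis3 (i : 'I_3) : R3 R := vec3 (fun j => (j == i)%:R).

Definition dot x y : R := \sum_(i < 3) coord i x * coord i y.

Definition enorm x : R := Num.sqrt (dot x x).

Definition segment a b : set (R3 R) :=
  [set (1 - t) *: a + t *: b | t in `[0, 1]].

Definition frontier A : set (R3 R) := closure A `\` interior A.

Definition diam A : R := sup [set enorm (x - y) | x in A & y in A].

Definition dist_to A x : R := inf [set enorm (x - y) | y in A].

Definition is_plane (P : set (R3 R)) : Prop :=
  exists c n, n != 0 /\ P = [set x | dot n (x - c) = 0].

(* [P = setT] gives star-shapedness with respect to a ball of the space; when
   [P] is the plane containing a face, the ball is a disc of that plane. *)
Definition star_shaped (P A : set (R3 R)) (r : R) : Prop :=
  exists c, let B := P `&` [set y | enorm (y - c) < r] in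
    [/\ P c, B `<=` A & forall x y, A x -> B y -> segment x y `<=` A].

End Euclidean.

(* The Borel structure for which the library's Lebesgue measure is declared. *)
Notation mR3 R :=
  (measurableTypeR R * measurableTypeR R * measurableTypeR R)%type.

Definition leb3 {R : realType} : {measure set (mR3 R) -> \bar R} :=
  ((@lebesgue_measure R \x @lebesgue_measure R) \x @lebesgue_measure R)%E.

Definition measurable_on {R : realType} (D : set (R3 R)) (u : R3 R -> R) :
  Prop := measurable_fun (D : set (mR3 R)) (u : mR3 R -> R).

(* A function on a set [D] is represented by a total function; only its values
   on [D] are ever used. *)

Section Sobolev.
Context {R : realType}.
Implicit Types (D : set (R3 R)) (u v g phi : R3 R -> R) (w : seq 'I_3).

Definition pderiv w phi : R3 R -> R :=
  foldr (fun i f => fun x => 'D_(basis3 i) f x) phi w.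

(* C^oo: every iterated partial derivative is Frechet differentiable. *)
Definition smooth_on (V : set (R3 R)) phi : Prop :=
  forall w x, V x -> differentiable (pderiv w phi) x.

Definition test_function D phi : Prop :=
  smooth_on setT phi /\
  exists K, [/\ compact K, K `<=` D & forall x, ~ K x -> phi x = 0].

Definition loc_integrable D u : Prop :=
  forall K, compact K -> K `<=` D -> leb3.-integrable K (EFin \o u).

Definition is_wderiv D w u g : Prop :=
  [/\ loc_integrable D u, loc_integrable D g &
    forall phi, test_function D phi ->
      (\int[leb3]_(x in D) (u x * pderiv w phi x)%:E =
       ((-1) ^+ size w)%:E * \int[leb3]_(x in D) (g x * phi x)%:E)%E].

(* A weak derivative is unique almost everywhere on [D]; this is a chosen
   representative, meaningful only when some weak derivative exists. *)
Definition wderiv D w u : R3 R -> R :=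
  xget (cst 0) [set g | is_wderiv D w u g].

(* Entrywise bounded by [k]: the condition [order al <= k] is added where these
   indices are used. [word] spells D^alpha as a word of directions. *)
Definition multi_index (k : nat) := {ffun 'I_3 -> 'I_k.+1}.

Definition order k (al : multi_index k) : nat := (\sum_(i < 3) al i)%N.

Definition word k (al : multi_index k) : seq 'I_3 :=
  flatten [seq nseq (al i) i | i <- enum 'I_3].

Definition L2norm D u : \bar R := 'N[leb3]_2%:E[(EFin \o u) \_ D]%E.

Definition Linfnorm D u : \bar R := 'N[leb3]_+oo%E[(EFin \o u) \_ D]%E.

Definition slobodeckij_sq D (sigma : R) v : \bar R :=
  (\int[leb3]_(x in D) \int[leb3]_(y in D)
    ((v x - v y) ^+ 2 / enorm (x - y) `^ (3 + 2 * sigma))%:E)%E.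

(* The norm of W^{s,2}(D), s = k + sigma with k the integer part of s: the
   Slobodeckij terms are present exactly when sigma <> 0. *)
Definition Hnorm D (s : R) u : \bar R :=
  let k := Num.truncn s in let sigma := s - k%:R in
  (((\sum_(al : multi_index k | (order al <= k)%N)
       L2norm D (wderiv D (word al) u) ^+ 2) +
    (if (sigma == 0)%R then 0 else
       \sum_(al : multi_index k | order al == k)
         slobodeckij_sq D sigma (wderiv D (word al) u))) `^ 2^-1)%E.

Definition in_H D (s : R) u : Prop :=
  (forall al : multi_index (Num.truncn s), (order al <= Num.truncn s)%N ->
    exists g, is_wderiv D (word al) u g) /\
  (Hnorm D s u < +oo)%E.

Definition H1seminorm D u : \bar R :=
  ((\sum_(i < 3) L2norm D (wderiv D [:: i] u) ^+ 2) `^ 2^-1)%E.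

(* Linearity and boundedness force [E u] to depend, up to a null set, only on
   the restriction of [u] to [Om] modulo null sets. *)
Definition extension_operator (orders : set R) (Om : set (R3 R))
    (E : (R3 R -> R) -> R3 R -> R) : Prop :=
  forall s, orders s ->
  [/\ forall (c : R) u v, in_H Om s u -> in_H Om s v ->
        {ae leb3, forall x, E (fun y => c * u y + v y) x = c * E u x + E v x},
      forall u, in_H Om s u -> {ae leb3, forall x, Om x -> E u x = u x} &
      exists C : R, forall u, in_H Om s u ->
        in_H setT s (E u) /\ (Hnorm setT s (E u) <= C%:E * Hnorm Om s u)%E].

End Sobolev.

Section Domain.
Context {R : realType}.
Implicit Types (Om V U : set (R3 R)) (a n x : R3 R) (rho : R3 R -> R).

Definition gradient rho x : R3 R := vec3 (fun i => 'D_(basis3 i) rho x).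

Definition local_defining_function Om a V rho : Prop :=
  [/\ open V, V a, smooth_on V rho &
    forall x, V x ->
      [/\ gradient rho x != 0, Om x <-> rho x < 0 &
          frontier Om x <-> rho x = 0]].

Definition smooth_boundary Om : Prop :=
  forall a, frontier Om a -> exists V rho, local_defining_function Om a V rho.

Definition outward_normal Om a n : Prop :=
  frontier Om a /\
  exists V rho, local_defining_function Om a V rho /\
    n = (enorm (gradient rho a))^-1 *: gradient rho a.

Definition oriented_distance Om x : R :=
  if x \in Om then - dist_to (frontier Om) x else dist_to (frontier Om) x.

(* x = a + d(x) nu(a) with a on the boundary *)
Definition fermi_decomposition Om x a : Prop :=
  exists n, outward_normal Om a n /\ x = a + oriented_distance Om x *: n.

(* The admissible neighbourhoods are stable under unions, so that their union
   is the largest one. *)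
Definition fermi_stripe Om : set (R3 R) :=
  \bigcup_(V in [set V | [/\ open V, frontier Om `<=` V &
      forall x, V x -> exists! a, fermi_decomposition Om x a]]) V.

End Domain.

Section Mesh.
Context {R : realType}.

(* A polygon is given by the cyclic sequence of its nodes together with the
   planar region that they bound. Nodes may be aligned with their neighbours. *)
Record polygon := Polygon {
  pnodes : seq (R3 R);
  psupp : set (R3 R) }.

Definition psides (F : polygon) : seq (R3 R * R3 R) :=
  zip (pnodes F) (rot 1 (pnodes F)).

Definition pedges (F : polygon) : set (set (R3 R)) :=
  [set segment ab.1 ab.2 | ab in [set` psides F]].

(* In a plane [P], the relative boundary of a closed set [A] is
   [A `&` closure (P `\` A)]. *)
Record valid_polygon (F : polygon) : Prop := ValidPolygon {
  polygon_size : (3 <= size (pnodes F))%N;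
  polygon_uniq : uniq (pnodes F);
  polygon_simple : forall ab cd, ab \in psides F -> cd \in psides F ->
    ab != cd -> forall x, segment ab.1 ab.2 x -> segment cd.1 cd.2 x ->
    (x = ab.1 \/ x = ab.2) /\ (x = cd.1 \/ x = cd.2);
  polygon_compact : compact (psupp F);
  polygon_boundary : exists P, [/\ is_plane P, psupp F `<=` P &
    psupp F `&` closure (P `\` psupp F) = \bigcup_(e in pedges F) e];
  polygon_nondegenerate : psupp F <> \bigcup_(e in pedges F) e }.

Record polyhedron := Polyhedron {
  hfaces : set polygon;
  hsupp : set (R3 R) }.

Definition hnodes (E : polyhedron) : set (R3 R) :=
  \bigcup_(F in hfaces E) [set` pnodes F].

Definition hedges (E : polyhedron) : set (set (R3 R)) :=
  \bigcup_(F in hfaces E) pedges F.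

Record valid_polyhedron (E : polyhedron) : Prop := ValidPolyhedron {
  polyhedron_finite : finite_set (hfaces E);
  polyhedron_faces : forall F, hfaces E F -> valid_polygon F;
  polyhedron_compact : compact (hsupp E);
  polyhedron_nonempty : hsupp E !=set0;
  polyhedron_nondegenerate : hsupp E = closure (interior (hsupp E));
  polyhedron_boundary :
    frontier (hsupp E) = \bigcup_(F in hfaces E) psupp F }.

Definition bulk (M : set polyhedron) : set (R3 R) :=
  \bigcup_(E in M) hsupp E.

Definition mesh_surface (M : set polyhedron) : set (R3 R) := frontier (bulk M).

Definition mesh_faces (M : set polyhedron) : set polygon :=
  \bigcup_(E in M) hfaces E.

Definition boundary_faces (M : set polyhedron) : set polygon :=
  [set F | mesh_faces M F /\ psupp F `<=` mesh_surface M].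

Definition exterior_element (M : set polyhedron) (E : polyhedron) : Prop :=
  M E /\ ((exists2 F, hfaces E F & psupp F `<=` mesh_surface M) \/
          (exists2 e, hedges E e & e `<=` mesh_surface M)).

Definition exterior_bulk (M : set polyhedron) : set (R3 R) :=
  bulk (exterior_element M).

(* [A] and [B] meet in the empty set, a common vertex, a common edge or a
   common face. *)
Definition meet_properly (A B : set (R3 R)) (vA vB : set (R3 R))
    (eA eB : set (set (R3 R))) (fA fB : set polygon) : Prop :=
  [\/ A `&` B = set0,
      exists2 v, (vA `&` vB) v & A `&` B = [set v],
      exists2 e, (eA `&` eB) e & A `&` B = e |
      exists2 F, (fA `&` fB) F & A `&` B = psupp F].

(* A face shared by two elements is the same [polygon] in both, which fixes
   one enumeration of its nodes. *)
Record bulk_surface_mesh (Om : set (R3 R)) (gamma1 gamma2 h : R)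
    (M : set polyhedron) : Prop := BulkSurfaceMesh {
  mesh_finite : finite_set M;
  mesh_valid : forall E, M E -> valid_polyhedron E;
  mesh_boundary : mesh_surface M = \bigcup_(F in boundary_faces M) psupp F;
  mesh_size : forall E, M E -> diam (hsupp E) <= h;
  mesh_elements : forall E E', M E -> M E' -> E <> E' ->
    meet_properly (hsupp E) (hsupp E') (hnodes E) (hnodes E')
      (hedges E) (hedges E') (hfaces E) (hfaces E');
  mesh_conforming : forall F F', mesh_faces M F -> mesh_faces M F' -> F <> F' ->
    meet_properly (psupp F) (psupp F') [set` pnodes F] [set` pnodes F']
      (pedges F) (pedges F') [set F] [set F'];
  mesh_nodes : forall F, boundary_faces M F ->
    [set` pnodes F] `<=` frontier Om;
  mesh_stripe : forall F, boundary_faces M F -> psupp F `<=` fermi_stripe Om;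
  mesh_star_element : forall E, M E ->
    star_shaped setT (hsupp E) (gamma1 * diam (hsupp E));
  mesh_star_face : forall F, mesh_faces M F ->
    exists P, [/\ is_plane P, psupp F `<=` P &
      star_shaped P (psupp F) (gamma1 * diam (psupp F))];
  mesh_separated_element : forall E a b, M E -> hnodes E a -> hnodes E b ->
    a <> b -> gamma2 * diam (hsupp E) <= enorm (a - b);
  mesh_separated_face : forall F a b, mesh_faces M F ->
    a \in pnodes F -> b \in pnodes F ->
    a <> b -> gamma2 * diam (psupp F) <= enorm (a - b) }.

End Mesh.
Arguments polygon : clear implicits.
Arguments polyhedron : clear implicits.

Section Lift.
Context {R : realType}.
Implicit Types (A B D Om : set (R3 R)) (G : R3 R -> R3 R).

Definition homeomorphism A B G : Prop :=
  exists H : R3 R -> R3 R,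
    [/\ {within A, continuous G}, {within B, continuous H},
        forall x, A x -> B (G x) /\ H (G x) = x &
        forall y, B y -> A (H y) /\ G (H y) = y].

Definition weak_jacobian D G (x : R3 R) : 'M[R]_3 :=
  \matrix_(i, j) wderiv D [:: j] (coord i \o G) x.

Definition in_W1oo D G : Prop :=
  forall i : 'I_3, (Linfnorm D (coord i \o G) < +oo)%E /\
  forall j : 'I_3, (exists g, is_wderiv D [:: j] (coord i \o G) g) /\
    (Linfnorm D (wderiv D [:: j] (coord i \o G)) < +oo)%E.

(* [G] maps boundary points to their normal projection, which is unique in the
   stripe. Weak derivatives are taken in the interior of the compact set
   [bulk M]. The norm on matrices is the library's maximum of the entries. *)
Record lifting_map Om (M : set (polyhedron R)) (CG h : R) G : Prop :=
    LiftingMap {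
  lifting_homeo : homeomorphism (bulk M) (closure Om) G;
  lifting_W1oo : in_W1oo (interior (bulk M)) G;
  lifting_boundary : forall x, mesh_surface M x ->
    fermi_decomposition Om x (G x);
  lifting_id : forall x, (bulk M `\` exterior_bulk M) x -> G x = x;
  lifting_jacobian : (Linfnorm (exterior_bulk M) (fun x =>
    `|weak_jacobian (interior (bulk M)) G x - 1%:M|%R) <= (CG * h)%:E)%E;
  lifting_det : (Linfnorm (exterior_bulk M) (fun x =>
    (\det (weak_jacobian (interior (bulk M)) G x) - 1)%R) <= (CG * h)%:E)%E;
  lifting_dist : (Linfnorm (exterior_bulk M) (fun x =>
    enorm (G x - x)%R) <= (CG * h ^+ 2)%:E)%E }.

(* [G] also reaches the boundary of [Om], where a function on [Om] has no
   value: it is extended there by zero, which affects a null set only. *)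
Definition inverse_lift Om G (u : R3 R -> R) : R3 R -> R := (u \_ Om) \o G.

End Lift.

(* Main.v *)
From HB Require Import structures.
Require Import Defs.
From mathcomp Require Import all_boot all_order all_algebra.
From mathcomp Require Import all_classical all_reals all_analysis.
From mathcomp Require Import measurable_realfun ess_sup_inf.
From mathcomp Require Import ring lra.

Set Implicit Arguments.
Unset Strict Implicit.
Unset Printing Implicit Defensive.
Import Order.TTheory GRing.Theory Num.Theory.
Import numFieldNormedType.Exports.
Local Open Scope classical_set_scope.
Local Open Scope ring_scope.
Local Notation coord := Defs.coord.

(** Two obstacles shape the proof. The function f is known only through weak derivatives, so f(x) -
    f(T x) cannot be integrated along the segment from x to T x: the cubes replace this segment by
    translations along the coordinate axes, each controlled for almost every starting point. And G
    is known only through its weak Jacobian on the interior of the bulk: the bound on JG - Id gives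
    Lipschitz bounds between points whose distance is small compared with their distance to the
    boundary, and the uniformly continuous inverse of G is what brings the preimages of a small ball
    that close. The admissible radii s thus depend on G and on the distance to the boundary, but the
    factor 64 = 4^3 does not; it becomes 65 with the identity outside D.

    Norms are kept squared, in the extended reals, until the last lines. The orders 2 + 1/4 and 2 +
    3/4 have integer part 2, so their norms dominate all derivatives of order at most 2; this is how
    the regularity of u enters. The displacement is O(h^2) but JG - Id is only O(h), hence the rate
    h for the gradient. *)

(* The extension f of u belongs to H^2(R^3), and on the interior D of the bulk
   the inverse lift of u coincides almost everywhere with f o G, so the error
   is f - f o T, where T is G on D and the identity elsewhere. T moves points
   by at most r = O(h^2) and multiplies volumes of preimages by at most a
   constant. For the zeroth order term, f(x) - f(y) is compared, for |x - y| <= r,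
   with the mean square increments of f over a cube of side 3r at x and at y;
   integrating, ||f - f o T|| <= C r ||grad f||. The gradient of the error is
   (grad f - (grad f) o T) + (Id - JG)^T (grad f) o T: the same inequality,
   applied to the first derivatives of f, bounds the first term by
   C h^2 ||f||_{H^2}, and the second is at most C h ||grad f||.

   That T controls volumes is not deduced from the determinant of JG: the
   bound on JG - Id makes G a local perturbation of the identity, so that
   preimages of balls of small radius s lie in balls of radius 4s, and a measure
   bounded by a multiple of the Lebesgue measure on small balls is so everywhere.
   The chain rule for f o G is first proved for a mollified f. *)

(** * Lebesgue measure on R^3 *)

Section measure_preserving.
Context d1 d2 (T1 : measurableType d1) (T2 : measurableType d2) {R : realType}.
Variables (m1 : {sigma_finite_measure set T1 -> \bar R}).
Variables (m2 : {sigma_finite_measure set T2 -> \bar R}).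
Variables (f1 : {mfun T1 >-> T1}) (f2 : {mfun T2 >-> T2}).

(** A product measure is determined by its values on rectangles, and the pushforward has the same
    values there. *)
Lemma product_measure_preserving :
  (forall A, measurable A -> m1 (f1 @^-1` A) = m1 A) ->
  (forall A, measurable A -> m2 (f2 @^-1` A) = m2 A) ->
  forall A, measurable A ->
    (m1 \x m2)%E ((fun x => (f1 x.1, f2 x.2)) @^-1` A) = (m1 \x m2)%E A.
Proof.
move=> f1m f2m A mA.
have mf : measurable_fun [set: T1 * T2] (fun x => (f1 x.1, f2 x.2)).
  by apply: measurable_fun_pair; exact: measurableT_comp.
pose f : {mfun (T1 * T2)%type >-> (T1 * T2)%type} :=
  HB.pack (fun x => (f1 x.1, f2 x.2)) (isMeasurableFun.Build _ _ _ _ _ mf).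
rewrite -[LHS]/(pushforward (m1 \x m2)%E f A); apply/esym.
apply: product_measure_unique => // B C mB mC.
rewrite -[LHS]/((m1 \x m2)%E ((f1 @^-1` B) `*` (f2 @^-1` C))).
rewrite product_measure1E; [|exact: measurable_funPTI..].
by congr (_ * _)%E; [exact: f1m|exact: f2m].
Qed.

End measure_preserving.

Section measure_R3.
Context {R : realType}.
Implicit Types (v : R3 R) (A B D : set (R3 R)).
Local Notation lam := (@lebesgue_measure R).

Lemma measurable_shift (a : R) : measurable_fun [set: measurableTypeR R]
  ((fun x : R => x + a) : measurableTypeR R -> measurableTypeR R).
Proof. exact: measurable_funD. Qed.

Definition shift_mfun (a : R) : {mfun measurableTypeR R >-> measurableTypeR R} :=
  HB.pack (fun x : R => x + a)
    (isMeasurableFun.Build _ _ _ _ _ (measurable_shift a)).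

(** Lebesgue measure is determined by the lengths of the half-open intervals, which a shift
    preserves. *)
Lemma lebesgue_measure_shift (a : R) (A : set R) :
  measurable (A : set (measurableTypeR R)) ->
  lam ((fun x => x + a) @^-1` A) = lam A.
Proof.
move=> mA.
rewrite -[LHS]/(pushforward lam (shift_mfun a) A).
apply/esym/lebesgue_measure_unique => //= _ [[p q]] _ <-.
rewrite /pushforward /=.
have -> : (fun x => x + a) @^-1` `]p, q] = `](p - a), (q - a)]%classic.
  by apply/seteqP; split => x /=; rewrite !in_itv /= ltrBlDr lerBrDr.
rewrite !lebesgue_measure_itv/= !lte_fin ltrD2r; case: ifPn => // _.
by rewrite -!EFinB; congr EFin; ring.
Qed.

Let sigma_finite_product d1 d2 (T1 : measurableType d1) (T2 : measurableType d2)
  (m1 : {sigma_finite_measure set T1 -> \bar R})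
  (m2 : {sigma_finite_measure set T2 -> \bar R}) : sigma_finite setT (m1 \x m2)%E.
Proof.
have /sigma_finiteP[F [TF ndF Foo]] := sigma_finiteT m1.
have /sigma_finiteP[G [TG ndG Goo]] := sigma_finiteT m2.
exists (fun n => F n `*` G n); last first.
  move=> k; have [? ?] := Foo k; have [? ?] := Goo k.
  split; first exact: measurableX.
  by rewrite product_measure1E// lte_mul_pinfty// ge0_fin_numE.
apply/seteqP; split => // -[x y] _.
have [n _ Fx] : (\bigcup_i F i) x by rewrite -TF.
have [k _ Gy] : (\bigcup_i G i) y by rewrite -TG.
exists (maxn n k) => //; split => /=.
- by move: x Fx; exact/subsetPset/ndF/leq_maxl.
- by move: y Gy; exact/subsetPset/ndG/leq_maxr.
Qed.

(** This name and [lebesgue_measure3] carry the instances of sigma-finiteness that Tonelli's theorem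
    asks for; both unfold to the products inside [leb3]. *)
Definition lebesgue_measure2 :
  set (measurableTypeR R * measurableTypeR R)%type -> \bar R := (lam \x lam)%E.
HB.instance Definition _ := Measure.on lebesgue_measure2.
HB.instance Definition _ := Measure_isSigmaFinite.Build _ _ _ lebesgue_measure2
  (sigma_finite_product lam lam).

Definition lebesgue_measure3 : set (mR3 R) -> \bar R := 
  (lebesgue_measure2 \x lam)%E.
HB.instance Definition _ := Measure.on lebesgue_measure3.
HB.instance Definition _ := Measure_isSigmaFinite.Build _ _ _ lebesgue_measure3
  (sigma_finite_product lebesgue_measure2 lam).

Lemma leb3_shift v A : measurable (A : set (mR3 R)) ->
  leb3 ((fun x : R3 R => x + v) @^-1` A) = leb3 A.
Proof.
case: v => -[a b] c mA.
have m2 : measurable_fun [set: measurableTypeR R * measurableTypeR R] (fun x : measurableTypeR R * measurableTypeR R=> (shift_mfun a x.1, shift_mfun b x.2)).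
  by apply: measurable_fun_pair; exact: measurableT_comp.
pose f : {mfun (measurableTypeR R * measurableTypeR R)%type >-> (measurableTypeR R * measurableTypeR R)%type} :=
  HB.pack (fun x : measurableTypeR R * measurableTypeR R => (shift_mfun a x.1, shift_mfun b x.2)) (isMeasurableFun.Build _ _ _ _ _ m2).
have := @product_measure_preserving _ _ _ _ _ lebesgue_measure2 lam f (shift_mfun c).
apply => //; last by move=> *; exact: lebesgue_measure_shift.
by apply: product_measure_preserving => *; exact: lebesgue_measure_shift.
Qed.

End measure_R3.

Lemma measurable_fun_pair_on d d1 d2 (T : measurableType d)
    (T1 : measurableType d1) (T2 : measurableType d2) (D : set T)
    (f : T -> T1) (g : T -> T2) :
  measurable_fun D f -> measurable_fun D g ->
  measurable_fun D (fun x => (f x, g x)).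
Proof.
move=> mf mg mD; apply: measurability (measurable_prod_measurableType T1 T2) _ _ => //.
move=> _ [_ [A mA [B mB <-]] <-].
rewrite (_ : _ `&` _ = (D `&` f @^-1` A) `&` (D `&` g @^-1` B)).
  by apply: measurableI; [exact: mf|exact: mg].
by apply/seteqP; split => [x [? []]|x [[? ?] []]].
Qed.

(** * Countable bases, measurability and translations *)

Section topology_R3.
Context {R : realType}.
Implicit Types (v : R3 R) (A B D : set (R3 R)).
Local Notation lam := (@lebesgue_measure R).
Local Notation mu := (@leb3 R).

(** A base of the topology indexed by a countable type: open sets become countable unions of cubes,
    and measurability and negligibility become local properties. *)
Definition rational_cube (i : rat * rat * rat * nat) : set (R3 R) :=
  ball ((ratr i.1.1.1, ratr i.1.1.2, ratr i.1.2) : R3 R) (i.2.+1%:R^-1).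

Lemma ball3E v (r : R) : ball v r =
  (ball v.1.1 r `*` ball v.1.2 r) `*` ball v.2 r :> set (R3 R).
Proof. by case: v => -[a b] c; apply/seteqP; split => -[[x y] z] [[]]. Qed.

Lemma measurable_ball3 v r : measurable (ball v r : set (mR3 R)).
Proof.
by rewrite ball3E; apply: measurableX => //; [apply: measurableX|];
  exact: measurable_ball.
Qed.

Lemma rational_cube_nbhs v A : nbhs v A ->
  exists i, rational_cube i v /\ rational_cube i `<=` A.
Proof.
move=> /nbhs_ballP[e /= e0 eA].
have [n _ ne] : \forall n \near \oo, (n.+1%:R^-1 : R) < e / 2.
  by apply: near_infty_natSinv_lt (PosNum _); rewrite /= divr_gt0.
have {}ne : n.+1%:R^-1 < e / 2 by exact: ne (leqnn n).
have rat_near (a : R) : exists q : rat, `|ratr q - a| < n.+1%:R^-1.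
  have [|q] := @rat_in_itvoo R (a - n.+1%:R^-1) (a + n.+1%:R^-1).
    by rewrite ltrD2l gtrN // invr_gt0.
  by rewrite in_itv /= => /andP[q1 q2]; exists q; rewrite ltr_distl q1.
case: v eA => -[a b] c eA.
have [[p Hp] [[q Hq] [s Hs]]] := (rat_near a, (rat_near b, rat_near c)).
exists (p, q, s, n); split; first by split; [split|].
move=> [[x y] z] [[/= Hx Hy] Hz]; apply: eA.
have H (t t' t'' : R) : `|t' - t| < n.+1%:R^-1 ->
    ball t' (n.+1%:R^-1) t'' -> ball t e t''.
  rewrite /ball /= => H1 H2.
  have -> : t - t'' = (t' - t'') - (t' - t) by ring.
  rewrite (le_lt_trans (ler_normB _ _))//.
  by move: H1 H2 ne; move: (n.+1%:R^-1) => r; lra.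
by split; [split|]; [exact: H Hx|exact: H Hy|exact: H Hz].
Qed.

Lemma open_measurable3 A : open A -> measurable (A : set (mR3 R)).
Proof.
move=> oA.
have -> : A = \bigcup_(i in [set i | rational_cube i `<=` A]) rational_cube i.
  apply/seteqP; split => [x Ax|x [i iA]]; last exact: iA.
  have [i [ix iA]] := rational_cube_nbhs (open_nbhs_nbhs (conj oA Ax)).
  by exists i.
rewrite bigcup_mkcond; apply: countable_bigcupT_measurable => //.
by move=> i; case: ifP => // _; exact: measurable_ball3.
Qed.

Lemma closed_measurable3 A : closed A -> measurable (A : set (mR3 R)).
Proof.
move=> cA; rewrite -(setCK A); apply: measurableC; apply: open_measurable3.
exact: closed_openC.
Qed.

Lemma compact_measurable3 A : compact A -> measurable (A : set (mR3 R)).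
Proof. by move=> cA; apply: closed_measurable3; exact: compact_closed. Qed.

Lemma within_continuous_measurable_fun D (f : R3 R -> R) :
  measurable (D : set (mR3 R)) -> {within D, continuous f} ->
  measurable_on D f.
Proof.
move=> mD /continuousP cf; apply: (measurability _ (RGenOpens.measurableE R)).
move=> _ [_ [a [b ->] <-]].
have oD := cf _ (@interval_open R (BRight a) (BLeft b) isT isT).
have [V oV VD] := iffLR (open_subspaceP _ _) oD.
by rewrite setIC -VD; apply: measurableI => //; exact: open_measurable3.
Qed.

(** Lindelof's argument: every point of [A] lies in a rational cube whose trace on [A] is
    negligible, and there are countably many such cubes. *)
Lemma negligible_locally A :
  (forall x, A x -> exists2 U, nbhs x U & mu.-negligible (A `&` U)) ->
  mu.-negligible A.
Proof.
move=> H.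
pose F n := if unpickle n is Some i then
    if `[< mu.-negligible (A `&` rational_cube i) >]
    then A `&` rational_cube i else set0
  else set0.
apply: (@negligibleS _ _ _ mu (\bigcup_n F n)); last first.
  apply: negligible_bigcup => n; rewrite /F.
  case: unpickle => [i|]; last exact: negligible_set0.
  by case: asboolP => // _; exact: negligible_set0.
move=> x Ax; have [U xU nU] := H _ Ax.
have [i [ix iU]] := rational_cube_nbhs xU.
have nAi : mu.-negligible (A `&` rational_cube i).
  by apply: negligibleS nU; exact: setIS.
by exists (pickle i); [exact: I|rewrite /F pickleK asboolT].
Qed.

Lemma measurable_fun3P d (T : measurableType d) (D : set T) (f : T -> R3 R) :
  measurable_fun D (f : T -> mR3 R) <->
  [/\ measurable_fun D (fun x => (f x).1.1 : measurableTypeR R),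
    measurable_fun D (fun x => (f x).1.2 : measurableTypeR R) &
    measurable_fun D (fun x => (f x).2 : measurableTypeR R)].
Proof.
have m1 : measurable_fun [set: mR3 R] (fun x : mR3 R => x.1).
  exact: measurable_fst.
have m2 : measurable_fun [set: mR3 R] (fun x : mR3 R => x.2).
  exact: measurable_snd.
have m11 : measurable_fun [set: measurableTypeR R * measurableTypeR R] fst.
  exact: measurable_fst.
have m12 : measurable_fun [set: measurableTypeR R * measurableTypeR R] snd.
  exact: measurable_snd.
split=> [mf|[f1 f2 f3]].
  have mf1 := measurableT_comp m1 mf.
  by split; [exact: measurableT_comp m11 mf1|exact: measurableT_comp m12 mf1|
    exact: measurableT_comp m2 mf].
have -> : f = (fun x => ((f x).1.1, (f x).1.2, (f x).2)).
  by apply/funext => x; case: (f x) => -[].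
exact: measurable_fun_pair_on (measurable_fun_pair_on f1 f2) f3.
Qed.

Lemma measurable_coord (i : 'I_3) : measurable_on setT (coord i : R3 R -> R).
Proof.
have /measurable_fun3P[m1 m2 m3] := @measurable_id _ (mR3 R) setT.
by rewrite /measurable_on /coord; case: (i == ord0) => //; case: (i == ord_max).
Qed.

Lemma measurable_funD3 d (T : measurableType d) (D : set T) (f g : T -> R3 R) :
  measurable_fun D (f : T -> mR3 R) -> measurable_fun D (g : T -> mR3 R) ->
  measurable_fun D ((fun x => f x + g x) : T -> mR3 R).
Proof.
move=> /measurable_fun3P[f1 f2 f3] /measurable_fun3P[g1 g2 g3].
by apply/measurable_fun3P; split; exact: measurable_funD.
Qed.

Lemma measurable_funZ3 d (T : measurableType d) (D : set T) (f : T -> R)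
    (g : T -> R3 R) :
  measurable_fun D f -> measurable_fun D (g : T -> mR3 R) ->
  measurable_fun D ((fun x => f x *: g x) : T -> mR3 R).
Proof.
move=> mf /measurable_fun3P[g1 g2 g3].
by apply/measurable_fun3P; split; exact: measurable_funM.
Qed.

Lemma measurable_shift3 v :
  measurable_fun [set: mR3 R] ((fun x : R3 R => x + v) : mR3 R -> mR3 R).
Proof.
apply: measurable_funD3; first exact: (@measurable_id _ (mR3 R)).
exact: (@measurable_cst _ _ (mR3 R) (mR3 R)).
Qed.

Definition shift3 v : {mfun mR3 R >-> mR3 R} :=
  HB.pack (fun x : R3 R => x + v)
    (isMeasurableFun.Build _ _ _ _ _ (measurable_shift3 v)).

Lemma ge0_integral_shift (f : R3 R -> \bar R) v :
  measurable_fun [set: mR3 R] f -> (forall x, 0 <= f x)%E ->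
  (\int[mu]_x f ((x : R3 R) + v)%R = \int[mu]_x f x)%E.
Proof.
move=> mf f0.
transitivity (\int[pushforward mu (shift3 v)]_x f x)%E.
  by rewrite ge0_integral_pushforward.
by apply: eq_measure_integral => A mA _; exact: leb3_shift.
Qed.

End topology_R3.

(** * Generators of product sigma-algebras and open boxes *)

Section product_generator.
Context d1 d2 (T1 : measurableType d1) (T2 : measurableType d2).
Variables (G1 : set (set T1)) (G2 : set (set T2)).
Hypotheses (mG1 : measurable = <<s G1 >>) (mG2 : measurable = <<s G2 >>).
Variables (g1 : (set T1)^nat) (g2 : (set T2)^nat).
Hypotheses (Gg1 : forall n, G1 (g1 n)) (Gg2 : forall n, G2 (g2 n)).
Hypotheses (cover1 : \bigcup_n g1 n = setT) (cover2 : \bigcup_n g2 n = setT).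

(** One factor at a time is extended from the generator to all measurable sets. The covers serve for
    complements: the whole space need not be in [G1], so the complement of [A] times [B] is written
    as the union of the [g1 n] times [B], minus [A] times [B]. *)
Lemma measurable_prod_generated : @measurable _ (T1 * T2)%type =
  <<s [set A `*` B | A in G1 & B in G2] >>.
Proof.
pose S := <<s [set A `*` B | A in G1 & B in G2] >>.
have SG A B : G1 A -> G2 B -> S (A `*` B).
  by move=> GA GB; apply: sub_sigma_algebra; exists A => //; exists B.
have sS : sigma_algebra setT S by exact: smallest_sigma_algebra.
have subT X : S X -> X `<=` setT by [].
have [_ _ _ SI] := iffLR (sigma_algebraP subT) sS.
have SD A B : S A -> S B -> S (A `\` B).
  by move=> SA SB; rewrite setDE -setTD; apply: SI => //; case: sS => _ + _; apply.
have SU (F : (set (T1 * T2))^nat) : (forall n, S (F n)) -> S (\bigcup_n F n).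
  exact: sigma_algebra_bigcup.
have S1 A B : measurable A -> G2 B -> S (A `*` B).
  move=> + GB; rewrite mG1; move: A; apply: smallest_sub; last by move=> A /SG; exact.
  split => [|A SA|F SF].
  - by rewrite set0X; exact: sigma_algebra0.
  - rewrite -[X in (X `\` _) `*` _]cover1.
    have -> : (\bigcup_n g1 n `\` A) `*` B = (\bigcup_n (g1 n `*` B)) `\` (A `*` B).
      apply/seteqP; split => -[x y] /=.
        by move=> [[[n _ gx] nA] By]; split; [exists n|case].
      by move=> [[n _ [gx By]] nAB]; split=> //; split; [exists n|move=> ?; exact: nAB].
    by apply: SD => //; apply: SU => n; exact: SG.
  - by rewrite setX_bigcupl; exact: SU.
have S2 A B : measurable A -> measurable B -> S (A `*` B).
  move=> mA; rewrite mG2; move: B; apply: smallest_sub; last by move=> B /(S1 _ _ mA).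
  split => [|B SB|F SF].
  - by rewrite setX0; exact: sigma_algebra0.
  - rewrite -[X in _ `*` (X `\` _)]cover2.
    have -> : A `*` (\bigcup_n g2 n `\` B) = (\bigcup_n (A `*` g2 n)) `\` (A `*` B).
      apply/seteqP; split => -[x y] /=.
        by move=> [Ax [[n _ gy] nB]]; split; [exists n|case].
      by move=> [[n _ [Ax gy]] nAB]; split=> //; split; [exists n|move=> ?; exact: nAB].
    by apply: SD => //; apply: SU => n; exact: S1.
  - by rewrite setX_bigcupr; exact: SU.
apply/seteqP; split.
  rewrite measurable_prod_measurableType; apply: smallest_sub.
    exact: smallest_sigma_algebra.
  by move=> _ [A mA [B mB <-]]; exact: S2.
apply: smallest_sub; first exact: sigma_algebra_measurable.
move=> _ [A GA [B GB <-]]; apply: measurableX.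
- by rewrite mG1; exact: sub_sigma_algebra.
- by rewrite mG2; exact: sub_sigma_algebra.
Qed.

End product_generator.

Lemma open_setX (U V : topologicalType) (A : set U) (B : set V) :
  open A -> open B -> open (A `*` B).
Proof.
move=> oA oB; rewrite openE => -[x y] [/= Ax By].
by exists (A, B) => //; split; apply: open_nbhs_nbhs.
Qed.

Section boxes.
Context {R : realType}.
Implicit Types (v p q : R3 R) (A B D : set (R3 R)).
Local Notation lam := (@lebesgue_measure R).
Local Notation mu := (@leb3 R).

Definition box p q : set (R3 R) :=
  (`]p.1.1, q.1.1[ `*` `]p.1.2, q.1.2[) `*` `]p.2, q.2[.

Definition boxes : set (set (R3 R)) := [set B | exists p q, B = box p q].

Let G1 : set (set (measurableTypeR R)) := @RGenOpens.G R.
Let G2 : set (set (measurableTypeR R * measurableTypeR R)) :=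
  [set A `*` B | A in G1 & B in G1].

Let g1 n : set (measurableTypeR R) := `](- n%:R), n%:R[%classic.

Let cover1 : \bigcup_n g1 n = setT.
Proof.
apply/seteqP; split => // x _; exists (Num.truncn `|x|).+1 => //.
have := truncnS_gt `|x|; rewrite ltr_norml /g1 /= in_itv /=.
by [].
Qed.

Let Gg1 n : G1 (g1 n). Proof. by exists (- n%:R), n%:R. Qed.

(** Boxes are stable under intersection, so this generator serves both for Dynkin's induction in the
    fundamental lemma and for the regularity of measures. *)
Lemma measurable_boxes : @measurable _ (mR3 R) = <<s boxes >>.
Proof.
have mG1 := RGenOpens.measurableE R.
have mG2 := measurable_prod_generated mG1 mG1 Gg1 Gg1 cover1 cover1.
pose g2 n := g1 n `*` g1 n.
have Gg2 n : G2 (g2 n) by exists (g1 n) => //; exists (g1 n).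
have cover2 : \bigcup_n g2 n = setT.
  apply/seteqP; split => // -[x y] _.
  have [[n _ gx] [m _ gy]] : (\bigcup_n g1 n) x /\ (\bigcup_n g1 n) y.
    by rewrite cover1.
  have inc k l : (k <= l)%N -> g1 k `<=` g1 l.
    move=> kl z; rewrite /g1 /= !in_itv /= => /andP[zk kz].
    have : k%:R <= l%:R :> R by rewrite ler_nat.
    by move=> ?; apply/andP; split; lra.
  exists (maxn n m) => //; split.
    exact: inc (leq_maxl _ _) _ gx.
  exact: inc (leq_maxr _ _) _ gy.
rewrite (measurable_prod_generated mG2 mG1 Gg2 Gg1 cover2 cover1).
congr (<<s _ >>); apply/seteqP; split.
  move=> _ [_ [_ [a [b ->]] [_ [c [d ->]] <-]] [_ [e [f ->]] <-]].
  by exists (a, c, e), (b, d, f).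
move=> _ [[[a c] e] [[[b d] f] ->]].
exists (`]a, b[ `*` `]c, d[); last by exists `]e, f[%classic => //; exists e, f.
exists `]a, b[%classic; first by exists a, b.
by exists `]c, d[%classic => //; exists c, d.
Qed.

Lemma box_measurable p q : measurable (box p q : set (mR3 R)).
Proof. by apply: measurableX => //; apply: measurableX. Qed.

Lemma boxI p q p' q' : exists p'' q'', box p q `&` box p' q' = box p'' q''.
Proof.
case: p q p' q' => -[a b] c [[a1 b1] c1] [[a' b'] c'] [[a1' b1'] c1'].
exists (Num.max a a', Num.max b b', Num.max c c').
exists (Num.min a1 a1', Num.min b1 b1', Num.min c1 c1').
apply/seteqP; split => -[[x y] z]; rewrite /box /= !in_itv /= !gt_max !lt_min.
  by move=> [[[/andP[-> ->] /andP[-> ->]] /andP[-> ->]]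
    [[/andP[-> ->] /andP[-> ->]] /andP[-> ->]]].
by move=> [[/andP[/andP[-> ->] /andP[-> ->]] /andP[/andP[-> ->] /andP[-> ->]]]
  /andP[/andP[-> ->] /andP[-> ->]]].
Qed.

Lemma leb3X (A B C : set R) : measurable (A : set (measurableTypeR R)) ->
  measurable (B : set (measurableTypeR R)) ->
  measurable (C : set (measurableTypeR R)) ->
  mu (A `*` B `*` C) = (lam A * lam B * lam C)%E.
Proof.
move=> mA mB mC.
rewrite [LHS](@product_measure1E _ _ _ _ _ lebesgue_measure2 lam)//; last exact: measurableX.
by congr (_ * _)%E; rewrite [LHS](@product_measure1E _ _ _ _ _ lam lam).
Qed.

Lemma leb3_ball v (r : R) : 0 <= r -> mu (ball v r) = ((2 * r) ^+ 3)%:E.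
Proof.
move=> r0; rewrite ball3E leb3X; [|exact: measurable_ball..].
by rewrite !lebesgue_measure_ball // -!EFinM; congr EFin; rewrite !mulr2n; ring.
Qed.

Lemma bounded_sub_ball A : bounded_set A -> exists2 M, 0 < M & A `<=` ball 0 M.
Proof.
move=> [M [Mr MA]]; exists (`|M| + 2); first by rewrite ltr_wpDl.
move=> x Ax; rewrite -ball_normE /ball_ /= sub0r normrN.
have /(_ _ x Ax) /= := MA (`|M| + 1).
move=> /(_ _)/le_lt_trans; apply; last by rewrite ltrD2l ltr1n.
by rewrite (le_lt_trans (ler_norm _))// ltrDl.
Qed.

Lemma le_leb3 A B : measurable (A : set (mR3 R)) ->
  measurable (B : set (mR3 R)) -> A `<=` B -> (mu A <= mu B)%E.
Proof. by move=> mA mB AB; apply: le_measure; rewrite ?inE. Qed.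

Lemma bounded_leb3_lty A : measurable (A : set (mR3 R)) -> bounded_set A ->
  (mu A < +oo)%E.
Proof.
move=> mA /bounded_sub_ball[M M0 AM].
rewrite (le_lt_trans (le_leb3 mA (measurable_ball3 _ _) AM))//.
by rewrite leb3_ball ?ltry// ltW.
Qed.

Lemma compact_leb3_lty A : compact A -> (mu A < +oo)%E.
Proof.
move=> cA; apply: bounded_leb3_lty; first exact: compact_measurable3.
exact: compact_bounded.
Qed.

Lemma leb3_ae_eq_setI_ball A :
  (forall n : nat, mu.-negligible (A `&` ball 0 n.+1%:R)) -> mu.-negligible A.
Proof.
move=> An; apply: (@negligibleS _ _ _ mu (\bigcup_n (A `&` ball 0 n.+1%:R))).
  move=> x Ax; exists (Num.truncn `|x|) => //; split=> //.
  by rewrite -ball_normE /ball_ /= sub0r normrN truncnS_gt.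
exact: negligible_bigcup.
Qed.

(* Within a ball, infinitely many disjoint translates of A have bounded total measure. *)
Lemma disjoint_translates_null A v : measurable (A : set (mR3 R)) ->
  (forall x (t : R), A x -> t != 0 -> ~ A (x + t *: v)) -> mu A = 0%E.
Proof.
move=> mA disj; apply/negligibleP => //; apply: leb3_ae_eq_setI_ball => n.
pose B := A `&` ball 0 n.+1%:R.
have mB : measurable (B : set (mR3 R)).
  by apply: measurableI => //; exact: measurable_ball3.
apply/negligibleP => //; rewrite -/B.
(* The offsets [v / (k + 1)] are pairwise distinct multiples of [v] and have norm at most that of
   [v]: the translates are disjoint and stay in one ball. *)
pose F (k : nat) : set (R3 R) := (fun x => x + k.+1%:R^-1 *: v) @^-1` B.
have mF k : measurable (F k : set (mR3 R)).
  rewrite -[X in _ X](setTI (F k)); exact: measurable_shift3.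
have muF k : mu (F k) = mu B by exact: leb3_shift.
have tF : trivIset setT F.
  apply/trivIsetP => k l _ _ kl; apply/seteqP; split => // x [[Ak _] [Al _]].
  apply: (disj _ (l.+1%:R^-1 - k.+1%:R^-1) Ak).
    rewrite subr_eq0; apply: contra kl => /eqP/invr_inj/eqP.
    by rewrite eqr_nat eqSS eq_sym.
  rewrite scalerBl addrC -addrA.
  have -> : - (k.+1%:R^-1 *: v) + (x + k.+1%:R^-1 *: v) = x.
    by rewrite addrC addrK.
  by rewrite addrC.
have sub : \bigcup_k F k `<=` ball 0 (n.+1%:R + `|v|).
  move=> x [k _ [_]]; rewrite -!ball_normE /ball_ /= !sub0r !normrN => xk.
  rewrite -(addrK (k.+1%:R^-1 *: v) x) (le_lt_trans (ler_normB _ _))//.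
  rewrite ltr_leD// normrZ ger0_norm ?invr_ge0// ler_piMl//.
  by rewrite invf_le1 ?ler1n.
have Boo : (mu (\bigcup_k F k) < +oo)%E.
  rewrite (le_lt_trans (le_leb3 (bigcupT_measurable _ mF) (measurable_ball3 _ _) sub))//.
  by rewrite leb3_ball ?ltry// addr_ge0.
have := Boo; rewrite (measure_semi_bigcup _ mF tF (bigcupT_measurable _ mF)).
rewrite (eq_eseriesr (g := fun=> mu B)) => [|k _]; last exact: muF.
have Blty : (mu B < +oo)%E.
  by apply: (le_lt_trans _ Boo); rewrite -(muF 0%N); apply: le_leb3 => //;
    [exact: bigcupT_measurable|exact: bigcup_sup].
have [r r0 muBr] : exists2 r, 0 <= r & mu B = r%:E.
  exists (fine (mu B)); first exact: fine_ge0.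
  by rewrite fineK// ge0_fin_numE.
rewrite [LHS]muBr muBr => Soo.
have rN N : ((r *+ N)%:E <= \sum_(0 <= k <oo) r%:E)%E.
  apply: (@le_trans _ _ (\sum_(0 <= k < N) r%:E)%E).
    by rewrite sumEFin sumr_const_nat subn0.
  by apply: nneseries_lim_ge => k _ _; rewrite lee_fin.
have [S SE] : exists S, (\sum_(0 <= k <oo) r%:E)%E = S%:E.
  exists (fine (\sum_(0 <= k <oo) r%:E)%E); rewrite fineK// ge0_fin_numE//.
  by apply: nneseries_ge0 => k _ _; rewrite lee_fin.
rewrite SE in rN.
have [->//|rn0] := eqVneq r 0.
have {rn0 r0}r0 : 0 < r by rewrite lt_def rn0.
have := rN (Num.truncn (S / r)).+1; rewrite lee_fin leNgt => /negP[].
by rewrite -mulr_natl -ltr_pdivrMr// truncnS_gt.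
Qed.

Lemma open_box p q : open (box p q).
Proof. by apply: open_setX; [apply: open_setX|]; exact: interval_open. Qed.

End boxes.

(** * Regularity of finite measures *)

Section regularity.
Context {R : realType}.
Implicit Types (v p q : R3 R) (A B D O : set (R3 R)).
Local Notation mu := (@leb3 R).

Lemma nonincreasing_measure_le d (T : measurableType d)
    (m : {finite_measure set T -> \bar R}) (F : (set T)^nat) (a e : R) :
  (forall n, measurable (F n)) -> nonincreasing_seq F ->
  (m (\bigcap_n F n) <= a%:E)%E -> 0 < e -> exists n, (m (F n) <= (a + e)%:E)%E.
Proof.
move=> mF niF ma e0.
have fin (A : set T) : measurable A -> m A \is a fin_num by exact: fin_num_measure.
have mI : measurable (\bigcap_n F n) by exact: bigcapT_measurable.
have m0 : (m (F 0%N) < +oo)%E by rewrite -ge0_fin_numE ?fin.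
have [l lE] : exists l, m (\bigcap_n F n) = l%:E.
  by exists (fine (m (\bigcap_n F n))); rewrite fineK ?fin.
have : m (F n) @[n --> \oo] --> l%:E.
  by rewrite -lE; exact: nonincreasing_cvg_mu.
move=> /fine_cvgP[_ /cvgrPdist_lt/(_ _ e0)[n _ /(_ n (leqnn n)) /= H]].
exists n; rewrite -(fineK (fin _ (mF n))) lee_fin.
move: ma; rewrite lE lee_fin.
by move: H; rewrite ltr_distlC => /andP[_]; lra.
Qed.

(** A closed set that increases with [k] to [O] when [O] is open. It gives uniform room around its
    points, here and later for ball averages and for the local bounds on [G]. *)
Definition inner O (k : nat) : set (R3 R) := [set x | ball x k.+1%:R^-1 `<=` O].

Lemma closed_inner O k : closed (inner O k).
Proof.
rewrite -openC openE => x /= /existsNP[y /not_implyP[xy nOy]].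
have oy := @ball_open _ (R3 R) y (k.+1%:R^-1).
apply: (@filterS _ _ _ (ball y (k.+1%:R^-1))).
  by move=> z /ball_sym zy; rewrite /inner /= => /(_ y zy).
by apply: open_nbhs_nbhs; split; [exact: oy|exact: ball_sym].
Qed.

(** The sets that can be squeezed between a closed and an open set with small difference form a
    sigma-algebra. It contains the boxes, which are exhausted by their sets [inner]. *)
Lemma finite_measure_regular (m : {finite_measure set (mR3 R) -> \bar R}) A :
  measurable (A : set (mR3 R)) -> forall e : R, 0 < e ->
  exists O C, [/\ open O, closed C, C `<=` A, A `<=` O & (m (O `\` C) <= e%:E)%E].
Proof.
pose reg A := forall e : R, 0 < e ->
  exists O C, [/\ open O, closed C, C `<=` A, A `<=` O & (m (O `\` C) <= e%:E)%E].
suff : (@measurable _ (mR3 R)) `<=` reg by move=> + mA; exact.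
have mO B : open B -> measurable (B : set (mR3 R)) by exact: open_measurable3.
have mC B : closed B -> measurable (B : set (mR3 R)) by exact: closed_measurable3.
rewrite measurable_boxes; apply: smallest_sub.
  split.
  - move=> e e0; exists set0, set0; split => //; first exact: closed0.
    by rewrite setD0 measure0 lee_fin ltW.
  - move=> B rB e e0; have [U0 [C [oU cC CB BU me]]] := rB e e0.
    exists (~` C), (~` U0); split.
    + exact: closed_openC.
    + exact: open_closedC.
    + by rewrite setTD; exact: subsetC.
    + by rewrite setTD; exact: subsetC.
    + by rewrite setDE setCK setIC -setDE.
  - move=> F rF e e0.
    (* These allowances add up to [e / 2]; the other half pays for the truncation of the union of
       closed sets. *)
    have en n : 0 < (e / 2) / ((2 ^ n.+1)%N)%:R.
      by rewrite !divr_gt0// ltr0n expn_gt0.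
    have /choice[OC HOC] n : exists OC : set (R3 R) * set (R3 R),
      [/\ open OC.1, closed OC.2, OC.2 `<=` F n, F n `<=` OC.1 &
        (m (OC.1 `\` OC.2) <= ((e / 2) / ((2 ^ n.+1)%N)%:R)%:E)%E].
      by have [U0 [C H]] := rF n _ (en n); exists (U0, C).
    pose O : set (R3 R) := \bigcup_n (OC n).1.
    pose C n : set (R3 R) := \big[setU/set0]_(k < n) (OC k).2.
    have oO : open O by apply: bigcup_open => n _; have [] := HOC n.
    have cC n : closed (C n) by apply: closed_bigsetU => k _; have [] := HOC k.
    have CE n : C n = \bigcup_(k < n) (OC k).2.
      by rewrite (bigcup_mkord n (fun k => (OC k).2)).
    have mD n : measurable (O `\` C n : set (mR3 R)).
      by apply: measurableD; [exact: mO|exact: mC].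
    have mDn n : measurable ((OC n).1 `\` (OC n).2 : set (mR3 R)).
      by have [? ? _ _ _] := HOC n; apply: measurableD; [exact: mO|exact: mC].
    (* A countable union of closed sets need not be closed, so only finitely many are kept;
       continuity from above tells how many suffice. *)
    have [|||n] := @nonincreasing_measure_le _ _ m (fun n => O `\` C n) (e / 2) (e / 2) mD.
    + move=> k l kl; apply/subsetPset; apply: setDS => x.
      rewrite !CE => -[i /= ik Cx]; exists i => //=.
      exact: leq_trans ik kl.
    + apply: (@le_trans _ _ (m (\bigcup_n ((OC n).1 `\` (OC n).2)))).
        apply: le_measure; rewrite ?inE.
        - exact: bigcapT_measurable.
        - exact: bigcupT_measurable.
        move=> x H; have [[k _ Ox] _] := H 0%N I; exists k => //; split => // Cx.
        have [_] := H k.+1 I; apply; rewrite CE; exists k => //=.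
      apply: le_trans.
        apply: (measure_sigma_subadditive m mDn) => //.
        exact: bigcupT_measurable.
      apply: (le_trans _ (epsilon_trick0 xpredT (ltW _))); last by rewrite divr_gt0.
      by apply: lee_nneseries => // n _; have [] := HOC n.
    + by rewrite divr_gt0.
    move=> mn; exists O, (C n); split => //.
    + move=> x; rewrite CE => -[k _ Cx]; exists k => //.
      by have [_ _ + _ _] := HOC k; apply.
    + move=> x [k _ Fx]; exists k => //.
      by have [_ _ _ + _] := HOC k; apply.
    + by apply: (le_trans mn); rewrite lee_fin; lra.
move=> _ [p [q ->]] e e0; set O := box p q.
have oO : open O by exact: open_box.
have innerO k : inner O k `<=` O.
  by move=> x; apply; apply: ballxx; rewrite invr_gt0.
have [|||//|n mn] := @nonincreasing_measure_le _ _ m (fun n => O `\` inner O n) 0 e.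
- by move=> n; apply: measurableD; [exact: mO|apply: mC; exact: closed_inner].
- move=> k l kl; apply/subsetPset; apply: setDS => x; apply: subset_trans.
  by apply: le_ball; rewrite lef_pV2 ?posrE// ler_nat.
- rewrite (_ : \bigcap_n _ = set0) ?measure0//; apply/seteqP; split => // x H.
  have [Ox _] := H 0%N I; have := open_nbhs_nbhs (conj oO Ox).
  move=> /nbhs_ballP[r /= r0 rO].
  have [k _ /(_ k (leqnn k)) kr] := near_infty_natSinv_lt (PosNum r0).
  have [_] := H k I; apply; apply: subset_trans rO.
  by apply: le_ball; exact: ltW kr.
by exists O, (inner O n); split => //; [exact: closed_inner|rewrite add0r in mn].
Qed.

(** Lebesgue measure cut off to a ball is finite, hence outer regular: an open set of nearly the
    same Lebesgue measure carries the bound over to [A] inside the ball. Continuity from below then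
    removes the ball. *)
Lemma le_measure_open (m : {measure set (mR3 R) -> \bar R}) (c : R) : 0 <= c ->
  (forall O, open O -> (m O <= c%:E * mu O)%E) ->
  forall A, measurable (A : set (mR3 R)) -> (m A <= c%:E * mu A)%E.
Proof.
move=> c0 mO A mA.
pose B n : set (R3 R) := ball 0 n.+1%:R.
have mB n : measurable (B n : set (mR3 R)) by exact: measurable_ball3.
have Blty n : (mu (B n) < +oo)%E by rewrite leb3_ball ?ltry.
have AB n : (m (A `&` B n) <= c%:E * mu A)%E.
  apply: (@le_trans _ _ (c%:E * mu (A `&` B n))%E); last first.
    by apply: lee_wpmul2l; [rewrite lee_fin|exact: measureIl].
  have restr_fin : fin_num_fun (mrestr mu (mB n)).
    apply: lty_fin_num_fun => /=.
    by rewrite /mrestr setTI; exact: Blty.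
  pose m' : {finite_measure set (mR3 R) -> \bar R} :=
    HB.pack (mrestr mu (mB n)) (Measure_isFinite.Build _ _ _ (mrestr mu (mB n)) restr_fin).
  have mAB : measurable (A `&` B n : set (mR3 R)) by exact: measurableI.
  have ABoo : (mu (A `&` B n) < +oo)%E by apply: le_lt_trans (Blty n); exact: measureIr.
  have ABfin : mu (A `&` B n) \is a fin_num by rewrite ge0_fin_numE.
  rewrite -(fineK ABfin) -EFinM; apply/lee_addgt0Pr => e e0.
  (* With [c + 1] in place of [c] the case [c = 0] is covered, and the excess costs
     [c * (e / (c + 1)) <= e]. *)
  have e'0 : 0 < e / (c + 1) by rewrite divr_gt0// ltr_wpDl.
  have [U0 [C [oU cC CA AU me]]] := finite_measure_regular m' mA e'0.
  have mU : measurable (U0 : set (mR3 R)) by exact: open_measurable3.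
  have mC : measurable (C : set (mR3 R)) by exact: closed_measurable3.
  have oUB : open (U0 `&` B n) by apply: openI => //; exact: ball_open.
  have mUB : measurable (U0 `&` B n : set (mR3 R)) by exact: measurableI.
  have mUCB : measurable ((U0 `\` C) `&` B n : set (mR3 R)).
    by apply: measurableI => //; exact: measurableD.
  apply: (@le_trans _ _ (m (U0 `&` B n))).
    by apply: le_measure; rewrite ?inE//; exact: setSI.
  apply: (le_trans (mO _ oUB)).
  apply: (@le_trans _ _ (c%:E * (mu (A `&` B n) + (e / (c + 1))%:E))%E).
    apply: lee_wpmul2l; first by rewrite lee_fin.
    apply: (@le_trans _ _ (mu ((A `&` B n) `|` ((U0 `\` C) `&` B n)))).
      apply: le_measure; rewrite ?inE//; first exact: measurableU.
      move=> x [Ux Bx]; have [Ax|nAx] := pselect (A x); [by left|right].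
      by split=> //; split=> // /CA.
    apply: le_trans; first exact: (measureU2 mu mAB mUCB).
    by apply: leeD2l; exact: me.
  rewrite -(fineK ABfin) -EFinD -!EFinM lee_fin mulrDr lerD2l.
  rewrite mulrCA ger_pMr// ler_pdivrMr ?mul1r ?ltr_wpDl//.
  by rewrite lerDl.
have ndAB : nondecreasing_seq (fun n => A `&` B n).
  move=> k l kl; apply/subsetPset; apply: setIS; apply: le_ball.
  by rewrite ler_nat.
have AE : A = \bigcup_n (A `&` B n).
  apply/seteqP; split => [x Ax|x [n _ []]//]; exists (Num.truncn `|x|) => //.
  by split => //; rewrite /B -ball_normE /ball_ /= sub0r normrN truncnS_gt.
have mAB n : measurable (A `&` B n : set (mR3 R)) by exact: measurableI.
have mABU : measurable (\bigcup_n (A `&` B n) : set (mR3 R)).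
  exact: bigcupT_measurable.
rewrite [X in m X]AE.
apply: (@closed_cvg _ _ _ _ _ (fun z => z <= c%:E * mu A)%E _ _ _
  (nondecreasing_cvg_mu mAB mABU ndAB)).
  exact: closed_ereal_ge_ereal.
exact: nearW.
Qed.

End regularity.

(** * Smooth bump functions *)

Section smooth1.
Context {R : realType}.
Implicit Types (f g : R -> R) (x c d : R).

(** Each derivative is supplied as a witness, so that the closure properties are inductions on the
    order with an explicit formula at each step. *)
Fixpoint nsmooth n f : Prop := if n is n'.+1 then
  exists2 f', (forall x, is_derive x (1 : R) f (f' x)) & nsmooth n' f' else True.

Definition smooth f : Prop := forall n, nsmooth n f.

Lemma nsmoothS n f : nsmooth n.+1 f -> nsmooth n f.
Proof. by elim: n f => [//|n IH] f [f' df /IH]; exists f'. Qed.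

Lemma nsmooth_cst n c : nsmooth n (cst c).
Proof.
by elim: n c => [//|n IH] c; exists (cst 0) => // x; exact: is_derive_cst.
Qed.

Lemma nsmoothD n f g : nsmooth n f -> nsmooth n g -> nsmooth n (fun x => f x + g x).
Proof.
elim: n f g => [//|n IH] f g [f' df sf] [g' dg sg].
by exists (fun x => f' x + g' x); [move=> x; exact: is_deriveD|exact: IH].
Qed.

Lemma nsmoothM n f g : nsmooth n f -> nsmooth n g -> nsmooth n (fun x => f x * g x).
Proof.
elim: n f g => [//|n IH] f g sf sg.
have [[f' df sf'] [g' dg sg']] := (sf, sg).
exists (fun x => f x * g' x + g x * f' x).
  by move=> x; apply: is_derive_eq (is_deriveM _ _) _; rewrite -?[_ *: _]/(_ * _).
by apply: nsmoothD; apply: IH => //; exact: nsmoothS.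
Qed.

Lemma nsmooth_affine n f c d : nsmooth n f -> nsmooth n (fun x => f (c * x + d)).
Proof.
elim: n f => [//|n IH] f [f' df sf].
exists (fun x => c * f' (c * x + d)); last by apply: nsmoothM; [exact: nsmooth_cst|exact: IH].
move=> x.
have dg : is_derive x (1 : R) (fun y => c * y + d) c.
  have := is_deriveD (is_deriveM (is_derive_cst c x 1) (is_derive_id x (1:R))) (is_derive_cst d x 1).
  move=> h; apply: is_derive_eq h _.
  by rewrite -![_ *: _]/(_ * _) mulr0 !addr0 mulr1.
have h := @is_derive1_comp R f (fun y => c * y + d) x (f' (c * x + d)) c (df _) dg.
by apply: DeriveDef; [exact: (@ex_derive _ _ _ _ _ _ _ h)|rewrite (@derive_val _ _ _ _ _ _ _ h) mulrC].
Qed.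

Lemma smooth_derivable f x : smooth f -> derivable f x 1.
Proof. by move=> /(_ 1%N)[f' df _]; have [] := df x. Qed.

Lemma smooth_derive1 f : smooth f -> smooth (derive1 f).
Proof.
move=> sf n; have [f' df sf'] := sf n.+1.
suff -> : (derive1 f) = f' by [].
by apply/funext => x; rewrite derive1E; have [] := df x.
Qed.

Lemma smooth_continuous f : smooth f -> continuous f.
Proof.
by move=> sf x; apply: differentiable_continuous; apply/derivable1_diffP; exact: smooth_derivable.
Qed.

Lemma smooth_primitive f F : smooth f -> (forall x, is_derive x (1 : R) F (f x)) ->
  smooth F.
Proof. by move=> sf dF [//|n]; exists f. Qed.

(* The derivative of each function is a linear combination of two others, which
   gives smoothness by induction. *)
Definition flat k x : R := if 0 < x then x ^- k * expR (- x^-1) else 0.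

Lemma flat_ge0 k x : 0 <= flat k x.
Proof.
rewrite /flat; case: ifPn => // x0.
by rewrite mulr_ge0 ?expR_ge0// invr_ge0 exprn_ge0// ltW.
Qed.

Lemma flat0_le1 x : flat 0 x <= 1.
Proof.
rewrite /flat; case: ifPn => // x0.
by rewrite expr0 invr1 mul1r -expR0 ler_expR oppr_le0 invr_ge0 ltW.
Qed.

(** From [expR y >= y ^+ n / n!] at [y = x^-1] and [n = k + m + 1]. For [m = 1] it makes [flat k]
    differentiable at the origin. *)
Lemma flat_le k m x : 0 < x -> flat k x <= (k + m).+1`!%:R * x ^+ m.+1.
Proof.
move=> x0; rewrite /flat x0.
have y0 : 0 <= x^-1 by rewrite invr_ge0 ltW.
have fp : (0 : R) < ((k + m).+1)`!%:R by rewrite ltr0n fact_gt0.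
have H : x^-1 ^+ (k + m).+1 / (k + m).+1`!%:R <= expR x^-1.
  by apply: le_trans (expR_ge1Dxn (k + m) y0); rewrite lerDr.
have H2 : expR (- x^-1) <= ((k + m).+1)`!%:R * x ^+ (k + m).+1.
  rewrite expRN -[leRHS]invrK lef_pV2 ?posrE ?expR_gt0 ?invr_gt0 ?mulr_gt0 ?exprn_gt0//.
  by rewrite invfM -exprVn mulrC.
have xk : 0 < x ^+ k by rewrite exprn_gt0.
rewrite mulrC ler_pdivrMr// (le_trans H2)// -mulrA -exprD.
by rewrite addSn addnC.
Qed.

Lemma is_derive_inv f df x : f x != 0 -> is_derive x (1 : R) f df ->
  is_derive x (1 : R) (fun y => (f y)^-1) (- (f x) ^- 2 * df).
Proof.
move=> f0 [dfx <-]; apply: DeriveDef; first exact: derivableV.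
exact: deriveV.
Qed.

Lemma is_derive_flat k x :
  is_derive x (1 : R) (flat k) (- k%:R * flat k.+1 x + flat k.+2 x).
Proof.
have [x0|x0|->] := ltgtP x 0.
- have nx : ~~ (0 < x) by rewrite -leNgt ltW.
  rewrite {2 3}/flat (negbTE nx) mulr0 addr0.
  apply: (@near_eq_is_derive _ _ _ (cst 0)).
  near=> y; rewrite /flat ifN// -leNgt ltW//; near: y; exact: lt_nbhsl.
- rewrite {2 3}/flat x0.
  have xn0 : x != 0 by rewrite gt_eqF.
  have dN : is_derive x (1:R) (fun y : R => - y^-1) (x ^- 2).
    apply: is_derive_eq (is_deriveN (is_derive_inv xn0 (is_derive_id x (1:R)))) _.
    by rewrite mulr1 opprK.
  have dk : is_derive x (1:R) (fun y : R => y ^- k) (- k%:R * x ^- k.+1).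
    have xk0 : x ^+ k != 0 by rewrite expf_neq0.
    have h : is_derive x (1:R) (fun y : R => y ^+ k) (k%:R * x ^+ k.-1).
      apply: DeriveDef; first exact: exprn_derivable.
      by rewrite exp_derive [_ *: _]mulr1.
    apply: is_derive_eq (is_derive_inv (f := fun y => y ^+ k) xk0 h) _.
    case: (k) => [|l]; first by rewrite !mul0r oppr0 !mul0r mulr0.
    by rewrite /= !exprS; field; rewrite expf_neq0 ?andbT.
  have de : is_derive x (1:R) (fun y => expR (- y^-1)) (expR (- x^-1) * x ^- 2).
    exact: (@is_derive1_comp R expR (fun y => - y^-1) x _ _ (is_derive_expR _) dN).
  have dF : is_derive x (1:R) (fun y => y ^- k * expR (- y^-1))
      (- k%:R * (x ^- k.+1 * expR (- x^-1)) + x ^- k.+2 * expR (- x^-1)).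
    apply: is_derive_eq (is_deriveM dk de) _.
    rewrite -![_ *: _]/(_ * _) !exprS; field.
    by rewrite expf_neq0 ?andbT.
  apply: (near_eq_is_derive _ dF).
  by near=> y; rewrite /flat ifT//; near: y; exact: lt_nbhsr.
- rewrite {2 3}/flat ltxx mulr0 addr0.
  (* The quotient vanishes for negative [h], and for positive [h] it is at most a constant times
     [h], by [flat_le] with [m = 1]. *)
  have H : h^-1 *: (flat k (h *: (1:R) + 0) - flat k 0) @[h --> 0^'] --> (0:R).
    apply/cvgr0Pnorm_lt => e e0.
    have fp : (0 : R) < ((k + 1).+1)`!%:R by rewrite ltr0n fact_gt0.
    near=> h; rewrite [flat k 0]/flat ltxx subr0 addr0 [h *: _]mulr1 -[_ *: _]/(_ * _).
    have [h0|h0] := ltP 0 h; last by rewrite /flat ifN -?leNgt// mulr0 normr0.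
    rewrite ger0_norm ?mulr_ge0 ?invr_ge0 ?flat_ge0 ?(ltW h0)//.
    rewrite mulrC ltr_pdivrMr// (le_lt_trans (flat_le k 1 h0))//.
    rewrite expr2 mulrA ltr_pM2r// mulrC -ltr_pdivlMr//.
    rewrite -(ger0_norm (ltW h0)).
    by near: h; apply: dnbhs0_lt; rewrite divr_gt0.
  apply: DeriveDef; first by apply/cvg_ex; exists 0.
  exact: cvg_lim H.
Unshelve. all: by end_near.
Qed.

Lemma smooth_flat k : smooth (flat k).
Proof.
move=> n; elim: n k => [//|n IH] k; exists (fun x => - k%:R * flat k.+1 x + flat k.+2 x).
  by move=> x; exact: is_derive_flat.
by apply: nsmoothD => //; apply: nsmoothM => //; exact: nsmooth_cst.
Qed.

(* Increases with n to the indicator function of the open interval. *)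
Definition bump (p q : R) n x := flat 0 (n.+1%:R * (x - p)) * flat 0 (n.+1%:R * (q - x)).

Lemma smooth_bump p q n : smooth (bump p q n).
Proof.
have -> : bump p q n = fun x => flat 0 (n.+1%:R * x + n.+1%:R * (- p)) *
    flat 0 (- n.+1%:R * x + n.+1%:R * q).
  apply/funext => x; congr (flat _ _ * flat _ _); first by rewrite mulrBr mulrN.
  by rewrite mulrBr mulNr addrC.
by move=> m; apply: nsmoothM; apply: nsmooth_affine; exact: smooth_flat.
Qed.

Lemma bump_ge0 p q n x : 0 <= bump p q n x.
Proof. by rewrite mulr_ge0// flat_ge0. Qed.

Lemma bump_le1 p q n x : bump p q n x <= 1.
Proof. by rewrite mulr_ile1 ?flat_ge0 ?flat0_le1. Qed.

Lemma bump_out p q n x : x \notin `]p, q[ -> bump p q n x = 0.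
Proof.
rewrite in_itv /= negb_and -!leNgt /bump => /orP[xp|qx].
  by rewrite /flat ifN ?mul0r// -leNgt pmulr_rle0// subr_le0.
by rewrite mulrC /flat ifN ?mul0r// -leNgt pmulr_rle0// subr_le0.
Qed.

Lemma bump_cvg p q x : bump p q n x @[n --> \oo] --> (\1_(`]p, q[ : set R) x : R).
Proof.
rewrite indicE; have [|xpq] := boolP (x \in (`]p, q[%classic : set R)); last first.
  rewrite (_ : (fun n => _) = cst 0); first exact: cvg_cst.
  apply/funext => n; rewrite bump_out//; apply: contra xpq => xpq.
  by rewrite inE.
rewrite inE /= in_itv /= => /andP[px xq].
have flat_cvg d : 0 < d -> flat 0 (n.+1%:R * d) @[n --> \oo] --> (1 : R).
  move=> d0; rewrite (_ : (fun n => _) = fun n => expR (- (d^-1 * n.+1%:R^-1))); last first.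
    by apply/funext => n; rewrite /flat pmulr_rgt0// d0 expr0 invr1 mul1r invfM mulrC.
  have H : - (d^-1 * n.+1%:R^-1) @[n --> \oo] --> (0 : R).
    rewrite -oppr0 -(mulr0 d^-1); apply: cvgN; apply: cvgM; first exact: cvg_cst.
    exact: cvg_harmonic.
  by rewrite -[X in _ --> X]expR0; apply: continuous_cvg; [exact: continuous_expR|exact: H].
by rewrite -[X in _ --> X](mulr1 1); apply: cvgM; apply: flat_cvg; rewrite subr_gt0.
Qed.

(** The integral from [p - 1] vanishes up to [p], so it is locally zero at and to the left of its
    base point; to the right of that point the fundamental theorem of calculus applies. *)
Lemma continuous_primitive f (p : R) : continuous f -> (forall x, x <= p -> f x = 0) ->
  exists F : R -> R, forall x, is_derive x (1 : R) F (f x).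
Proof.
move=> cf f0.
pose F x : R := (\int[lebesgue_measure]_(t in `[p - 1, x]) f t)%R.
have F0 x : x <= p -> F x = 0.
  move=> xp; rewrite /F (@eq_Rintegral _ _ _ _ _ (cst 0)) ?Rintegral_cst ?mul0r//.
  move=> y; rewrite inE /= in_itv /= => /andP[_ yx]; rewrite f0//; exact: le_trans yx xp.
exists F => x; have [px|xp] := ltP (p - 1) x.
  have := @continuous_FTC1_closed R f (p - 1) x (x + 1).
  rewrite ltrDl ltr01 => /(_ isT _ px (cf x)) [].
    apply: continuous_compact_integrable; first exact: segment_compact.
    exact: continuous_subspaceT.
  by move=> dF dFE; apply: DeriveDef; [exact: dF|rewrite -derive1E; exact: dFE].
have xp' : x < p by rewrite (le_lt_trans xp)// gtrBl.
rewrite f0 ?(ltW xp')//.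
have dc : is_derive x (1:R) (cst 0 : R -> R) (0:R) by exact: is_derive_cst.
apply: (near_eq_is_derive _ dc).
by near=> y; rewrite /= F0// ltW//; near: y; exact: lt_nbhsl.
Unshelve. all: by end_near.
Qed.

End smooth1.

(** * Tensor products as test functions *)

Section tensor.
Context {R : realType}.
Implicit Types (x y v : R3 R) (a b : 'I_3 -> R -> R) (i j : 'I_3).

Lemma ord3_ind (P : 'I_3 -> Prop) : P ord0 -> P (inord 1) -> P ord_max -> forall i, P i.
Proof.
move=> P0 P1 P2 [[|[|[|//]]] k].
- by rewrite (_ : Ordinal k = ord0)//; exact/val_inj.
- by rewrite (_ : Ordinal k = inord 1)//; apply/val_inj; rewrite /= inordK.
- by rewrite (_ : Ordinal k = ord_max)//; exact/val_inj.
Qed.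

Lemma inord1_eq0 : (inord 1 == ord0 :> 'I_3) = false.
Proof. by rewrite -val_eqE /= inordK. Qed.

Lemma inord1_eq2 : (inord 1 == ord_max :> 'I_3) = false.
Proof. by rewrite -val_eqE /= inordK. Qed.

Lemma coordE x : (coord ord0 x = x.1.1) * (coord (inord 1) x = x.1.2) * (coord ord_max x = x.2).
Proof. by rewrite /coord inord1_eq0 inord1_eq2 !eqxx. Qed.

Lemma coord_vec3 i f : coord i (vec3 f : R3 R) = f i.
Proof. by elim/ord3_ind: i; rewrite coordE. Qed.

Lemma coord_basis3 i j : coord i (basis3 j : R3 R) = (i == j)%:R.
Proof. exact: coord_vec3. Qed.

Lemma coordD i x y : coord i (x + y) = coord i x + coord i y.
Proof. by elim/ord3_ind: i; rewrite !coordE. Qed.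

Lemma coordZ i (t : R) x : coord i (t *: x) = t * coord i x.
Proof. by elim/ord3_ind: i; rewrite !coordE. Qed.

Lemma coord_shift i j (t : R) x :
  coord i (x + t *: basis3 j) = coord i x + t *+ (i == j).
Proof. by rewrite coordD coordZ coord_basis3; case: eqP; rewrite ?mulr1// mulr0. Qed.

Let coord_is_linear i : linear (coord i : R3 R -> R).
Proof. by move=> t x y; rewrite coordD coordZ. Qed.

HB.instance Definition _ i := GRing.isLinear.Build R (R * R * R)%type R _ (coord i) (coord_is_linear i).

Lemma normr_coord i x : `|coord i x| <= `|x|.
Proof.
case: x => -[x1 x2] x3; rewrite /Num.norm/=.
by elim/ord3_ind: i; rewrite coordE /= !le_max lexx ?orbT.
Qed.

Lemma continuous_coord i : continuous (coord i : R3 R -> R).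
Proof.
move=> x; apply/cvgrPdist_lt => e e0; near=> y.
by rewrite -raddfB (le_lt_trans (normr_coord _ _))//; near: y; exact: cvgr_dist_lt.
Unshelve. all: by end_near.
Qed.

Lemma differentiable_coord3 i x : differentiable (coord i : R3 R -> R) x.
Proof. by apply: linear_differentiable; exact: continuous_coord. Qed.

Lemma is_derive_coord_comp (f : R -> R) i x v : derivable f (coord i x) 1 ->
  differentiable (f \o coord i) x /\
  'D_v (f \o coord i) x = derive1 f (coord i x) * coord i v.
Proof.
move=> /derivable1_diffP df.
have dc := differentiable_coord3 i x.
have dfc : differentiable (f \o coord i) x by exact: differentiable_comp.
split => //; rewrite deriveE// diff_comp//= diff_lin; last exact: continuous_coord.
rewrite deriv1E; last exact/derivable1_diffP.
by rewrite -[LHS]/(_ * _) mulrC.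
Qed.

(** Partial derivatives act on a single factor ([derive_tensor]), so products stay products at every
    order and smoothness reduces to one variable. *)
Definition tensor a x := a ord0 (coord ord0 x) * a (inord 1) (coord (inord 1) x) *
  a ord_max (coord ord_max x).

Definition derive_tensor i a : 'I_3 -> R -> R :=
  fun j => if j == i then derive1 (a j) else a j.

Lemma smooth_derive_tensor i a : (forall j, smooth (a j)) ->
  forall j, smooth (derive_tensor i a j).
Proof. by move=> sa j; rewrite /derive_tensor; case: ifP => // _; exact: smooth_derive1. Qed.

Lemma derive_tensorE i a x : (forall j, smooth (a j)) ->
  differentiable (tensor a) x /\
  'D_(basis3 i) (tensor a) x = tensor (derive_tensor i a) x.
Proof.
move=> sa.
have H j v := is_derive_coord_comp v (smooth_derivable (x := coord j x) (sa j)).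
have [d0 D0] := H ord0 (basis3 i).
have [d1 D1] := H (inord 1) (basis3 i).
have [d2 D2] := H ord_max (basis3 i).
have -> : tensor a = ((a ord0 \o coord ord0) * (a (inord 1) \o coord (inord 1))) * (a ord_max \o coord ord_max).
  by [].
have d01 := differentiableM d0 d1.
split; first exact: differentiableM.
rewrite deriveM; [|exact/diff_derivable..].
rewrite deriveM; [|exact/diff_derivable..].
rewrite D0 D1 D2 !coord_basis3 /tensor /derive_tensor -![_ *: _]/(_ * _) !fctE /=.
elim/ord3_ind: i {H D0 D1 D2}; rewrite ?eqxx ?inord1_eq0 ?inord1_eq2 ?[_ == inord 1]eq_sym ?inord1_eq0 ?inord1_eq2 /=; ring.
Qed.

Lemma pderiv_tensor w a : (forall j, smooth (a j)) ->
  exists2 b, (forall j, smooth (b j)) & pderiv w (tensor a) = tensor b.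
Proof.
move=> sa; elim: w => [|i w [b sb bE]]; first by exists a.
exists (derive_tensor i b); first exact: smooth_derive_tensor.
by rewrite /= bE; apply/funext => x; have [] := derive_tensorE i x sb.
Qed.

Lemma pderiv_tensor1 i a : (forall j, smooth (a j)) ->
  pderiv [:: i] (tensor a) = tensor (derive_tensor i a).
Proof. by move=> sa; apply/funext => x; have [] := derive_tensorE i x sa. Qed.

Lemma derive_tensorC i j a :
  derive_tensor i (derive_tensor j a) = derive_tensor j (derive_tensor i a).
Proof.
apply/funext => k; rewrite /derive_tensor.
by case: ifP => //; case: ifP.
Qed.

Lemma pderiv_tensor2 i j a : (forall k, smooth (a k)) ->
  pderiv [:: i; j] (tensor a) = tensor (derive_tensor i (derive_tensor j a)).
Proof.
move=> sa; rewrite -pderiv_tensor1; last exact: smooth_derive_tensor.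
by rewrite -pderiv_tensor1.
Qed.

Definition cbox x y : set (R3 R) :=
  (`[x.1.1, y.1.1] `*` `[x.1.2, y.1.2]) `*` `[x.2, y.2].

Lemma compact_cbox x y : compact (cbox x y).
Proof. by apply: compact_setX; [apply: compact_setX|]; exact: segment_compact. Qed.

Lemma cboxE x y z : cbox x y z <-> forall i, coord i x <= coord i z <= coord i y.
Proof.
split=> [[[]]|H].
  by rewrite /= !in_itv /= => H0 H1 H2; elim/ord3_ind; rewrite !coordE.
have := H ord0; have := H (inord 1); have := H ord_max; rewrite !coordE => h1 h2 h3.
by split; [split|]; rewrite /= in_itv.
Qed.

Lemma boxE x y z : box x y z <-> forall i, coord i x < coord i z < coord i y.
Proof.
split=> [[[]]|H].
  by rewrite /= !in_itv /= => H0 H1 H2; elim/ord3_ind; rewrite !coordE.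
have := H ord0; have := H (inord 1); have := H ord_max; rewrite !coordE => h1 h2 h3.
by split; [split|]; rewrite /= in_itv.
Qed.

Lemma box_cbox x y : box x y `<=` cbox x y.
Proof.
by move=> z /boxE H; apply/cboxE => i; have /andP[/ltW -> /ltW ->] := H i.
Qed.

Lemma tensor_test_function (D : set (R3 R)) a x y : (forall j, smooth (a j)) ->
  (forall j t, t \notin `[coord j x, coord j y] -> a j t = 0) ->
  cbox x y `<=` D -> test_function D (tensor a).
Proof.
move=> sa a0 xyD; split.
  move=> w z _; have [b sb ->] := pderiv_tensor w sa.
  by have [] := derive_tensorE ord0 z sb.
exists (cbox x y); split => //; first exact: compact_cbox.
move=> z /cboxE/existsNP[j nj].
have aj : a j (coord j z) = 0 by apply: a0; rewrite in_itv /=; apply/negP.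
by rewrite /tensor; elim/ord3_ind: j aj {nj} => ->; rewrite !(mulr0,mul0r).
Qed.

End tensor.

(** * Weak derivatives *)

Section fundamental_lemma.
Context {R : realType}.
Implicit Types (x y v p q : R3 R) (a b : 'I_3 -> R -> R) (i j : 'I_3).
Implicit Types (D K A : set (R3 R)) (u g F : R3 R -> R).
Local Notation mu := (@leb3 R).

Lemma nbhs_cbox x A : nbhs x A -> exists p q, box p q x /\ cbox p q `<=` A.
Proof.
move=> /nbhs_ballP[e /= e0 eA].
pose d : R3 R := vec3 (fun=> e / 2).
have dE i : coord i d = e / 2 by rewrite coord_vec3.
exists (x - d), (x + d); split.
  by apply/boxE => i; rewrite raddfB raddfD /= dE; apply/andP; split; lra.
move=> y /cboxE H; apply: eA; rewrite ball3E.
have {}H i : ball (coord i x) e (coord i y).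
  have := H i; rewrite raddfB raddfD /= dE => /andP[? ?].
  by rewrite /ball /= ltr_distl; apply/andP; split; lra.
by have := H ord0; have := H (inord 1); have := H ord_max; rewrite !coordE; split; [split|].
Qed.

Lemma measurable_cbox p q : measurable (cbox p q : set (mR3 R)).
Proof. by apply: measurableX => //; apply: measurableX. Qed.

(** [D] is covered by countably many rational cubes, each inside a compact subset of [D], and
    integrability on the compact set includes measurability. *)
Lemma loc_integrable_measurable D u : open D -> loc_integrable D u -> measurable_on D u.
Proof.
move=> oD iu mD Y mY.
pose I := [set i : rat * rat * rat * nat | exists2 K, compact K & rational_cube i `<=` K /\ K `<=` D].
have -> : D `&` u @^-1` Y = \bigcup_(i in I) (rational_cube i `&` u @^-1` Y).
  apply/seteqP; split => [x [Dx Yx]|x [i [K cK [iK KD]] [ix Yx]]]; last first.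
    by split => //; apply: KD; exact: iK.
  have [p [q [pqx pqD]]] := nbhs_cbox (open_nbhs_nbhs (conj oD Dx)).
  have [i [ix ipq]] := rational_cube_nbhs (open_nbhs_nbhs (conj (@open_box R p q) pqx)).
  exists i => //; exists (cbox p q); first exact: compact_cbox.
  by split => //; apply: (subset_trans ipq); exact: box_cbox.
rewrite bigcup_mkcond; apply: countable_bigcupT_measurable => // i.
case: ifPn => // /set_mem[K cK [iK KD]].
have /integrableP[/measurable_EFinP mu_ _] := iu K cK KD.
have := mu_ (compact_measurable3 cK) Y mY.
rewrite (_ : rational_cube i `&` _ = rational_cube i `&` (K `&` u @^-1` Y)).
  by move=> ?; apply: measurableI => //; exact: measurable_ball3.
by rewrite setIA (setIidl iK).
Qed.

Definition bump3 p q n : R3 R -> R := tensor (fun i => bump (coord i p) (coord i q) n).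

Lemma bump3_ge0 p q n x : 0 <= bump3 p q n x.
Proof. by apply: mulr_ge0; [apply: mulr_ge0|]; exact: bump_ge0. Qed.

Lemma bump3_le1 p q n x : bump3 p q n x <= 1.
Proof.
by apply: mulr_ile1; rewrite ?bump_ge0 ?bump_le1//;
  [apply: mulr_ge0|apply: mulr_ile1]; rewrite ?bump_ge0 ?bump_le1.
Qed.

Lemma bump3_out p q n x : ~ box p q x -> bump3 p q n x = 0.
Proof.
move=> /boxE/existsNP[j nj].
have bj : bump (coord j p) (coord j q) n (coord j x) = 0.
  by apply: bump_out; rewrite in_itv /=; apply/negP.
by rewrite /bump3 /tensor; elim/ord3_ind: j bj {nj} => ->; rewrite !(mulr0,mul0r).
Qed.

Lemma continuous_tensor a : (forall j, smooth (a j)) -> continuous (tensor a).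
Proof. by move=> sa x; apply: differentiable_continuous; have [] := derive_tensorE ord0 x sa. Qed.

Lemma continuous_measurable3 u : continuous u -> measurable_on setT u.
Proof.
by move=> cu; apply: within_continuous_measurable_fun => //; exact: continuous_subspaceT.
Qed.

Lemma measurable_bump3 p q n : measurable_on setT (bump3 p q n).
Proof.
by apply: continuous_measurable3; apply: continuous_tensor => j; exact: smooth_bump.
Qed.

Lemma bump3_cvg p q x : bump3 p q n x @[n --> \oo] --> (\1_(box p q) x : R).
Proof.
have -> : \1_(box p q) x = \1_(`]coord ord0 p, coord ord0 q[ : set R) (coord ord0 x)
   * \1_(`]coord (inord 1) p, coord (inord 1) q[ : set R) (coord (inord 1) x)
   * \1_(`]coord ord_max p, coord ord_max q[ : set R) (coord ord_max x) :> R.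
  by rewrite !indicE /box !in_setX !coordE -!natrM !mulnb.
by apply: cvgM; [apply: cvgM|]; exact: bump_cvg.
Qed.

Lemma boxI_cbox p q p' q' : exists p'' q'',
  box p q `&` box p' q' = box p'' q'' /\ cbox p'' q'' `<=` cbox p q.
Proof.
exists (vec3 (fun i => Num.max (coord i p) (coord i p'))).
exists (vec3 (fun i => Num.min (coord i q) (coord i q'))).
split; [apply/seteqP; split => x|move=> x /cboxE H; apply/cboxE => i].
- move=> [/boxE h /boxE h']; apply/boxE => i; rewrite !coord_vec3 gt_max lt_min.
  by have /andP[-> ->] := h i; have /andP[-> ->] := h' i.
- move=> /boxE H; split; apply/boxE => i; have := H i;
  by rewrite !coord_vec3 gt_max lt_min => /andP[/andP[? ?] /andP[? ?]]; apply/andP.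
- by have := H i; rewrite !coord_vec3 ge_max le_min => /andP[/andP[-> _] /andP[-> _]].
Qed.

(** The bumps converge to the indicator of the box and are at most 1, so that [F] itself is a
    dominating function on the closed box. *)
Lemma fundamental_lemma_box D F p q : open D -> loc_integrable D F ->
  (forall n, (\int[mu]_(x in D) (F x * bump3 p q n x)%:E = 0)%E) ->
  cbox p q `<=` D -> (\int[mu]_(x in box p q) (F x)%:E = 0)%E.
Proof.
move=> oD iF F0 pqD.
have iFK := iF _ (@compact_cbox R p q) pqD.
have mFK : measurable_fun (cbox p q : set (mR3 R)) F.
  by have /integrableP[/measurable_EFinP] := iFK.
have mK := measurable_cbox p q.
have bK : box p q `<=` cbox p q := @box_cbox R p q.
have E1 n : (\int[mu]_(x in cbox p q) (F x * bump3 p q n x)%:E = 0)%E.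
  rewrite -(F0 n) [RHS]integral_mkcond [LHS]integral_mkcond; apply: eq_integral => x _.
  rewrite !patchE; case: ifPn => [/set_mem Kx|nKx].
    by rewrite ifT// inE; exact: pqD.
  case: ifPn => // _; rewrite bump3_out ?mulr0// => /bK.
  by move/mem_set; rewrite (negbTE nKx).
have mB n : measurable_fun (cbox p q : set (mR3 R)) (bump3 p q n).
  by apply: (@measurable_funS _ _ _ _ setT) => //; exact: measurable_bump3.
have [|||||] := @dominated_convergence _ _ _ mu (cbox p q) mK
  (fun n x => (F x * bump3 p q n x)%:E) (fun x => (F x * \1_(box p q) x)%:E)
  (fun x => (`|F x|)%:E).
- by move=> n; apply/measurable_EFinP; apply: measurable_funM.
- apply/measurable_EFinP; apply: measurable_funM => //.
  by apply: measurable_indic; exact: box_measurable.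
- apply: aeW => x _; apply: cvg_EFin; first exact: nearW.
  by apply: cvgM; [exact: cvg_cst|exact: bump3_cvg].
- exact: (integrable_abse iFK).
- apply: aeW => x n _; rewrite lee_fin normrM ler_piMr//.
  by rewrite ger0_norm ?bump3_ge0// bump3_le1.
move=> _ _; rewrite (_ : (fun n => _) = cst 0%E); last by apply/funext => n; exact: E1.
move=> /cvg_lim; rewrite lim_cst// => /(_ _)/esym H.
rewrite -[RHS]H//.
rewrite [LHS]integral_mkcond [RHS]integral_mkcond; apply: eq_integral => x _.
rewrite !patchE indicE; have [xb|] := boolP (x \in box p q).
  by rewrite ifT ?mulr1// inE; apply: bK; rewrite inE in xb.
by rewrite mulr0; case: ifP.
Qed.

(** The sets whose trace on the box has zero integral form a Dynkin system that contains the open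
    boxes, a generating family stable under intersection. A function with zero integral on every
    measurable subset vanishes almost everywhere. *)
Lemma box_ae_eq0 F p0 q0 : mu.-integrable (box p0 q0) (EFin \o F) ->
  (forall p q, cbox p q `<=` cbox p0 q0 -> (\int[mu]_(x in box p q) (F x)%:E = 0)%E) ->
  mu.-negligible [set x | box p0 q0 x /\ F x <> 0].
Proof.
set Q := box p0 q0 => iF F0.
have mQ : measurable (Q : set (mR3 R)) by exact: box_measurable.
have H A : measurable (A : set (mR3 R)) -> (\int[mu]_(x in Q `&` A) (F x)%:E = 0)%E.
  rewrite measurable_boxes; move: A; apply: (@dynkin_induction _ (mR3 R) boxes
    [set A | \int[mu]_(x in Q `&` A) (F x)%:E = 0]%E).
  - exact: measurable_boxes.
  - move=> _ _ [p [q ->]] [p' [q' ->]]; have [p'' [q'' ->]] := boxI p q p' q'.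
    by exists p'', q''.
  - by rewrite /= setIT; exact: F0.
  - move=> _ [p [q ->]]; have [p'' [q'' [E sub]]] := boxI_cbox p0 q0 p q.
    by rewrite /= /Q E; exact: F0.
  - move=> S mS /= SQ; have := F0 _ _ (@subset_refl _ (cbox p0 q0)).
    rewrite -/Q -{1}(setIT Q) -(setUv S) setIUr integral_setU //=.
    + by rewrite SQ add0e.
    + exact: measurableI.
    + by apply: measurableI => //; exact: measurableC.
    + by rewrite -setIUr setUv setIT; have /integrableP[] := iF.
    + apply/disj_setPS => x [[_ Sx] [_]]; exact.
  - move=> Fn mFn tF F0n; rewrite /= setI_bigcupr integral_bigcup.
    + by apply: eseries0 => n _ _; exact: F0n.
    + exact: trivIset_setIl.
    + by move=> k; exact: measurableI.
    + apply: integrableS iF => //; first by rewrite -setI_bigcupr; apply: measurableI => //; exact: bigcupT_measurable.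
      by rewrite -setI_bigcupr; exact: subIsetl.
have : ae_eq mu Q (EFin \o F) (cst 0%E).
  apply: integral_ae_eq => // A AQ mA; rewrite integral0.
  by rewrite -(setIidr AQ); exact: H.
apply: negligibleS => x /= [Qx Fx]; apply/not_implyP; split=> //= -[].
exact: Fx.
Qed.

(** The lemma of du Bois-Reymond, for bumps only: the two previous results on a small box around
    each point, glued by [negligible_locally]. *)
Lemma fundamental_lemma D F : open D -> loc_integrable D F ->
  (forall p q, cbox p q `<=` D -> forall n,
    (\int[mu]_(x in D) (F x * bump3 p q n x)%:E = 0)%E) ->
  mu.-negligible [set x | D x /\ F x <> 0].
Proof.
move=> oD iF F0; apply: negligible_locally => x [Dx Fx].
have [p [q [pqx pqD]]] := nbhs_cbox (open_nbhs_nbhs (conj oD Dx)).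
exists (box p q); first by apply: open_nbhs_nbhs; split => //; exact: open_box.
have : mu.-negligible [set x | box p q x /\ F x <> 0].
  apply: box_ae_eq0 => [|p' q' pqS].
    apply: (integrableS _ _ _ (iF _ (@compact_cbox R p q) pqD)).
    - exact: measurable_cbox.
    - exact: box_measurable.
    - exact: box_cbox.
  have pqD' := subset_trans pqS pqD.
  by apply: (@fundamental_lemma_box D) => //; exact: F0.
by apply: negligibleS => y [[_ Fy] pqy].
Qed.

End fundamental_lemma.

Section bounded_multiplier.
Context d (T : measurableType d) {R : realType} (m : {measure set T -> \bar R}).
Variables (D : set T) (mD : measurable D).

Lemma integrable_bounded_mul (f h : T -> R) C : m.-integrable D (EFin \o f) ->
  measurable_fun D h -> (forall x, D x -> `|h x| <= C) ->
  m.-integrable D (fun x => (f x * h x)%:E).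
Proof.
move=> If mh hC.
apply: (le_integrable mD (g := fun x => (C%:E * (EFin \o f) x)%E)).
- apply/measurable_EFinP; apply: measurable_funM => //.
  by apply/measurable_EFinP; have /integrableP[] := If.
- move=> x Dx /=; rewrite lee_fin !normrM mulrC ler_wpM2r//.
  by rewrite (le_trans (hC x Dx))// ler_norm.
- exact: integrableZl.
Qed.

End bounded_multiplier.

Section weak_partial.
Context {R : realType}.
Implicit Types (x y v p q : R3 R) (a b : 'I_3 -> R -> R) (i j : 'I_3).
Implicit Types (D K A : set (R3 R)) (u g F : R3 R -> R).
Local Notation mu := (@leb3 R).
Local Notation lam := (@lebesgue_measure R).

(* Weaker than [is_wderiv]: only products of one-dimensional functions are
   tested, which is stable under averaging along a line. *)
Definition weak_partial D i u g := [/\ loc_integrable D u, loc_integrable D g &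
  forall a p q, (forall j, smooth (a j)) ->
    (forall j t, t \notin `[coord j p, coord j q] -> a j t = 0) ->
    cbox p q `<=` D ->
    (\int[mu]_(x in D) (u x * tensor (derive_tensor i a) x)%:E =
     - \int[mu]_(x in D) (g x * tensor a x)%:E)%E].

Lemma is_wderiv_weak_partial D i u g : is_wderiv D [:: i] u g -> weak_partial D i u g.
Proof.
move=> [iu ig ug]; split => // a p q sa a0 pqD.
have := ug _ (tensor_test_function sa a0 pqD).
by rewrite pderiv_tensor1// expr1 mulN1e.
Qed.

(** The partial derivatives of a tensor product commute, so either order of the word will do; [word]
    spells each multi-index in one order only. The identity for [u'] is the one for [u], tested with
    an already differentiated function. *)
Lemma is_wderiv2_weak_partial D i j u u' g : is_wderiv D [:: j] u u' ->
  is_wderiv D [:: i; j] u g \/ is_wderiv D [:: j; i] u g ->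
  weak_partial D i u' g.
Proof.
move=> [iu iu' uu'] ug.
have [ig tg] : loc_integrable D g /\ forall a p q, (forall j, smooth (a j)) ->
    (forall j t, t \notin `[coord j p, coord j q] -> a j t = 0) ->
    cbox p q `<=` D ->
    (\int[mu]_(x in D) (u x * tensor (derive_tensor i (derive_tensor j a)) x)%:E =
     \int[mu]_(x in D) (g x * tensor a x)%:E)%E.
  by case: ug => -[_ ig ug]; split => // a p q sa a0 pqD;
    have := ug _ (tensor_test_function sa a0 pqD);
    rewrite pderiv_tensor2// ?(derive_tensorC j i) sqrrN expr1n mul1e.
split => // a p q sa a0 pqD.
have da0 k t : t \notin `[coord k p, coord k q] -> derive_tensor i a k t = 0.
  rewrite /derive_tensor; case: ifP => _ tpq; last exact: a0.
  have dc : is_derive t (1:R) (cst 0 : R -> R) (0:R) by exact: is_derive_cst.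
  have [//|_ dE] := @near_eq_is_derive R R R (cst 0) (a k) t 1 0 _ dc.
    move: tpq; rewrite in_itv /= negb_and -!ltNge => /orP[tp|qt].
      near=> s; rewrite /= a0// in_itv /= negb_and -!ltNge; apply/orP; left.
      by near: s; exact: lt_nbhsl.
    near=> s; rewrite /= a0// in_itv /= negb_and -!ltNge; apply/orP; right.
    by near: s; exact: lt_nbhsr.
  by rewrite derive1E.
have := uu' _ (tensor_test_function (smooth_derive_tensor i sa) da0 pqD).
rewrite pderiv_tensor1; last exact: smooth_derive_tensor.
rewrite derive_tensorC (tg _ _ _ sa a0 pqD) expr1 mulN1e => ->.
by rewrite oppeK.
Unshelve. all: by end_near.
Qed.

Lemma measurable_comp_shift u v : measurable_on setT u ->
  measurable_on setT (fun x => u (x + v)).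
Proof. by move=> mu_; exact: (measurableT_comp mu_ (@measurable_shift3 R v)). Qed.

Lemma integrable_shift u v : mu.-integrable setT (EFin \o u) ->
  mu.-integrable setT (fun x : mR3 R => (u ((x : R3 R) + v))%:E).
Proof.
move=> /integrableP[/measurable_EFinP mu_ uoo].
apply/integrableP; split.
  by apply/measurable_EFinP; exact: measurable_comp_shift.
rewrite (ge0_integral_shift (f := fun x => `|(EFin \o u) x|%E))//.
by apply/measurable_EFinP; exact: measurableT_comp.
Qed.

Lemma integral_shift u v : mu.-integrable setT (EFin \o u) ->
  (\int[mu]_x (u ((x : R3 R) + v))%:E = \int[mu]_x (u x)%:E)%E.
Proof.
move=> iu.
have mEu : measurable_fun [set: mR3 R] (EFin \o u) by have /integrableP[] := iu.
transitivity (\int[pushforward mu (shift3 v)]_x (EFin \o u) x)%E; last first.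
  by apply: eq_measure_integral => A mA _; exact: leb3_shift.
apply/esym; apply: (etrans (integral_pushforward (phi := shift3 v) (D := setT) _ mEu _ _)) => //.
exact: integrable_shift.
Qed.

(** The witness is the product of the two factors of [a] other than [i] at [x]. Being independent of
    [b] and [y], it reduces identities between tensors to direction [i]. *)
Lemma tensor_split i a x : exists c, forall b y,
  (forall j, j != i -> b j (coord j y) = a j (coord j x)) ->
  tensor b y = c * b i (coord i y).
Proof.
have i10 : inord 1 != ord0 :> 'I_3 by rewrite inord1_eq0.
have i12 : inord 1 != ord_max :> 'I_3 by rewrite inord1_eq2.
elim/ord3_ind: i.
- exists (a (inord 1) (coord (inord 1) x) * a ord_max (coord ord_max x)) => b y H.
  by rewrite /tensor (H _ i10) (H ord_max)//; ring.
- exists (a ord0 (coord ord0 x) * a ord_max (coord ord_max x)) => b y H.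
  by rewrite /tensor (H ord0) 1?eq_sym// (H ord_max) 1?eq_sym//; ring.
- exists (a ord0 (coord ord0 x) * a (inord 1) (coord (inord 1) x)) => b y H.
  by rewrite /tensor (H _ i12) (H ord0)//; ring.
Qed.

(* The average of translates of a bump is again a test function, with the
   difference of two bumps as its derivative. *)
Lemma bump_window (p q : R) n (t : R) : 0 < t -> exists A : R -> R,
  [/\ smooth A, forall s, derive1 A s = bump p q n s - bump p q n (s - t),
      forall s, ((A s)%:E = \int[lam]_(r in `[0%R, t]) (bump p q n (s - r))%:E)%E &
      forall s, s \notin `[p, q + t] -> A s = 0].
Proof.
move=> t0.
have [|B dB] := @continuous_primitive R (bump p q n) p (smooth_continuous (@smooth_bump R p q n)).
  by move=> x xp; apply: bump_out; rewrite in_itv /= negb_and -!leNgt xp.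
have dBt s : is_derive s (1:R) (fun z => B (z - t)) (bump p q n (s - t)).
  have dt : is_derive s (1:R) (fun z : R => z - t) 1.
    apply: is_derive_eq (is_deriveB (is_derive_id s (1:R)) (is_derive_cst t s (1:R))) _.
    by rewrite subr0.
  have h := @is_derive1_comp R B (fun z => z - t) s _ _ (dB _) dt.
  by apply: is_derive_eq h _; rewrite mulr1.
pose A s := B s - B (s - t).
have dA s : is_derive s (1:R) A (bump p q n s - bump p q n (s - t)).
  exact: is_deriveB.
have AE s : ((A s)%:E = \int[lam]_(r in `[0%R, t]) (bump p q n (s - r))%:E)%E.
  have dN r : is_derive r (1:R) (fun z => - B (s - z)) (bump p q n (s - r)).
    have dt : is_derive r (1:R) (fun z : R => s - z) (-1).
      apply: is_derive_eq (is_deriveB (is_derive_cst s r (1:R)) (is_derive_id r (1:R))) _.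
      by rewrite sub0r.
    have h := is_deriveN (@is_derive1_comp R B (fun z => s - z) r _ _ (dB _) dt).
    by apply: is_derive_eq h _; rewrite mulrN1 opprK.
  have cN : continuous (fun z => - B (s - z)).
    by move=> r; apply: differentiable_continuous; apply/derivable1_diffP; have [] := dN r.
  rewrite (@continuous_FTC2 R (fun r => bump p q n (s - r)) (fun z => - B (s - z)) 0 t)//.
  - by rewrite subr0 -EFinB /A opprK addrC.
  - apply: continuous_subspaceT => r.
    have sb : smooth (fun r => bump p q n (-1 * r + s)).
      by move=> m; apply: nsmooth_affine; exact: smooth_bump.
    rewrite (_ : (fun r => _) = fun r => bump p q n (-1 * r + s)).
      exact: smooth_continuous.
    by apply/funext => r'; rewrite mulN1r addrC.
  - split; [by move=> r _; have [] := dN r| |].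
    + exact/cvg_at_right_filter/cN.
    + exact/cvg_at_left_filter/cN.
  - by move=> r _; rewrite derive1E; have [] := dN r.
exists A; split => //.
- apply: (@smooth_primitive R (fun s => bump p q n s - bump p q n (s - t))) => //.
  move=> k; rewrite (_ : (fun _ => _) = fun s => bump p q n s + (cst (-1) s) * bump p q n (1 * s + (- t))); last first.
    by apply/funext => s; rewrite mul1r mulN1r.
  apply: nsmoothD; first exact: smooth_bump.
  apply: nsmoothM; first exact: nsmooth_cst.
  by apply: nsmooth_affine; exact: smooth_bump.
- by move=> s; rewrite derive1E; have [] := dA s.
- move=> s spq; apply: EFin_inj; rewrite AE integral0_eq// => r.
  rewrite /= in_itv /= => /andP[r0 rt]; rewrite bump_out//.
  move: spq; rewrite !in_itv /= !negb_and -!ltNge -!leNgt => /orP[h|h]; apply/orP; [left|right]; lra.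
Qed.

End weak_partial.

(** * Absolute continuity along lines *)

Section absolute_continuity.
Context {R : realType}.
Implicit Types (x y e p q : R3 R) (a b : 'I_3 -> R -> R) (i j : 'I_3).
Implicit Types (D K A : set (R3 R)) (u g F : R3 R -> R) (t : R).
Local Notation mu := (@leb3 R).
Local Notation lam := (@lebesgue_measure R).

Lemma integrable_bump3 D g p q n : measurable (D : set (mR3 R)) ->
  loc_integrable D g -> cbox p q `<=` D ->
  mu.-integrable D (fun x => (g x * bump3 p q n x)%:E).
Proof.
move=> mD ig pqD.
have mK := @measurable_cbox R p q.
have iK : mu.-integrable (cbox p q) (fun x => (g x * bump3 p q n x)%:E).
  apply: (integrable_bounded_mul (C := 1) mK).
  - by apply: ig => //; exact: compact_cbox.
  - by apply: measurable_funS (@measurable_bump3 R p q n).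
  - by move=> x _; rewrite ger0_norm ?bump3_ge0 ?bump3_le1.
rewrite (_ : (fun x => _) = (fun x => (g x * bump3 p q n x)%:E) \_ (cbox p q)).
  by apply/integrable_restrict => //; rewrite setIidr.
apply/funext => x; rewrite patchE; case: ifPn => // nx.
rewrite bump3_out ?mulr0// => /(@box_cbox R p q)/mem_set.
by rewrite (negbTE nx).
Qed.

Lemma weak_partial_unique D i u g g' : open D -> weak_partial D i u g ->
  weak_partial D i u g' -> mu.-negligible [set x | D x /\ g x <> g' x].
Proof.
move=> oD [_ ig wg] [_ ig' wg'].
have mD : measurable (D : set (mR3 R)) by exact: open_measurable3.
have : mu.-negligible [set x | D x /\ (g x - g' x) <> 0].
  apply: (@fundamental_lemma R D (fun x => g x - g' x)) => //.
    move=> K cK KD; have := integrableB (compact_measurable3 cK) (ig K cK KD) (ig' K cK KD).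
    by [].
  move=> p q pqD n.
  pose a j := bump (coord j p) (coord j q) n.
  have sa j : smooth (a j) by exact: smooth_bump.
  have a0 j t : t \notin `[coord j p, coord j q] -> a j t = 0.
    move=> tpq; apply: bump_out; apply: contra tpq; exact: subset_itv_oo_cc.
  have E : (- (\int[mu]_(x in D) (g x * bump3 p q n x)%:E) = - \int[mu]_(x in D) (g' x * bump3 p q n x)%:E)%E.
    by rewrite -(wg a p q)// -(wg' a p q).
  have ib := @integrable_bump3 D g p q n mD ig pqD.
  have ib' := @integrable_bump3 D g' p q n mD ig' pqD.
  transitivity (\int[mu]_(x in D) ((fun x => (g x * bump3 p q n x)%:E) \- (fun x => (g' x * bump3 p q n x)%:E)) x)%E.
    by apply: eq_integral => x _; rewrite -EFinB mulrBl.
  rewrite integralB//.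
  have -> : (\int[mu]_(x in D) (g x * bump3 p q n x)%:E = \int[mu]_(x in D) (g' x * bump3 p q n x)%:E)%E.
    by apply: oppe_inj.
  by rewrite subee// integrable_fin_num.
apply: negligibleS => x [Dx gx]; split => // /eqP; rewrite subr_eq0 => /eqP.
exact: gx.
Qed.

Lemma integrable_patch D u : measurable (D : set (mR3 R)) ->
  mu.-integrable D (EFin \o u) -> mu.-integrable setT (EFin \o (u \_ D)).
Proof.
move=> mD iu; rewrite (_ : EFin \o _ = (EFin \o u) \_ D); first exact: (iffLR (integrable_mkcond _ mD) iu).
by apply/funext => x; rewrite /= !patchE; case: ifP.
Qed.

Lemma measurable_shift_line g e : measurable_on setT g ->
  measurable_fun [set: mR3 R * measurableTypeR R]
    (fun z => g ((z.1 : R3 R) + (z.2 : R) *: e)).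
Proof.
move=> mg.
have m2 : measurable_fun [set: mR3 R * measurableTypeR R]
    ((fun z => (z.1 : R3 R) + (z.2 : R) *: e) : _ -> mR3 R).
  apply: measurable_funD3; first exact: (@measurable_fst _ _ (mR3 R) (measurableTypeR R)).
  apply: measurable_funZ3; first exact: (@measurable_snd _ _ (mR3 R) (measurableTypeR R)).
  exact: (@measurable_cst _ _ _ (mR3 R)).
exact: (measurableT_comp mg m2).
Qed.

(** The indicator of the segment belongs to the integrand, so that Fubini's theorem is used on the
    full product of space and line. *)
Definition line_integrand g e t : mR3 R * measurableTypeR R -> \bar R :=
  fun z => (g ((z.1 : R3 R) + (z.2 : R) *: e) * \1_(`[0, t] : set R) z.2)%:E.

Lemma line_integrand_integrable g e t : mu.-integrable setT (EFin \o g) ->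
  (@lebesgue_measure3 R \x lam)%E.-integrable setT (line_integrand g e t).
Proof.
move=> ig.
have mg : measurable_on setT g by apply/measurable_EFinP; have /integrableP[] := ig.
have mG : measurable_fun setT (line_integrand g e t).
  apply/measurable_EFinP; apply: measurable_funM; first exact: measurable_shift_line.
  apply: (@measurableT_comp _ _ _ _ _ _ (\1_(`[0, t] : set R) : measurableTypeR R -> R) _ snd) => //.
apply/integrable21ltyP => //.
have -> : (fun s => \int[@lebesgue_measure3 R]_x `|line_integrand g e t (x, s)|)%E =
   fun s => ((\int[mu]_x `|(EFin \o g) x|) * (\1_(`[0, t] : set R) s)%:E)%E.
  apply/funext => s; rewrite /line_integrand /=.
  under eq_integral do rewrite normrM EFinM [X in (_ * X%:E)%E]ger0_norm//.
  rewrite ge0_integralZr//; last first.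
    apply/measurable_EFinP; apply: measurableT_comp => //.
    exact: measurable_comp_shift.
  congr (_ * _)%E.
  have mg' : measurable_fun [set: mR3 R] (fun x => `|(EFin \o g) x|)%E.
    by apply/measurable_EFinP; exact: measurableT_comp.
  exact: (@ge0_integral_shift R (fun x => `|(EFin \o g) x|)%E (s *: e) mg').
have Nlty : (\int[mu]_x `|(EFin \o g) x| < +oo)%E by have /integrableP[] := ig.
set N := (\int[mu]_x _)%E in Nlty *.
have N0 : (0 <= N)%E by exact: integral_ge0.
rewrite ge0_integralZl//; last exact/measurable_EFinP.
rewrite integral_indic// setIT lte_mul_pinfty//.
  by rewrite ge0_fin_numE.
by rewrite /= lebesgue_measure_itv/=; case: ifP => _; rewrite ltry.
Qed.

Lemma line_integrand_integrableE g e t x :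
  lam.-integrable setT (fun s => line_integrand g e t (x, s)) ->
  lam.-integrable `[0, t] (fun s => (g (x + s *: e))%:E) /\
  (\int[lam]_s line_integrand g e t (x, s) =
   \int[lam]_(s in `[0%R, t]) (g (x + s *: e))%:E)%E.
Proof.
have E : (fun s => line_integrand g e t (x, s)) =
    (fun s => (g (x + s *: e))%:E) \_ (`[0, t]%classic : set R).
  apply/funext => s; rewrite /line_integrand /= patchE indicE.
  by case: ifP; rewrite ?mulr1 ?mulr0.
rewrite E => H; split; last by rewrite [RHS]integral_mkcond.
by apply/(integrable_mkcond (mu := lam) (D := `[0, t]%classic)).
Qed.

(** Fubini's theorem twice, with a translation by [s *: e] for fixed [s] in between: the averaging
    along [e] passes from [g] to the test function, and changes direction. *)
Lemma line_integral_swap g e t (H : R3 R -> R) : mu.-integrable setT (EFin \o g) ->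
  measurable_on setT H -> (forall x, `|H x| <= 1) ->
  (\int[mu]_x ((\int[lam]_s line_integrand g e t (x, s)) * (H x)%:E) =
   \int[mu]_x ((g x)%:E * \int[lam]_(s in `[0%R, t]) (H (x - s *: e))%:E))%E.
Proof.
move=> ig mH H1.
pose m3 := @lebesgue_measure3 R.
have mg : measurable_on setT g by apply/measurable_EFinP; have /integrableP[] := ig.
pose L e' (z : mR3 R * measurableTypeR R) : R :=
  g ((z.1 : R3 R) + (z.2 : R) *: e') * \1_(`[0, t] : set R) z.2.
have iL e' : (m3 \x lam)%E.-integrable setT (EFin \o L e').
  exact: line_integrand_integrable.
have mfst : measurable_fun [set: mR3 R * measurableTypeR R] (fun z => H z.1).
  exact: (@measurableT_comp _ _ _ _ _ _ (H : mR3 R -> R) _ fst).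
have mshift : measurable_fun [set: mR3 R * measurableTypeR R]
    (fun z => H ((z.1 : R3 R) - (z.2 : R) *: e)).
  rewrite (_ : (fun z => _) = fun z : mR3 R * measurableTypeR R => H ((z.1 : R3 R) + (z.2 : R) *: (- e))).
    exact: measurable_shift_line.
  by apply/funext => z; rewrite scalerN.
pose f2 (z : mR3 R * measurableTypeR R) := (L e z * H z.1)%:E.
have if2 : (m3 \x lam)%E.-integrable setT f2.
  by apply: (integrable_bounded_mul (C := 1) measurableT).
pose f3 (z : mR3 R * measurableTypeR R) := (L 0 z * H ((z.1 : R3 R) - (z.2 : R) *: e))%:E.
have if3 : (m3 \x lam)%E.-integrable setT f3.
  by apply: (integrable_bounded_mul (C := 1) measurableT).
transitivity (\int[m3]_x \int[lam]_s f2 (x, s))%E.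
  apply: ae_eq_integral => //.
  - apply: emeasurable_funM; last exact/measurable_EFinP.
    exact: (measurable_fubini_F (iL e)).
  - exact: (measurable_fubini_F if2).
  have := ae_integrable1 (iL e); apply: filterS => x iLx _.
  by rewrite -integralZr.
rewrite (Fubini if2).
transitivity (\int[lam]_s \int[m3]_x f3 (x, s))%E.
  apply: eq_integral => s _.
  pose k x := g x * (H (x - s *: e) * \1_(`[0, t] : set R) s).
  transitivity (\int[mu]_x (k ((x : R3 R) + s *: e))%:E)%E.
    by apply: eq_integral => x _; rewrite /f2 /L /k /= addrK; congr EFin; ring.
  rewrite integral_shift.
    by apply: eq_integral => x _; rewrite /f3 /L /k /= scaler0 addr0; congr EFin; ring.
  apply: (integrable_bounded_mul (C := 1) measurableT) => //.
  - apply: measurable_funM => //.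
    exact: (@measurable_comp_shift R H (- (s *: e)) mH).
  - move=> x _; rewrite normrM mulr_ile1// ger0_norm ?indicE//.
    by case: (_ \in _).
rewrite -(Fubini if3).
apply: eq_integral => x _.
have mHx : measurable_fun [set: measurableTypeR R] (fun s : R => H (x - s *: e)).
  have m2 : measurable_fun [set: measurableTypeR R]
      ((fun s : R => (x : R3 R) + s *: (- e)) : _ -> mR3 R).
    apply: measurable_funD3; first exact: (@measurable_cst _ _ _ (mR3 R)).
    apply: measurable_funZ3 => //; exact: (@measurable_cst _ _ _ (mR3 R)).
  rewrite (_ : (fun s => _) = H \o (fun s : R => (x : R3 R) + s *: (- e))).
    exact: (measurableT_comp mH m2).
  by apply/funext => s; rewrite /= scalerN.
have iHx : lam.-integrable `[0, t] (fun s => (H (x - s *: e))%:E).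
  apply: measurable_bounded_integrable => //.
  - by rewrite /= lebesgue_measure_itv/=; case: ifP => _; rewrite ltry.
  - exact: measurable_funTS.
  - exists 1; split=> // M M1 s _; exact: (le_trans (H1 _) (ltW M1)).
have mI : measurable (`[0, t]%classic : set (measurableTypeR R)) by [].
apply: etrans (integralZl mI iHx (g x)).
rewrite [RHS]integral_mkcond; apply: eq_integral => s _.
rewrite /f3 /L /= scaler0 addr0 patchE indicE -EFinM; case: ifP => _; first by rewrite mulr1.
by rewrite mulr0 mul0r.
Qed.

End absolute_continuity.

Section lines.
Context {R : realType}.
Implicit Types (x y e p q : R3 R) (a b : 'I_3 -> R -> R) (i j : 'I_3).
Implicit Types (D K A : set (R3 R)) (u g F : R3 R -> R) (t : R).
Local Notation mu := (@leb3 R).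
Local Notation lam := (@lebesgue_measure R).

(** The factor of the bump in direction [i] is replaced by its average over a window. Tested with
    this function, a weak derivative yields increments of [u] on one side and line integrals of [g]
    on the other. *)
Lemma window_tensor i p q n t : 0 < t -> exists a,
  [/\ forall j, smooth (a j),
    forall j r, r \notin `[coord j p, coord j (q + t *: basis3 i)] -> a j r = 0,
    forall x, tensor (derive_tensor i a) x = bump3 p q n x - bump3 p q n (x - t *: basis3 i) &
    forall x, ((tensor a x)%:E = \int[lam]_(s in `[0%R, t]) (bump3 p q n (x - s *: basis3 i))%:E)%E].
Proof.
move=> t0; have [B [sB dB BE B0]] := @bump_window R (coord i p) (coord i q) n t t0.
pose b j := bump (coord j p) (coord j q) n.
pose a j := if j == i then B else b j.
have sb j : smooth (b j) by exact: smooth_bump.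
have shift_ne j x (s : R) : j != i -> coord j (x - s *: basis3 i) = coord j x.
  by move=> ji; rewrite -scaleNr coord_shift (negbTE ji) mulr0n addr0.
have shift_eq x (s : R) : coord i (x - s *: basis3 i) = coord i x - s.
  by rewrite -scaleNr coord_shift eqxx.
exists a; split.
- by move=> j; rewrite /a; case: ifP.
- move=> j r; rewrite /a coord_shift; case: ifPn => [/eqP ->|ji]; first exact: B0.
  rewrite mulr0n addr0 => rpq; apply: bump_out; apply: contra rpq; exact: subset_itv_oo_cc.
- move=> x; have [c H] := tensor_split i b x.
  rewrite (H (derive_tensor i a) x); last first.
    by move=> j ji; rewrite /derive_tensor /a (negbTE ji).
  rewrite /bump3 -/b (H b x)// (H b); last by move=> j ji; rewrite shift_ne.
  by rewrite -mulrBr shift_eq /derive_tensor /a eqxx dB.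
- move=> x; have [c H] := tensor_split i b x.
  rewrite (H a x); last by move=> j ji; rewrite /a (negbTE ji).
  have iB : lam.-integrable `[0, t] (fun s => (bump (coord i p) (coord i q) n (coord i x - s))%:E).
    apply: continuous_compact_integrable; first exact: segment_compact.
    apply: continuous_subspaceT => r.
    have sb' : smooth (fun r => b i (-1 * r + coord i x)).
      by move=> m; apply: nsmooth_affine; exact: sb.
    rewrite (_ : (fun r => _) = fun r => b i (-1 * r + coord i x)).
      exact: smooth_continuous.
    by apply/funext => r'; rewrite mulN1r addrC.
  have mI : measurable (`[0, t]%classic : set (measurableTypeR R)) by [].
  rewrite /a eqxx EFinM BE; apply: etrans (esym (integralZl mI iB c)) _.
  apply: eq_integral => s _; rewrite -EFinM /bump3 -/b (H b).
    by rewrite shift_eq.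
  by move=> j ji; rewrite shift_ne.
Qed.

(* Fundamental theorem of calculus for a weak derivative, along one segment. *)
Definition line_difference u g i t x :=
  lam.-integrable `[0, t] (fun s => (g (x + s *: basis3 i))%:E) /\
  ((u (x + t *: basis3 i) - u x)%:E =
    \int[lam]_(s in `[0%R, t]) (g (x + s *: basis3 i))%:E)%E.

Lemma fin_num_sub3 (a b c : \bar R) : (a \is a fin_num -> b \is a fin_num -> c \is a fin_num ->
  a - b = - c -> b - a - c = 0)%E.
Proof.
move: a b c => [a| |] [b| |] [c| |] // _ _ _ [abc]; congr EFin.
by move: abc; lra.
Qed.

(** Tested with a bump, the defect between increment and line integral turns into the weak
    derivative identity for the function of [window_tensor], and vanishes. The fundamental lemma
    then removes the bump. *)
Lemma line_difference_box D i u g p q t : open D -> weak_partial D i u g ->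
  0 < t -> cbox p (q + t *: basis3 i) `<=` D ->
  mu.-negligible [set x | box p q x /\ ~ line_difference u g i t x].
Proof.
set e := basis3 i; set C := cbox p _ => oD [iu ig wug] t0 CD.
have mD : measurable (D : set (mR3 R)) by exact: open_measurable3.
have mC : measurable (C : set (mR3 R)) by exact: measurable_cbox.
have cC : compact C by exact: compact_cbox.
(* [C] contains every segment of length [t] in direction [e] issued from the box; cut off to it,
   both functions are integrable on the whole space. *)
pose u1 := u \_ C; pose g1 := g \_ C.
have iu1 : mu.-integrable setT (EFin \o u1) by exact/integrable_patch/iu.
have ig1 : mu.-integrable setT (EFin \o g1) by exact/integrable_patch/ig.
have iL := line_integrand_integrable e t ig1.
(* The line integral is finite for almost every [x] only; [fine] makes [P] real-valued
   everywhere. *)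
pose P x := fine (\int[lam]_s line_integrand g1 e t (x, s)).
have mF := measurable_fubini_F iL.
have iF := integrable_fubini_F iL.
have iP : mu.-integrable setT (EFin \o P).
  apply: (le_integrable measurableT _ _ iF).
    by apply/measurable_EFinP; exact: (measurableT_comp (@fine_measurable R setT measurableT) mF).
  move=> x _; rewrite /P /fubini_F /=.
  by case: (\int[_]_s _)%E => [r| |] /=; rewrite ?normr0 ?lexx ?leey.
pose F x := u1 (x + t *: e) - u1 x - P x.
have iu1t : mu.-integrable setT (EFin \o (fun x => u1 (x + t *: e))) by exact: integrable_shift.
have iFF : mu.-integrable setT (EFin \o F).
  exact: (integrableB measurableT (integrableB measurableT iu1t iu1) iP).
have FL : mu.-negligible [set x | box p q x /\ F x <> 0].
  apply: fundamental_lemma; first exact: open_box.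
    move=> K cK _; apply: integrableS iFF => //; exact: compact_measurable3.
  move=> p' q' pq' n; pose H := bump3 p' q' n.
  have H0 x : ~ box p' q' x -> H x = 0 by exact: bump3_out.
  have mH : measurable_on setT H by exact: measurable_bump3.
  have H1 x : `|H x| <= 1 by rewrite ger0_norm ?bump3_ge0 ?bump3_le1.
  (* If the corners are in the wrong order, the open box is empty and the bump is zero. Otherwise
     both corners lie in [box p q], which puts the lengthened box inside [C]. *)
  have [le|nle] := pselect (forall j, coord j p' <= coord j q'); last first.
    apply: integral0_eq => x _; rewrite -/(H x) H0 ?mulr0// => /boxE h; apply: nle => j.
    by have /andP[h1 h2] := h j; rewrite ltW// (lt_trans h1).
  have bp' : box p q p' by apply: pq'; apply/cboxE => j; rewrite lexx le.
  have bq' : box p q q' by apply: pq'; apply/cboxE => j; rewrite lexx le.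
  have [a [sa a0 da aE]] := @window_tensor i p' q' n t t0.
  have C'C : cbox p' (q' + t *: e) `<=` C.
    move=> x /cboxE h; apply/cboxE => j; have := h j; rewrite !coord_shift.
    have /boxE/(_ j)/andP[h1 _] := bp'; have /boxE/(_ j)/andP[_ h2] := bq'.
    by move=> /andP[h3 h4]; apply/andP; split; [rewrite ltW// (lt_le_trans h1)|
      rewrite (le_trans h4)// lerD2r ltW].
  have sub y (s : R) : box p' q' y -> 0 <= s <= t -> cbox p' (q' + t *: e) (y + s *: e).
    move=> /boxE h /andP[s0 st]; apply/cboxE => j; rewrite !coord_shift.
    have /andP[/ltW h1 /ltW h2] := h j; apply/andP; split.
      by apply: le_trans h1 _; rewrite lerDl mulrn_wge0.
    by apply: lerD => //; exact: ler_wMn2r.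
  have toC u' (k : R3 R -> R) : (forall x, ~ C x -> k x = 0) ->
      (\int[mu]_(x in D) (u' x * k x)%:E = \int[mu]_x ((u' \_ C) x * k x)%:E)%E.
    move=> k0; rewrite [LHS]integral_mkcond; apply: eq_integral => x _; rewrite !patchE.
    case: (boolP (x \in C)) => [|nC].
      by rewrite inE => /CD Dx; rewrite mem_set.
    rewrite mul0r k0 ?mulr0; last by move=> Cx; rewrite (mem_set Cx) in nC.
    by case: ifP.
  pose H' x := H (x - t *: e).
  have mH' : measurable_on setT H' by exact: (@measurable_comp_shift R H (- (t *: e)) mH).
  have iuH : mu.-integrable setT (fun x => (u1 x * H x)%:E).
    by apply: (integrable_bounded_mul measurableT iu1 mH (C := 1)) => x _; exact: H1.
  have iuH' : mu.-integrable setT (fun x => (u1 x * H' x)%:E).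
    by apply: (integrable_bounded_mul measurableT iu1 mH' (C := 1)) => x _; exact: H1.
  have iutH : mu.-integrable setT (fun x => (u1 (x + t *: e) * H x)%:E).
    by apply: (integrable_bounded_mul measurableT iu1t mH (C := 1)) => x _; exact: H1.
  have iPH : mu.-integrable setT (fun x => (P x * H x)%:E).
    by apply: (integrable_bounded_mul measurableT iP mH (C := 1)) => x _; exact: H1.
  have E1 : (\int[mu]_x (u1 (x + t *: e) * H x)%:E = \int[mu]_x (u1 x * H' x)%:E)%E.
    rewrite -(integral_shift (t *: e) iuH'); apply: eq_integral => x _.
    by rewrite /H' addrK.
  have E2 : (\int[mu]_x (P x * H x)%:E = \int[mu]_x (g1 x * tensor a x)%:E)%E.
    transitivity (\int[mu]_x ((\int[lam]_s line_integrand g1 e t (x, s)) * (H x)%:E))%E.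
      have mPH : measurable_fun setT (fun x => (P x * H x)%:E).
        by have /integrableP[] := iPH.
      have mLH : measurable_fun setT (fun x : mR3 R => (\int[lam]_s line_integrand g1 e t (x, s)) * (H x)%:E)%E.
        exact: emeasurable_funM mF (proj2 (measurable_EFinP setT H) mH).
      apply: (@ae_eq_integral _ _ _ mu setT _ _ measurableT mPH mLH).
      have := ae_integrable1 iL; apply: filterS => x iLx _.
      by rewrite EFinM /P (fineK (integrable_fin_num measurableT iLx)).
    rewrite (line_integral_swap e t ig1 mH H1); apply: eq_integral => x _.
    by rewrite EFinM aE.
  have T0 x : ~ C x -> tensor a x = 0.
    move=> nC; have [zx|/cboxE/existsNP[j nj]] := pselect (cbox p' (q' + t *: e) x).
      by case: nC; exact: C'C.
    have aj : a j (coord j x) = 0 by apply: a0; rewrite in_itv /=; apply/negP.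
    by rewrite /tensor; elim/ord3_ind: j aj {nj} => ->; rewrite !(mulr0,mul0r).
  have dT0 x : ~ C x -> tensor (derive_tensor i a) x = 0.
    move=> nC; rewrite da (bump3_out n (x := x)); last first.
      by move=> h; apply: nC; apply: C'C; rewrite -(addr0 x) -(scale0r e); apply: sub; rewrite ?lexx ?ltW.
    rewrite (bump3_out n (x := x - t *: e)) ?subrr// => h; apply: nC; apply: C'C.
    by rewrite -(subrK (t *: e) x); apply: sub; rewrite ?lexx ?ltW.
  have := wug a _ _ sa a0 (subset_trans C'C CD).
  rewrite (toC _ _ T0) (toC _ _ dT0) -/u1 -/g1 -E2.
  have -> : (\int[mu]_x (u1 x * tensor (derive_tensor i a) x)%:E =
      \int[mu]_x (u1 x * H x)%:E - \int[mu]_x (u1 x * H' x)%:E)%E.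
    rewrite -(integralB measurableT iuH iuH'); apply: eq_integral => x _.
    by rewrite -EFinB da mulrBr.
  clear toC T0 dT0 sub => E3.
  transitivity (\int[mu]_x (u1 (x + t *: e) * H x)%:E - \int[mu]_x (u1 x * H x)%:E - \int[mu]_x (P x * H x)%:E)%E.
    have iB := integrableB measurableT iutH iuH.
    rewrite -(integralB measurableT iutH iuH) -(integralB measurableT iB iPH).
    rewrite [LHS]integral_mkcond; apply: eq_integral => x _; rewrite patchE.
    case: ifPn => bx; first by rewrite -!EFinB /F !mulrBl.
    rewrite H0; first by rewrite !mulr0 -!EFinB !subr0.
    move=> b'x; move/negP: bx; apply; apply/mem_set.
    exact: (pq' _ (box_cbox b'x)).
  rewrite E1.
  move: (integrable_fin_num measurableT iuH) (integrable_fin_num measurableT iuH')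
    (integrable_fin_num measurableT iPH) E3.
  exact: fin_num_sub3.
have aeL := ae_integrable1 iL.
have : mu.-negligible ([set x | box p q x /\ F x <> 0] `|`
    ~` [set x | lam.-integrable setT (fun s => line_integrand g1 e t (x, s))]).
  by apply: negligibleU => //; exact: aeL.
apply: negligibleS => x [bx ld].
have [iLx|] := pselect (lam.-integrable setT (fun s => line_integrand g1 e t (x, s))); last by right.
left; split => // F0; apply: ld.
have [iLx' LE] := line_integrand_integrableE iLx.
have xC (s : R) : 0 <= s <= t -> C (x + s *: e).
  move=> /andP[s0 st]; apply/cboxE => j; rewrite !coord_shift.
  move/boxE: bx => /(_ j)/andP[px xq].
  apply/andP; split; first by apply: le_trans (ltW px) _; rewrite lerDl mulrn_wge0.
  by apply: lerD (ltW xq) _; exact: ler_wMn2r.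
have gE s : s \in (`[0, t]%classic : set R) -> (g1 (x + s *: e))%:E = (g (x + s *: e))%:E.
  by rewrite inE /= in_itv /= => /xC xsC; rewrite /g1 patchE mem_set.
split; first exact: eq_integrable iLx'.
have fC : (\int[lam]_s line_integrand g1 e t (x, s))%E \is a fin_num.
  exact: integrable_fin_num iLx.
apply: etrans; last by apply: eq_integral => s sI; exact: (gE s sI).
rewrite -LE -(fineK fC); congr EFin.
move: F0; rewrite /F /P /u1 !patchE.
have := xC 0; rewrite scale0r addr0 => xC0.
rewrite (mem_set (xC t _)) ?lexx ?ltW// (mem_set (xC0 _)) ?lexx ?ltW//.
by move/eqP; rewrite subr_eq0 => /eqP.
Qed.

End lines.

Lemma integrable_bounded d (T : measurableType d) (R : realType)
    (m : {measure set T -> \bar R}) (A : set T) (f : T -> R) (C : R) :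
  measurable A -> (m A < +oo)%E -> measurable_fun A f ->
  (forall x, A x -> `|f x| <= C) -> m.-integrable A (EFin \o f).
Proof.
move=> mA Aoo mf fC; apply: measurable_bounded_integrable => //.
by exists C; split; [exact: num_real|move=> N CN x Ax /=; exact: le_trans (fC x Ax) (ltW CN)].
Qed.

(** The Cauchy-Schwarz inequality against the constant 1, obtained by integrating
    [(k x - S / c) ^+ 2 >= 0], where [S / c] is the mean of [k]. *)
Lemma sqr_integral_le d (T : measurableType d) (R : realType)
    (m : {measure set T -> \bar R}) (A : set T) (k : T -> R) (c : R) :
  measurable A -> m A = c%:E -> 0 < c -> m.-integrable A (EFin \o k) ->
  ((fine (\int[m]_(x in A) (k x)%:E) ^+ 2)%:E <=
    c%:E * \int[m]_(x in A) (k x ^+ 2)%:E)%E.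
Proof.
move=> mA Ac c0 ik; set S := fine _.
have SE : (\int[m]_(x in A) (k x)%:E = S%:E)%E by rewrite fineK//; exact: integrable_fin_num ik.
have mk : measurable_fun A k by have /integrableP[/measurable_EFinP] := ik.
have mk2 : measurable_fun A (fun x => (k x ^+ 2)%:E).
  by apply/measurable_EFinP; exact: measurable_funX.
have I0 : (0 <= \int[m]_(x in A) (k x ^+ 2)%:E)%E.
  by apply: integral_ge0 => x _; rewrite lee_fin sqr_ge0.
case IE : (\int[m]_(x in A) (k x ^+ 2)%:E)%E I0 => [I| |] // I0; last first.
  by rewrite gt0_muley ?lte_fin// leey.
have ik2 : m.-integrable A (fun x => (k x ^+ 2)%:E).
  apply/integrableP; split => //.
  rewrite (eq_integral (fun x => (k x ^+ 2)%:E)) ?IE ?ltry// => x _.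
  by rewrite gee0_abs// lee_fin sqr_ge0.
have ic : m.-integrable A (cst ((S / c) ^+ 2)%:E).
  by apply: (@integrable_bounded _ _ _ _ _ (cst ((S / c) ^+ 2)) `|(S / c) ^+ 2|) => //; rewrite Ac ltry.
have i2 : m.-integrable A (fun x => (2 * (S / c))%:E * (k x)%:E)%E.
  exact: integrableZl.
have : (\int[m]_(x in A) ((2 * (S / c))%:E * (k x)%:E - ((S / c) ^+ 2)%:E) <= I%:E)%E.
  rewrite -IE; apply: le_integral => //; first exact: integrableB.
  move=> x _; rewrite -EFinM -EFinB lee_fin.
  rewrite -subr_ge0 (_ : _ - _ = (k x - S / c) ^+ 2) ?sqr_ge0//; ring.
rewrite (integralB mA i2 ic) (integralZl mA ik) SE (integral_cst _ mA) Ac -!EFinM -EFinB !lee_fin.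
have -> : 2 * (S / c) * S - (S / c) ^+ 2 * c = S ^+ 2 / c by field; rewrite gt_eqF.
by rewrite ler_pdivrMr// mulrC.
Qed.

Section translations.
Context {R : realType}.
Implicit Types (x y e p q v : R3 R) (i j : 'I_3).
Implicit Types (D K A : set (R3 R)) (u g f : R3 R -> R) (t r : R).
Local Notation mu := (@leb3 R).
Local Notation lam := (@lebesgue_measure R).

Lemma coordB j x y : coord j (x - y) = coord j x - coord j y.
Proof. exact: raddfB. Qed.

Lemma norm3_lt x r : (forall j, `|coord j x| < r) -> `|x| < r.
Proof. by move=> h; rewrite !prod_normE /= !gt_max -!coordE !h. Qed.

Lemma norm3_le x r : (forall j, `|coord j x| <= r) -> `|x| <= r.
Proof. by move=> h; rewrite !prod_normE /= !ge_max -!coordE !h. Qed.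

Lemma line_difference_ae D i u g t r : open D -> weak_partial D i u g ->
  0 < t -> t < r ->
  mu.-negligible [set x | ball x r `<=` D /\ ~ line_difference u g i t x].
Proof.
move=> oD w t0 tr; apply: negligible_locally => x [xD _].
(* A cube of half-side [s] about [x], lengthened by [t], stays in the ball because [s + t < r]. *)
pose s := (r - t) / 4.
have s0 : 0 < s by rewrite divr_gt0// subr_gt0.
pose ones : R3 R := vec3 (fun=> 1).
exists (box (x - s *: ones) (x + s *: ones)).
  apply: open_nbhs_nbhs; split; first exact: open_box.
  by apply/boxE => j; rewrite coordD -scaleNr coordD !coordZ coord_vec3 !mulr1; lra.
have CD : cbox (x - s *: ones) (x + s *: ones + t *: basis3 i) `<=` D.
  move=> y /cboxE yC; apply: xD; rewrite -ball_normE /=; apply: norm3_lt => j.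
  have := yC j; rewrite coord_shift coordD -scaleNr coordD !coordZ coord_vec3 !mulr1.
  rewrite coordB => /andP[h1 h2].
  have h3 : t *+ (j == i) <= t by case: (j == i); rewrite ?mulr1n ?mulr0n ?lexx// ltW.
  by rewrite ltr_norml; apply/andP; split; move: h1 h2 h3; rewrite /s; lra.
apply: negligibleS (line_difference_box oD w t0 CD).
by move=> y [[_ nl] by_]; split.
Qed.

Lemma line_difference_sqr u g i t x : 0 < t -> line_difference u g i t x ->
  (((u (x + t *: basis3 i) - u x) ^+ 2)%:E <=
    t%:E * \int[lam]_(s in `[0%R, t]) (g (x + s *: basis3 i) ^+ 2)%:E)%E.
Proof.
move=> t0 [ig E].
have mI : measurable (`[0, t]%classic : set (measurableTypeR R)) by [].
have lI : lam (`[0, t]%classic : set R) = t%:E.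
  by rewrite lebesgue_measure_itv/= lte_fin t0 oppr0 adde0.
have := sqr_integral_le mI lI t0 ig.
by rewrite -E.
Qed.

End translations.

(** * Energy and oscillation *)

Section energy.
Context {R : realType}.
Implicit Types (x y e p q v : R3 R) (i j : 'I_3).
Implicit Types (D K A : set (R3 R)) (u g f : R3 R -> R) (t r : R).
Local Notation mu := (@leb3 R).
Local Notation lam := (@lebesgue_measure R).

(** The squared norm of L^2 over the whole space. As an extended real it is defined for all
    functions, and bounds on it need no square roots. *)
Definition energy u : \bar R := (\int[mu]_x (u x ^+ 2)%:E)%E.

Lemma energy_ge0 u : (0 <= energy u)%E.
Proof. by apply: integral_ge0 => x _; rewrite lee_fin sqr_ge0. Qed.

Lemma measurable_sqr u : measurable_on setT u ->
  measurable_fun [set: mR3 R] (fun x => (u x ^+ 2)%:E).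
Proof. by move=> mu_; apply/measurable_EFinP; exact: measurable_funX. Qed.

Lemma energy_shift u v : measurable_on setT u ->
  energy (fun x => u (x + v)) = energy u.
Proof.
move=> mu_; apply: (@ge0_integral_shift R (fun x => (u x ^+ 2)%:E) v).
  exact: measurable_sqr.
by move=> x; rewrite lee_fin sqr_ge0.
Qed.

Lemma measurable_line_integrand g e t : measurable_on setT g ->
  measurable_fun setT (line_integrand g e t).
Proof.
move=> mg; apply/measurable_EFinP; apply: measurable_funM; first exact: measurable_shift_line.
by apply: (@measurableT_comp _ _ _ _ _ _ (\1_(`[0, t] : set R) : measurableTypeR R -> R) _ snd).
Qed.

Lemma line_integral_sqrE g e t x :
  (\int[lam]_(s in `[0%R, t]) (g (x + s *: e) ^+ 2)%:E =
   \int[lam]_s line_integrand (fun y => g y ^+ 2)%R e t (x, s))%E.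
Proof.
rewrite integral_mkcond; apply: eq_integral => s _.
by rewrite /line_integrand patchE indicE /=; case: ifP; rewrite ?mulr1 ?mulr0.
Qed.

Lemma line_integrand_sqr_ge0 g e t z :
  (0 <= line_integrand (fun y => g y ^+ 2)%R e t z)%E.
Proof. by rewrite lee_fin mulr_ge0 ?sqr_ge0// indicE; case: (_ \in _). Qed.

Lemma measurable_line_integral_sqr g e t : measurable_on setT g ->
  measurable_fun [set: mR3 R] (fun x => \int[lam]_(s in `[0%R, t]) (g ((x : R3 R) + s *: e)%R ^+ 2)%:E)%E.
Proof.
move=> mg; under eq_fun do rewrite line_integral_sqrE.
have mk : measurable_on setT (fun y => g y ^+ 2) by exact: measurable_funX.
apply: (@measurable_fun_fubini_tonelli_F _ _ _ _ _ lam _ (measurable_line_integrand e t mk)).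
exact: line_integrand_sqr_ge0.
Qed.

Lemma integral_line_sqr g i t : 0 < t -> measurable_on setT g ->
  (\int[mu]_x \int[lam]_(s in `[0%R, t]) (g ((x : R3 R) + s *: basis3 i)%R ^+ 2)%:E =
   t%:E * energy g)%E.
Proof.
move=> t0 mg; set e := basis3 i.
pose k x := g x ^+ 2; pose m3 := @lebesgue_measure3 R.
have mk : measurable_on setT k by exact: measurable_funX.
have mL := measurable_line_integrand e t mk.
have L0 := line_integrand_sqr_ge0 g e t.
transitivity (\int[m3]_x \int[lam]_s line_integrand k e t (x, s))%E.
  by apply: eq_integral => x _; rewrite line_integral_sqrE.
rewrite (@fubini_tonelli _ _ _ _ _ m3 lam _ mL L0).
transitivity (\int[lam]_s (energy g * (\1_(`[0, t] : set R) s)%:E))%E.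
  apply: eq_integral => s _; rewrite /line_integrand/=.
  under eq_integral do rewrite EFinM.
  have mks : measurable_fun [set: mR3 R] (fun x => (k ((x : R3 R) + s *: e))%:E).
    by apply/measurable_EFinP; exact: measurable_comp_shift.
  rewrite (@ge0_integralZr _ _ _ m3 setT measurableT (fun x => (k ((x : R3 R) + s *: e))%:E)).
  - congr (_ * _)%E; exact: (energy_shift (s *: e) mg).
  - exact: mks.
  - by move=> x _; rewrite lee_fin sqr_ge0.
  - by rewrite lee_fin indicE; case: (_ \in _).
have m1 : measurable_fun [set: measurableTypeR R] (EFin \o (\1_(`[0, t] : set R) : measurableTypeR R -> R)).
  by apply/measurable_EFinP.
rewrite (ge0_integralZl lam measurableT m1) ?energy_ge0//; last first.
  by move=> s _; rewrite lee_fin indicE; case: (_ \in _).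
rewrite (integral_indic lam measurableT) ?setIT// muleC; congr (_ * _)%E.
by rewrite /= lebesgue_measure_itv/= lte_fin t0 oppr0 adde0.
Qed.

(** One factor [t] comes from Cauchy-Schwarz on the segment, the other from integrating over all
    segments, by Tonelli's theorem and translation invariance. *)
Lemma energy_step i u g t : 0 <= t -> measurable_on setT u -> measurable_on setT g ->
  weak_partial setT i u g ->
  (energy (fun x => u (x + t *: basis3 i) - u x)%R <= (t ^+ 2)%:E * energy g)%E.
Proof.
rewrite le_eqVlt => /predU1P[<- _ _ _|t0 mu_ mg w].
  rewrite expr0n mul0e /energy integral0_eq// => x _.
  by rewrite scale0r addr0 subrr expr0n.
have tt : t < t + 1 by rewrite ltrDl.
have ld := line_difference_ae openT w t0 tt.
have mL := measurable_line_integral_sqr (basis3 i) t mg.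
have mtL : measurable_fun [set: mR3 R] (fun x => t%:E *
    \int[lam]_(s in `[0%R, t]) (g ((x : R3 R) + s *: basis3 i)%R ^+ 2)%:E)%E.
  exact: measurable_funeM.
have I0 x : (0 <= \int[lam]_(s in `[0%R, t]) (g ((x : R3 R) + s *: basis3 i)%R ^+ 2)%:E)%E.
  by apply: integral_ge0 => s _; rewrite lee_fin sqr_ge0.
apply: (@le_trans _ _ (\int[mu]_x (t%:E *
    \int[lam]_(s in `[0%R, t]) (g ((x : R3 R) + s *: basis3 i)%R ^+ 2)%:E))%E).
  apply: ae_ge0_le_integral => //.
  - by move=> x _; rewrite lee_fin sqr_ge0.
  - apply: measurable_sqr; apply: measurable_funB => //.
    exact: measurable_comp_shift.
  - by move=> x _; rewrite mule_ge0// lee_fin ltW.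
  apply: negligibleS ld => x; apply: contra_notP => /not_andP[nb|/contrapT ldx] _; first by case: nb.
  exact: (line_difference_sqr t0 ldx).
have t0' : (0 <= t%:E)%E by rewrite lee_fin ltW.
rewrite (ge0_integralZl _ measurableT mL (fun x _ => I0 x) t0') (integral_line_sqr i t0 mg).
by rewrite expr2 EFinM -muleA lexx.
Qed.
End energy.

Section oscillation.
Context {R : realType}.
Implicit Types (x y e p q v : R3 R) (i j : 'I_3).
Implicit Types (D K A : set (R3 R)) (u g f : R3 R -> R) (t r : R).
Local Notation mu := (@leb3 R).
Local Notation lam := (@lebesgue_measure R).

Definition cube r t : set (R3 R) := cbox (vec3 (fun=> r)) (vec3 (fun=> t)).

Lemma cubeE r t x : cube r t x <-> forall j, r <= coord j x <= t.
Proof. by split => [/cboxE h j|h]; [have := h j|apply/cboxE => j]; rewrite !coord_vec3. Qed.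

Lemma leb3_cube r t : r <= t -> mu (cube r t) = ((t - r) ^+ 3)%:E.
Proof.
move=> rt; have mI : measurable (`[r, t]%classic : set (measurableTypeR R)) by [].
rewrite /cube /cbox /= leb3X//.
have -> : lam (`[r, t]%classic : set R) = (t - r)%:E.
  rewrite lebesgue_measure_itv/= lte_fin; move: rt; rewrite le_eqVlt => /predU1P[->|->].
    by rewrite ltxx subrr.
  by rewrite EFinB.
by rewrite -!EFinM !exprS expr0 mulr1 mulrA.
Qed.

(** Not divided by the volume of the cube: that volume shows up as explicit powers of the side in
    the bounds. The cube lies on one side of [y], so that only increments in positive directions
    occur. *)
Definition oscillation f t y : \bar R :=
  (\int[mu]_(v in cube 0 t) ((f (y + v)%R - f y) ^+ 2)%:E)%E.

Lemma measurable_add3 f : measurable_on setT f ->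
  measurable_fun [set: mR3 R * mR3 R] (fun z => f ((z.1 : R3 R) + (z.2 : R3 R))).
Proof.
move=> mf.
have mD : measurable_fun [set: mR3 R * mR3 R]
    ((fun z => (z.1 : R3 R) + (z.2 : R3 R)) : mR3 R * mR3 R -> mR3 R).
  exact: (@measurable_funD3 R _ (mR3 R * mR3 R)%type setT fst snd).
exact: (measurableT_comp mf mD).
Qed.

Definition oscillation_integrand f t (z : mR3 R * mR3 R) : \bar R :=
  (((f ((z.1 : R3 R) + (z.2 : R3 R)) - f z.1) ^+ 2) * \1_(cube 0 t) (z.2 : R3 R))%:E.

Lemma measurable_oscillation_integrand f t : measurable_on setT f ->
  measurable_fun setT (oscillation_integrand f t).
Proof.
move=> mf; apply/measurable_EFinP; apply: measurable_funM.
  apply: measurable_funX; apply: measurable_funB; first exact: measurable_add3.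
  exact: (measurableT_comp mf (@measurable_fst _ _ (mR3 R) (mR3 R))).
have mQ : measurable_on setT (\1_(cube 0 t) : R3 R -> R).
  by apply: (@measurable_indic _ (mR3 R) R setT (cube 0 t)); exact: measurable_cbox.
exact: (measurableT_comp mQ (@measurable_snd _ _ (mR3 R) (mR3 R))).
Qed.

Lemma oscillation_integrand_ge0 f t z : (0 <= oscillation_integrand f t z)%E.
Proof. by rewrite lee_fin mulr_ge0 ?sqr_ge0// indicE; case: (_ \in _). Qed.

Lemma oscillationE f t y :
  oscillation f t y = (\int[mu]_v oscillation_integrand f t (y, v))%E.
Proof.
rewrite /oscillation integral_mkcond; apply: eq_integral => v _.
by rewrite /oscillation_integrand patchE indicE /=; case: ifP; rewrite ?mulr1 ?mulr0.
Qed.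

Lemma oscillation_ge0 f t y : (0 <= oscillation f t y)%E.
Proof. by apply: integral_ge0 => v _; rewrite lee_fin sqr_ge0. Qed.

Lemma measurable_oscillation f t : measurable_on setT f ->
  measurable_fun [set: mR3 R] (oscillation f t).
Proof.
move=> mf; rewrite (_ : oscillation f t = fun y => \int[mu]_v oscillation_integrand f t (y, v))%E.
  apply: (@measurable_fun_fubini_tonelli_F _ _ _ _ _ (@lebesgue_measure3 R) _
    (measurable_oscillation_integrand t mf)).
  exact: oscillation_integrand_ge0.
by apply/funext => y; rewrite oscillationE.
Qed.

Lemma energyD3 f g u : measurable_on setT f -> measurable_on setT g -> measurable_on setT u ->
  (energy (fun x => f x + g x + u x)%R <= 3%:E * (energy f + energy g + energy u))%E.
Proof.
move=> mf mg mu_; rewrite /energy.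
have mf2 := measurable_sqr mf; have mg2 := measurable_sqr mg; have mu2 := measurable_sqr mu_.
have p0 (h : R3 R -> R) x : (setT x -> 0 <= (h x ^+ 2)%:E)%E by rewrite lee_fin sqr_ge0.
rewrite -(@ge0_integralD _ _ _ mu setT measurableT _ _ (p0 f) mf2 (p0 g) mg2).
have p1 x : (setT x -> 0 <= (f x ^+ 2)%:E + (g x ^+ 2)%:E)%E by rewrite adde_ge0 ?lee_fin ?sqr_ge0.
have m1 : measurable_fun [set: mR3 R] (fun x => (f x ^+ 2)%:E + (g x ^+ 2)%:E)%E by exact: emeasurable_funD.
rewrite -(@ge0_integralD _ _ _ mu setT measurableT _ _ p1 m1 (p0 u) mu2).
have p2 x : (setT x -> 0 <= (f x ^+ 2)%:E + (g x ^+ 2)%:E + (u x ^+ 2)%:E)%E by rewrite !adde_ge0 ?lee_fin ?sqr_ge0.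
have m2 : measurable_fun [set: mR3 R] (fun x => (f x ^+ 2)%:E + (g x ^+ 2)%:E + (u x ^+ 2)%:E)%E by exact: emeasurable_funD.
have z3 : (0 <= 3%:E :> \bar R)%E by rewrite lee_fin.
rewrite -(ge0_integralZl mu measurableT m2 p2 z3).
apply: ge0_le_integral => //.
- by move=> x _; rewrite lee_fin sqr_ge0.
- by apply: measurable_sqr; apply: measurable_funD => //; exact: measurable_funD.
- exact: measurable_funeM.
move=> x _; rewrite -!EFinD -EFinM lee_fin.
move: (f x) (g x) (u x) => a b c.
have := sqr_ge0 (a - b); have := sqr_ge0 (a - c); have := sqr_ge0 (b - c); nra.
Qed.

Lemma coord_inj x y : (forall j, coord j x = coord j y) -> x = y.
Proof.
move=> h; have := h ord0; have := h (inord 1); have := h ord_max; rewrite !coordE.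
by case: x y {h} => [[? ?] ?] [[? ?] ?] /= -> -> ->.
Qed.

Lemma vec3_coord v : v = coord ord0 v *: basis3 ord0 +
  coord (inord 1) v *: basis3 (inord 1) + coord ord_max v *: basis3 ord_max.
Proof.
apply: coord_inj => j; rewrite !coordD !coordZ !coord_basis3.
elim/ord3_ind: j; rewrite ?eqxx ?inord1_eq0 ?inord1_eq2 ?(eq_sym _ (inord 1))
  ?inord1_eq0 ?inord1_eq2 /= !(mulr1, mulr0, addr0, add0r)//.
Qed.

Section gradient.
Variables (f : R3 R -> R) (g : 'I_3 -> R3 R -> R).
Hypotheses (mf : measurable_on setT f) (mg : forall i, measurable_on setT (g i)).
Hypothesis (fg : forall i, weak_partial setT i f (g i)).

Definition gradient_energy : \bar R :=
  (energy (g ord0) + energy (g (inord 1)) + energy (g ord_max))%E.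

Lemma gradient_energy_ge0 : (0 <= gradient_energy)%E.
Proof. by apply: adde_ge0; [apply: adde_ge0|]; exact: energy_ge0. Qed.

(** The translation is split into one step along each axis, and the square of a sum of three terms
    is at most three times the sum of their squares. *)
Lemma energy_translation t v : cube 0 t v ->
  (energy (fun x => f (x + v) - f x)%R <= (3 * t ^+ 2)%:E * gradient_energy)%E.
Proof.
move=> /cubeE vQ.
have t0 : 0 <= t by have /andP[h1 h2] := vQ ord0; exact: le_trans h2.
pose s i := coord i v *: basis3 i : R3 R.
pose h i x := f (x + s i) - f x.
have mh i : measurable_on setT (h i).
  by apply: measurable_funB => //; exact: measurable_comp_shift.
have hE i : (energy (h i) <= (t ^+ 2)%:E * energy (g i))%E.
  have /andP[v0 vt] := vQ i.
  apply: (le_trans (energy_step v0 mf (mg i) (fg i))).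
  by apply: lee_wpmul2r; rewrite ?energy_ge0// lee_fin ler_sqr// nnegrE.
pose s01 := s ord0 + s (inord 1).
have -> : (fun x => f (x + v) - f x) =
    (fun x => h ord_max (x + s01) + h (inord 1) (x + s ord0) + h ord0 x).
  apply/funext => x; rewrite /h /s01 {1}(vec3_coord v) -/(s _) !addrA.
  by rewrite -/(s _) -/(s _); ring.
have m1 := measurable_comp_shift s01 (mh ord_max).
have m2 := measurable_comp_shift (s ord0) (mh (inord 1)).
apply: (le_trans (energyD3 m1 m2 (mh ord0))).
rewrite (energy_shift _ (mh ord_max)) (energy_shift _ (mh (inord 1))).
rewrite EFinM -muleA; apply: lee_wpmul2l; first by rewrite lee_fin.
have eg i := energy_ge0 (g i).
rewrite /gradient_energy (ge0_muleDr _ (adde_ge0 (eg _) (eg _)) (eg _)) (ge0_muleDr _ (eg _) (eg _)).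
rewrite [leLHS]addeC [X in (_ + X <= _)%E]addeC addeA.
exact: (leeD (leeD (hE _) (hE _)) (hE _)).
Qed.

(** Tonelli's theorem: [energy_translation] for each [v], then integration over a cube of volume
    [t ^+ 3]. *)
Lemma integral_oscillation t : 0 <= t ->
  (\int[mu]_y oscillation f t y <= (3 * t ^+ 5)%:E * gradient_energy)%E.
Proof.
move=> t0; pose m3 := @lebesgue_measure3 R.
have mO := measurable_oscillation_integrand t mf.
under eq_integral do rewrite oscillationE.
rewrite (@fubini_tonelli _ _ _ _ _ m3 m3 _ mO (oscillation_integrand_ge0 f t)).
set c := ((3 * t ^+ 2)%:E * gradient_energy)%E.
have c0 : (0 <= c)%E.
  by apply: mule_ge0; [rewrite lee_fin mulr_ge0// sqr_ge0|exact: gradient_energy_ge0].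
have mC := @measurable_cbox R (vec3 (fun=> 0)) (vec3 (fun=> t)).
apply: (@le_trans _ _ (\int[m3]_(v in cube 0 t) c)%E); last first.
  rewrite (integral_cst _ mC) -/(cube 0 t) leb3_cube// subr0 /c muleAC -EFinM.
  by rewrite -mulrA -exprD.
rewrite [leRHS]integral_mkcond; apply: ge0_le_integral => //.
- by move=> v _; apply: integral_ge0 => x _; exact: oscillation_integrand_ge0.
- apply: (@measurable_fun_fubini_tonelli_G _ _ _ _ _ m3 _ mO).
  exact: oscillation_integrand_ge0.
- by apply/(measurable_restrictT _ mC); exact: measurable_cst.
move=> v _; rewrite patchE /oscillation_integrand /= indicE; case: ifPn => vQ.
  under eq_integral do rewrite mulr1.
  by apply: energy_translation; exact: set_mem.
by under eq_integral do rewrite mulr0; rewrite integral0.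
Qed.

End gradient.

(* The cubes of side 3r at y and y' share a cube of side r, and
   f(y) - f(y') is split at each of its points. *)
Lemma pair_oscillation f r y y' : measurable_on setT f -> 0 < r -> `|y - y'| <= r ->
  ((r ^+ 3 * (f y - f y') ^+ 2)%:E <=
    2%:E * (oscillation f (3 * r) y + oscillation f (3 * r) y'))%E.
Proof.
move=> mf r0 yy'; set t := 3 * r.
have r2 : r <= 2 * r by lra.
pose k z v := ((f (z + v) - f z) ^+ 2 * \1_(cube 0 t) v).
have mk z : measurable_on setT (k z).
  apply: measurable_funM; last first.
    by apply: (@measurable_indic _ (mR3 R) R setT (cube 0 t)); exact: measurable_cbox.
  apply: measurable_funX; apply: measurable_funB => //.
  rewrite (_ : (fun v => _) = fun v => f (v + z)); first exact: measurable_comp_shift.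
  by apply/funext => v; rewrite addrC.
have k0 z v : 0 <= k z v.
  by rewrite mulr_ge0 ?sqr_ge0// indicE; case: (_ \in _).
have oE z : oscillation f t z = (\int[mu]_v (k z v)%:E)%E by rewrite oscillationE.
(* After this substitution both integrands compare with the same value, since
   [y' + (v + (y - y')) = y + v]. *)
have oE' : oscillation f t y' = (\int[mu]_v (k y' ((v : R3 R) + (y - y'))%R)%:E)%E.
  rewrite oE (@ge0_integral_shift R (fun v => (k y' v)%:E) (y - y'))//.
    by apply/measurable_EFinP; exact: mk.
  by move=> v; rewrite lee_fin.
have my := mk y; have my' := measurable_comp_shift (y - y') (mk y').
have := leb3_cube r2; rewrite (_ : 2 * r - r = r); last by ring.
move=> cE; have mC := @measurable_cbox R (vec3 (fun=> r)) (vec3 (fun=> 2 * r)).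
have mEy := proj2 (measurable_EFinP setT (k y)) my.
have mEy' := proj2 (measurable_EFinP setT _) my'.
have ky0 v : (setT v -> 0 <= (k y v)%:E)%E by rewrite lee_fin.
have ky0' v : (setT v -> 0 <= (k y' (v + (y - y')))%:E)%E by rewrite lee_fin.
rewrite oE oE' -(@ge0_integralD _ _ _ mu setT measurableT _ _ ky0 mEy ky0' mEy').
have mD := emeasurable_funD mEy mEy'.
have D0 v : (setT v -> 0 <= (k y v)%:E + (k y' (v + (y - y')))%:E)%E.
  by move=> _; rewrite adde_ge0// lee_fin.
have z2 : (0 <= 2%:E :> \bar R)%E by rewrite lee_fin.
rewrite -(ge0_integralZl mu measurableT mD D0 z2).
apply: (@le_trans _ _ (\int[mu]_(v in cube r (2 * r)) ((f y - f y') ^+ 2)%:E)%E).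
  by rewrite (integral_cst _ mC) -/(cube r _) cE -EFinM mulrC.
rewrite [leLHS]integral_mkcond; apply: ge0_le_integral => //.
- by move=> v _; rewrite patchE; case: ifP; rewrite ?lee_fin ?sqr_ge0.
- by apply/(measurable_restrictT _ mC); exact: measurable_cst.
- exact: measurable_funeM.
move=> v _; rewrite patchE -EFinD -EFinM; case: ifPn => [|_]; last first.
  by rewrite lee_fin mulr_ge0// addr_ge0.
rewrite inE => /cubeE vC; rewrite lee_fin /k !indicE.
have v1 : cube 0 t v.
  apply/cubeE => j; have /andP[h1 h2] := vC j.
  by rewrite (le_trans (ltW r0) h1) (le_trans h2)// /t; lra.
have v2 : cube 0 t (v + (y - y')).
  apply/cubeE => j; have /andP[h1 h2] := vC j; rewrite coordD.
  have := le_trans (normr_coord j (y - y')) yy'; rewrite ler_norml => /andP[h3 h4].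
  by apply/andP; split; rewrite /t; lra.
rewrite !mem_set// !mulr1 (_ : y' + (v + (y - y')) = y + v); last first.
  by rewrite addrCA [y' + _]addrC subrK addrC.
by move: (f y) (f y') (f (y + v)) => a b c; have := sqr_ge0 (2 * c - a - b); nra.
Qed.

End oscillation.

(** * Maps close to the identity *)

Section ball_density.
Context {R : realType}.
Implicit Types (x y : R3 R) (A O : set (R3 R)).
Local Notation mu := (@leb3 R).
Variables (m : {finite_measure set (mR3 R) -> \bar R}) (c r0 : R).
Hypotheses (c0 : 0 <= c) (r00 : 0 < r0).
Hypothesis m_ball : forall (z : R3 R) (r : R), 0 < r -> r < r0 -> (m (ball z r) <= (c * (2 * r) ^+ 3)%:E)%E.

Let near_set r O : set (mR3 R * mR3 R) := [set z | ball (z.1 : R3 R) r (z.2 : R3 R) /\ O (z.2 : R3 R)].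

Let measurable_near_set r O : open O -> measurable (near_set r O).
Proof.
move=> oO.
have mD : measurable_fun [set: mR3 R * mR3 R]
    ((fun z => (z.1 : R3 R) + (-1) *: (z.2 : R3 R)) : mR3 R * mR3 R -> mR3 R).
  apply: (@measurable_funD3 R _ (mR3 R * mR3 R)%type setT fst).
    exact: (@measurable_fst _ _ (mR3 R) (mR3 R)).
  apply: (@measurable_funZ3 R _ (mR3 R * mR3 R)%type setT (cst (-1)) snd); first exact: measurable_cst.
  exact: (@measurable_snd _ _ (mR3 R) (mR3 R)).
have mB := mD measurableT _ (measurable_ball3 0 r).
have mO := (@measurable_snd _ _ (mR3 R) (mR3 R)) measurableT _ (open_measurable3 oO).
rewrite setTI in mB; rewrite setTI in mO.
rewrite (_ : near_set r O = ((fun z : mR3 R * mR3 R => (z.1 : R3 R) + (-1) *: (z.2 : R3 R)) @^-1` ball 0 r) `&` (snd @^-1` O)); first exact: (measurableI _ _ mB mO).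
have bE (y z : R3 R) : ball 0 r (y + (-1) *: z) = ball y r z.
  by rewrite -!ball_normE /ball_ /= sub0r normrN scaleN1r.
by apply/seteqP; split => -[y z] [h Oz]; split => //; move: h; rewrite /= bE.
Qed.

(** The pairs at distance less than [r] with second point in [O] are measured in two ways: a first
    point in [inner O k] sees a whole ball, of volume [(2 * r) ^+ 3], and a second point [y] sees
    [m (ball y r)], at most [c] times that volume. *)
Let m_inner O k : open O -> k.+1%:R^-1 < r0 -> (m (inner O k) <= c%:E * mu O)%E.
Proof.
move=> oO; set r := k.+1%:R^-1 => rr0; have r_gt0 : 0 < r by rewrite invr_gt0.
pose m3 := @lebesgue_measure3 R.
have mS := measurable_near_set r oO; have mO := open_measurable3 oO.
have mI := closed_measurable3 (@closed_inner R O k).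
pose f z := (\1_(near_set r O) z)%:E : \bar R.
have mf : measurable_fun [set: mR3 R * mR3 R] f by exact/measurable_EFinP/measurable_indic.
have f0 z : (0 <= f z)%E by rewrite lee_fin.
have tonelli := @fubini_tonelli _ _ _ _ _ m m3 f mf f0.
have q0 : 0 < (2 * r) ^+ 3 by rewrite exprn_gt0// mulr_gt0.
rewrite -(@lee_pmul2l _ ((2 * r) ^+ 3)%:E)// muleA muleC.
apply: (@le_trans _ _ (\int[m]_x \int[m3]_y f (x, y))%E).
  apply: (@le_trans _ _ (\int[m]_(x in inner O k) ((2 * r) ^+ 3)%:E)%E).
    by rewrite integral_cst// muleC.
  rewrite [leLHS]integral_mkcond; apply: ge0_le_integral => //.
  - by move=> x _; rewrite patchE; case: ifP; rewrite // lee_fin ltW.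
  - by apply/(measurable_restrictT _ mI); exact: measurable_cst.
  - exact: (@measurable_fun_fubini_tonelli_F _ _ _ _ _ m3 _ mf f0).
  move=> x _; rewrite patchE; case: ifPn => [xO|_]; last exact: integral_ge0.
  suff -> : (\int[m3]_y f (x, y) = mu (ball x r))%E by rewrite leb3_ball// ltW.
  rewrite -[X in mu X]setIT -(integral_indic mu measurableT (measurable_ball3 x r)).
  apply: eq_integral => y _; rewrite /f !indicE; congr ((nat_of_bool _)%:R%:E).
  apply/idP/idP; rewrite !inE; first by case.
  by move=> xy; split => //; move/set_mem: xO; apply.
rewrite tonelli.
apply: (@le_trans _ _ (\int[m3]_(y in O) (c * (2 * r) ^+ 3)%:E)%E); last first.
  by rewrite integral_cst// EFinM [(c%:E * _)%E]muleC.
rewrite [leRHS]integral_mkcond; apply: ge0_le_integral => //.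
- by move=> y _; exact: integral_ge0.
- exact: (@measurable_fun_fubini_tonelli_G _ _ _ _ _ m _ mf f0).
- by apply/(measurable_restrictT _ mO); exact: measurable_cst.
move=> y _; rewrite patchE; case: ifPn => yO; last first.
  rewrite integral0_eq// => x _; rewrite /f indicE memNset// => -[_ /= Oy].
  by rewrite (mem_set Oy) in yO.
apply: le_trans (m_ball y r_gt0 rr0).
suff -> : (\int[m]_x f (x, y) = m (ball y r))%E by [].
rewrite -[X in m X]setIT -(integral_indic m measurableT (measurable_ball3 y r)).
apply: eq_integral => x _; rewrite /f !indicE; congr ((nat_of_bool _)%:R%:E).
apply/idP/idP; rewrite !inE; first by case => /= /ball_sym.
by move=> /ball_sym xy; split => //; exact: set_mem.
Qed.

(* Average m(ball y r) over y, exchange the integrals, and let r tend to 0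
   on the points of an open set A at distance at least r from the complement. *)
Lemma ball_density A : measurable (A : set (mR3 R)) -> (m A <= c%:E * mu A)%E.
Proof.
apply: (le_measure_open c0) => O oO {A}.
pose F n := inner O n.
have mF n : measurable (F n : set (mR3 R)) by exact: closed_measurable3 (@closed_inner R O n).
have ndF : nondecreasing_seq (F : (set (mR3 R))^nat).
  move=> a b ab; apply/subsetPset => x; apply: subset_trans; apply: le_ball.
  by rewrite lef_pV2 ?posrE// ler_nat.
have FO : \bigcup_n F n = O.
  apply/seteqP; split => [x [n _]|x Ox]; first by apply; exact: ballxx.
  have /nbhs_ballP[e /= e0 eO] := open_nbhs_nbhs (conj oO Ox).
  have [k _ /(_ k (leqnn k)) ke] := near_infty_natSinv_lt (PosNum e0).
  by exists k => //; apply: subset_trans eO; apply: le_ball; exact: ltW ke.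
have mU : measurable (\bigcup_n F n : set (mR3 R)) by rewrite FO; exact: open_measurable3.
have cv : (m \o F) n @[n --> \oo] --> m O.
  by have := nondecreasing_cvg_mu (mu := m) mF mU ndF; rewrite FO.
have E : lim ((m \o F) n @[n --> \oo]) = m O by exact: cvg_lim.
apply: (@le_trans _ _ (lim ((m \o F) n @[n --> \oo]))); first by rewrite E.
apply: lime_le; first by apply/cvg_ex; exists (m O).
have [N _ HN] := near_infty_natSinv_lt (PosNum r00).
by exists N => // n /HN; exact: m_inner.
Qed.

End ball_density.

Lemma ball_density_measure {R : realType} (m : {measure set (mR3 R) -> \bar R}) (c r0 : R) :
  (m setT < +oo)%E -> 0 <= c -> 0 < r0 ->
  (forall (z : R3 R) (r : R), 0 < r -> r < r0 -> (m (ball z r) <= (c * (2 * r) ^+ 3)%:E)%E) ->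
  forall A, measurable (A : set (mR3 R)) -> (m A <= c%:E * leb3 A)%E.
Proof.
move=> moo c0 r00 mb A mA.
have := @ball_density R (mfrestr measurableT moo) c r0 c0 r00.
rewrite /= /mfrestr /mrestr => /(_ _ A mA); rewrite setIT; apply => z r r_gt0 rr0.
by rewrite setIT; exact: mb.
Qed.

Section near_identity.
Context {R : realType}.
Implicit Types (x y z v : R3 R) (i j : 'I_3) (A B D : set (R3 R)) (u g : R3 R -> R) (t r : R).
Local Notation mu := (@leb3 R).
Local Notation lam := (@lebesgue_measure R).

Lemma negligible_open_empty A : open A -> mu.-negligible A -> A = set0.
Proof.
move=> oA [N [mN N0 AN]]; apply/seteqP; split => // x Ax.
have /nbhs_ballP[r /= r0 rA] := open_nbhs_nbhs (conj oA Ax).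
have h := le_leb3 (measurable_ball3 x r) mN (subset_trans rA AN).
have : (((2 * r) ^+ 3)%:E <= 0%:E :> \bar R)%E.
  by apply: le_trans (le_trans h _); rewrite ?(leb3_ball _ (ltW r0))// le_eqVlt; apply/orP; left; apply/eqP.
by rewrite lee_fin leNgt exprn_gt0// mulr_gt0.
Qed.

Lemma line_difference_le u g j x t (d e : R) : 0 < t -> line_difference u g j t x ->
  (forall y, `|g y - d| <= e) -> `|u (x + t *: basis3 j) - u x - d * t| <= e * t.
Proof.
move=> t0 [ig E] gde.
have mI : measurable (`[0, t]%classic : set (measurableTypeR R)) by [].
have lI : lam (`[0, t]%classic : set R) = t%:E.
  by rewrite lebesgue_measure_itv/= lte_fin t0 oppr0 adde0.
have ic k : lam.-integrable `[0, t] (cst (k%:E : \bar R)).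
  apply: (@integrable_bounded _ _ _ lam _ (cst k) `|k|) => //.
  by rewrite [X in (X < _)%E]lI ltry.
have icE k : (\int[lam]_(s in `[0%R, t]) (cst k%:E s) = (k * t)%:E)%E.
  by rewrite integral_cst// [X in (_ * X)%E]lI.
rewrite ler_norml -!lee_fin; apply/andP; split.
  rewrite EFinB E -icE -(integralB mI ig (ic d)) -mulNr -icE; apply: le_integral => //.
    exact: integrableB.
  by move=> s _; rewrite -EFinB lee_fin; have := gde (x + s *: basis3 j); rewrite ler_norml => /andP[].
rewrite EFinB E -icE -(integralB mI ig (ic d)) -icE; apply: le_integral => //.
  exact: integrableB.
by move=> s _; rewrite -EFinB lee_fin; have := gde (x + s *: basis3 j); rewrite ler_norml => /andP[].
Qed.

Section increments.
Variables (D : set (R3 R)) (j : 'I_3) (u g : R3 R -> R) (d e : R).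
Hypotheses (oD : open D) (ug : weak_partial D j u g).
Hypotheses (cu : forall x, D x -> {for x, continuous u}) (gde : forall y, `|g y - d| <= e).

(** For almost every point the increment is a line integral of [g], which gives the bound. By
    continuity of [u], a violation at [x] would persist on a neighbourhood, but a nonempty open set
    is not negligible. *)
Let increment_pos x r t : ball x r `<=` D -> 0 < t -> t < r ->
  `|u (x + t *: basis3 j) - u x - d * t| <= e * t.
Proof.
move=> xD t0 tr; rewrite leNgt; apply/negP => bad.
(* A radius strictly between [t] and [r] leaves room to move [x] while the segment stays in [D]. *)
pose r' := (t + r) / 2; have tr' : t < r' by rewrite /r'; lra.
have r'r : r' < r by rewrite /r'; lra.
pose F y := `|u (y + t *: basis3 j) - u y - d * t|.
have Dt y : ball y r' `<=` D -> D (y + t *: basis3 j).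
  apply; rewrite -ball_normE /= opprD addNKr normrN; apply: norm3_lt => k.
  by rewrite coordZ coord_basis3 normrM gtr0_norm//; case: (k == j); rewrite ?normr1 ?normr0 ?mulr1 ?mulr0 ?(lt_trans t0).
have xr' : ball x r' `<=` D by apply: subset_trans xD; apply: le_ball; exact: ltW.
have cF : {for x, continuous F}.
  apply: (@continuous_comp _ _ _ (fun y => u (y + t *: basis3 j) - u y - d * t) (fun z : R => `|z|)); last exact: norm_continuous.
  apply: continuousB; last exact: cst_continuous.
  apply: continuousB; last by apply: cu; apply: xD; apply: ballxx; exact: lt_trans tr.
  apply: (@continuous_comp _ _ _ (fun y => y + t *: basis3 j) u); last by apply: cu; exact: Dt.
  by apply: continuousD; [exact: cvg_id|exact: cst_continuous].
have : nbhs x [set y | e * t < F y] by exact: (cF _ (lt_nbhsr bad)).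
have : nbhs x (ball x (r - r')) by apply: nbhsx_ballx; rewrite subr_gt0.
move=> h1 h2; have : nbhs x (ball x (r - r') `&` [set y | e * t < F y]) by exact: filterI.
rewrite nbhsE => -[U [oU Ux] UF].
suff U0 : U = set0 by rewrite U0 in Ux.
apply: negligible_open_empty => //; apply: negligibleS (line_difference_ae oD ug t0 tr').
move=> y /UF[yx Fy]; split.
  move=> z yz; apply: xD; rewrite (_ : r = (r - r') + r'); last by ring.
  exact: ball_triangle yz.
move=> /(line_difference_le t0)/(_ gde); rewrite leNgt => /negP; exact.
Qed.

(** A negative increment is a positive one seen from the other end, around which a ball of radius
    [r / 2] remains in [D]. *)
Lemma increment_le x r t : ball x r `<=` D -> `|t| < r / 2 ->
  `|u (x + t *: basis3 j) - u x - d * t| <= e * `|t|.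
Proof.
move=> xD tr; have r0 : 0 < r by have := le_lt_trans (normr_ge0 t) tr; lra.
have [t0|t0|->] := ltgtP t 0; [|rewrite (gtr0_norm t0)|by rewrite scale0r addr0 subrr mulr0 subr0 normr0 mulr0]; last first.
  apply: (increment_pos xD) => //.
  by move: tr; rewrite gtr0_norm//; lra.
have xt : ball (x + t *: basis3 j) (r / 2) `<=` D.
  move=> y xy; apply: xD; rewrite [r]splitr; apply: ball_triangle xy.
  rewrite -ball_normE /= opprD addNKr normrN; apply: norm3_lt => k.
  rewrite coordZ coord_basis3 normrM; case: (k == j); rewrite ?normr1 ?normr0 ?mulr1 ?mulr0//.
  exact: le_lt_trans tr.
have := @increment_pos (x + t *: basis3 j) (r / 2) (- t) xt.
rewrite scaleNr addrK oppr_gt0 -(ltr0_norm t0) => /(_ t0 tr).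
rewrite -normrN; apply: le_trans; rewrite le_eqVlt; apply/orP; left; apply/eqP.
by congr (`|_|); rewrite (ltr0_norm t0); ring.
Qed.

End increments.

(** Three steps parallel to the axes, each contributing [e]. The intermediate points stay within
    [r / 4] of [x], so balls of radius [r / 2] about them lie in [D] and allow steps shorter than
    [r / 4]. *)
Lemma increment3_le D u (g : 'I_3 -> R3 R -> R) (d : 'I_3 -> R) (e : R) x y r : open D ->
  (forall j, weak_partial D j u (g j)) -> (forall x, D x -> {for x, continuous u}) ->
  (forall j z, `|g j z - d j| <= e) -> ball x r `<=` D -> `|y - x| < r / 4 ->
  `|u y - u x - (d ord0 * coord ord0 (y - x) + d (inord 1) * coord (inord 1) (y - x)
      + d ord_max * coord ord_max (y - x))| <= 3 * e * `|y - x|.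
Proof.
move=> oD ug cu gde xD yx; set v := y - x.
have e0 : 0 <= e by apply: le_trans (normr_ge0 _) (gde ord0 x).
pose s i := coord i v *: basis3 i : R3 R.
have sv i (z : R3 R) (r' : R) : ball z r' `<=` D -> r / 2 <= r' ->
    `|u (z + s i) - u z - d i * coord i v| <= e * `|v|.
  move=> zD rr'; apply: le_trans (increment_le oD (ug i) cu (gde i) zD _) _.
    by apply: le_lt_trans (normr_coord i v) _; apply: (lt_le_trans yx); lra.
  by apply: ler_wpM2l => //; exact: normr_coord.
have bs (z : R3 R) : `|z - x| < r / 4 -> ball z (r / 2) `<=` D.
  move=> zx w; rewrite -ball_normE /= => zw; apply: xD; rewrite -ball_normE /=.
  rewrite -(subrKA z) (le_lt_trans (ler_normD _ _))// distrC.
  by move: (normr_ge0 (z - w)) zx zw; lra.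
have sk i k : coord k (s i) = coord i v *+ (k == i).
  by rewrite coordZ coord_basis3 mulr_natr.
have vk k : `|coord k v| < r / 4 by exact: le_lt_trans (normr_coord k v) yx.
have r4 : 0 < r / 4 by exact: le_lt_trans (normr_ge0 _) (vk ord0).
have n1 : `|x + s ord0 - x| < r / 4.
  apply: norm3_lt => k; rewrite [x + _]addrC addrK sk.
  by elim/ord3_ind: k; rewrite ?mulr1n ?inord1_eq0 ?mulr0n ?normr0.
have n2 : `|x + s ord0 + s (inord 1) - x| < r / 4.
  apply: norm3_lt => k; rewrite -(addrA x) [x + _]addrC addrK coordD !sk.
  elim/ord3_ind: k; rewrite ?eqxx ?inord1_eq0 ?(eq_sym _ (inord 1)) ?inord1_eq0 ?inord1_eq2;
    by rewrite /= ?(mulr1n, mulr0n, addr0, add0r) ?normr0.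
have yE : y = x + s ord0 + s (inord 1) + s ord_max.
  by rewrite -(subrK x y) -/v [LHS]addrC {1}(vec3_coord v) !addrA.
have rr : r / 2 <= r by lra.
have := sv ord0 x r xD rr; have := sv (inord 1) _ _ (bs _ n1) (lexx _).
have := sv ord_max _ _ (bs _ n2) (lexx _); rewrite -yE.
move: (u y) (u _) (u _) (u x) => a b c k.
rewrite !ler_norml => /andP[p1 p2] /andP[p3 p4] /andP[p5 p6].
move: p1 p2 p3 p4 p5 p6; set q := e * `|v|; rewrite -mulrA -/q => *.
apply/andP; split; lra.
Qed.

End near_identity.

Section lift.
Context {R : realType}.
Implicit Types (x y z v : R3 R) (i j : 'I_3) (A B D : set (R3 R)) (t r : R) (G H : R3 R -> R3 R).
Local Notation mu := (@leb3 R).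

(** [increment3_le] for each component, with the Kronecker symbol as reference gradient. The bound
    is local: it compares points that are close relative to the room around [x]. *)
Lemma near_identity_le D G (g : 'I_3 -> 'I_3 -> R3 R -> R) (e : R) x y r : open D ->
  (forall i j, weak_partial D j (coord i \o G) (g i j)) ->
  (forall x, D x -> {for x, continuous G}) ->
  (forall i j z, `|g i j z - (i == j)%:R| <= e) -> ball x r `<=` D -> `|y - x| < r / 4 ->
  `|(G y - G x) - (y - x)| <= 3 * e * `|y - x|.
Proof.
move=> oD wG cG ge xD yx; apply: norm3_le => i.
have cGi z : D z -> {for z, continuous (coord i \o G)}.
  by move=> Dz; apply: continuous_comp; [exact: cG|exact: continuous_coord].
have := increment3_le oD (wG i) cGi (ge i) xD yx.
have -> : coord i (G y - G x - (y - x)) = coord i (G y) - coord i (G x) - coord i (y - x).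
  by rewrite !coordB.
apply: le_trans; rewrite le_eqVlt; apply/orP; left; apply/eqP; congr (`|_ - _|).
elim/ord3_ind: i {cGi}; rewrite ?eqxx ?inord1_eq0 ?inord1_eq2 ?(eq_sym _ (inord 1))
  ?inord1_eq0 ?inord1_eq2 /= !(mul1r, mul0r, addr0, add0r)//.
Qed.

Lemma near_identity_contract G x y (e : R) : 3 * e <= 1 / 2 ->
  `|(G y - G x) - (y - x)| <= 3 * e * `|y - x| ->
  `|y - x| <= 2 * `|G y - G x| /\ `|G y - G x| <= 2 * `|y - x|.
Proof.
move=> e2 h; have n0 := normr_ge0 (y - x).
have h' : `|(G y - G x) - (y - x)| <= 1 / 2 * `|y - x|.
  by apply: le_trans h _; exact: ler_wpM2r.
have := ler_normD (G y - G x - (y - x)) (y - x); rewrite subrK => h1.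
have := ler_normB (G y - G x) (G y - G x - (y - x)); rewrite opprB addrCA subrr addr0 => h2.
by split; lra.
Qed.

(** Heine's theorem, applied to the inverse of [G]: it brings the preimages of nearby points within
    the range where [near_identity_le] holds. *)
Lemma compact_uniform_continuity B H (eta : R) : compact B -> {within B, continuous H} -> 0 < eta ->
  exists2 del : R, 0 < del & forall y y', B y -> B y' -> `|y - y'| < del -> `|H y - H y'| < eta.
Proof.
move=> cB cH eta0.
pose P (del : R) y := B y -> forall y', B y' -> `|y - y'| < del -> `|H y - H y'| < eta.
have /compact_near_coveringP/(_ R (0^'+) P _) : compact B by [].
have key y : B y -> \forall x' \near y & i \near (0:R)^'+, P i x'.
  move=> By.
  have : H @ within B (nbhs y) --> H y.
    by have /subspace_continuousP := cH; apply.
  have e2 : 0 < eta / 2 by rewrite divr_gt0.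
  move=> /cvgrPdist_lt/(_ _ e2)/nbhs_ballP[d /= d0 dH].
  exists (ball y (d / 2), [set r | r < d / 2]) => /=.
    split; first by apply: nbhsx_ballx; rewrite divr_gt0.
    by apply: nbhs_right_lt; rewrite divr_gt0.
  move=> -[y1 r] [/= yy1 rd] By1 y2 By2 y12.
  have b1 : ball y d y1 by apply: le_ball yy1; lra.
  have b2 : ball y d y2.
    rewrite [d]splitr; apply: ball_triangle yy1 _; rewrite -ball_normE /=; exact: lt_trans rd.
  have h1 := dH _ b1 By1; have h2 := dH _ b2 By2.
  rewrite -(subrKA (H y)) (le_lt_trans (ler_normD _ _))// distrC; lra.
move=> /(_ key) [d /= d0 dP].
exists (d / 2); first by rewrite divr_gt0.
move=> y y' By By' yy'; apply: (dP (d / 2)) => //=.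
- rewrite sub0r normrN gtr0_norm ?divr_gt0//; lra.
- by rewrite divr_gt0.
Qed.

(* Extending by the identity makes functions composed with G global and keeps
   integrals under control off D. *)
Definition glue D G x := if x \in D then G x else x.

Section pushforward.
Variables (D B : set (R3 R)) (G H : R3 R -> R3 R) (g : 'I_3 -> 'I_3 -> R3 R -> R) (e : R).
Hypotheses (oD : open D) (bD : bounded_set D) (cB : compact B).
Hypotheses (GB : forall x, D x -> B (G x) /\ H (G x) = x) (cH : {within B, continuous H}).
Hypothesis (cG : forall x, D x -> {for x, continuous G}).
Hypothesis wG : forall i j, weak_partial D j (coord i \o G) (g i j).
Hypothesis ge : forall i j z, `|g i j z - (i == j)%:R| <= e.
Hypothesis e_small : 3 * e <= 1 / 2.

Let mD : measurable (D : set (mR3 R)). Proof. exact: open_measurable3. Qed.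

Lemma measurable_glue : measurable_fun [set: mR3 R] (glue D G : mR3 R -> mR3 R).
Proof.
have mb : measurable_fun [set: mR3 R] (fun x : mR3 R => (x : R3 R) \in D).
  apply: (measurable_fun_bool true); rewrite setTI (_ : _ @^-1` _ = D)//.
  by apply/seteqP; split => x; [move/set_mem|move/mem_set].
apply: measurable_fun_if => //.
apply: (@measurable_funS _ _ _ _ (D : set (mR3 R))) => //.
  by move=> x [_ /set_mem].
apply/measurable_fun3P.
have mGi i : measurable_on D (coord i \o G).
  apply: within_continuous_measurable_fun => //; apply: continuous_in_subspaceT => x /set_mem Dx.
  by apply: continuous_comp; [exact: cG|exact: continuous_coord].
by split; [have := mGi ord0|have := mGi (inord 1)|have := mGi ord_max];
  apply: eq_measurable_fun => x _; rewrite /= coordE.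
Qed.

Let glue_mfun : {mfun mR3 R >-> mR3 R} :=
  HB.pack (glue D G) (isMeasurableFun.Build _ _ _ _ _ measurable_glue).

(** Two points of the preimage of a small ball of radius [s] have images within [2 * s], hence are
    close by uniform continuity of [H], hence within [4 * s] by the local Lipschitz bound. The
    preimage fits in a ball of radius [4 * s], of volume 64 times that of the given ball, and
    [ball_density_measure] passes to all sets. *)
Let measure_inner k A : measurable (A : set (mR3 R)) ->
  (mu (inner D k `&` glue D G @^-1` A) <= 64%:E * mu A)%E.
Proof.
pose r : R := k.+1%:R^-1; have r0 : 0 < r by rewrite invr_gt0.
have ID : inner D k `<=` D by move=> x; apply; exact: ballxx.
have mI : measurable (inner D k : set (mR3 R)) by exact: closed_measurable3 (@closed_inner R D k).
have [del del0 Hdel] := compact_uniform_continuity cB cH (divr_gt0 r0 (ltr0n _ 4)).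
have := @ball_density_measure R (pushforward (mrestr mu mI) glue_mfun) 64 (del / 2) _ _ (divr_gt0 del0 (ltr0n _ 2)).
rewrite /pushforward /mrestr /= => h mA; rewrite setIC; apply: h => //.
  exact: measurable_glue.
  apply: (@le_lt_trans _ _ (mu D)); last exact: bounded_leb3_lty.
  apply: le_leb3 => //; last by move=> x [_] /ID.
  by apply: measurableI => //; have := measurable_glue measurableT measurableT; rewrite setTI.
move=> z s s0 sd; rewrite /pushforward /mrestr.
have mP : measurable (glue D G @^-1` ball z s : set (mR3 R)).
  have := measurable_glue measurableT (measurable_ball3 z s); by rewrite setTI.
have [->|/set0P[x [xz xI]]] := eqVneq (glue D G @^-1` ball z s `&` inner D k) set0.
  by rewrite measure0 lee_fin mulr_ge0// exprn_ge0// mulr_ge0// ltW.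
apply: (@le_trans _ _ (mu (ball x (4 * s)))); last first.
  have s4 : 0 <= 4 * s by rewrite mulr_ge0// ltW.
  rewrite le_eqVlt; apply/orP; left; apply/eqP; apply: etrans (leb3_ball x s4) _.
  by congr EFin; ring.
apply: le_leb3; [exact: measurableI|exact: measurable_ball3|].
have bE (a b : R3 R) (q : R) : ball a q b = (`|a - b| < q) :> Prop by rewrite -ball_normE.
move=> y [yz yI]; rewrite bE.
have Gx : glue D G x = G x by rewrite /glue mem_set//; exact: ID.
have Gy : glue D G y = G y by rewrite /glue mem_set//; exact: ID.
have {}xz : `|z - G x| < s by rewrite -bE -Gx.
have {}yz : `|z - G y| < s by rewrite -bE -Gy.
have Gyx : `|G y - G x| < 2 * s.
  rewrite -(subrKA z) (le_lt_trans (ler_normD _ _))// distrC; lra.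
have [Bx Hx] := GB (ID _ xI); have [By Hy] := GB (ID _ yI).
have yx : `|y - x| < r / 4.
  by rewrite -Hx -Hy; apply: Hdel => //; apply: lt_trans Gyx _; lra.
have [h1 _] := near_identity_contract e_small (near_identity_le oD wG cG ge xI yx).
by rewrite distrC (le_lt_trans h1)//; lra.
Qed.

(** The constant is 64 for the part in [D], exhausted by the sets [inner D k], plus 1 for the part
    where the map is the identity. *)
Lemma measure_glue A : measurable (A : set (mR3 R)) ->
  (mu (glue D G @^-1` A) <= 65%:E * mu A)%E.
Proof.
move=> mA; have mP : measurable (glue D G @^-1` A : set (mR3 R)).
  by have := measurable_glue measurableT mA; rewrite setTI.
rewrite -(setIT (glue D G @^-1` A)) -(setUv D) setIUr measureU//; last 3 first.
- exact: measurableI.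
- by apply: measurableI => //; exact: measurableC.
- by apply/seteqP; split => // x [[_ Dx] [_ nDx]].
rewrite (_ : 65 = 64 + 1)%R; last by ring.
rewrite EFinD ge0_muleDl// mul1e leeD//; last first.
  apply: le_leb3 => //; first by apply: measurableI => //; exact: measurableC.
  by move=> x [/= xA nDx]; move: xA; rewrite /glue memNset.
pose F k := inner D k `&` glue D G @^-1` A.
have mI k : measurable (inner D k : set (mR3 R)) by exact: closed_measurable3 (@closed_inner R D k).
have mF k : measurable (F k : set (mR3 R)) by exact: measurableI.
have FU : \bigcup_k F k = glue D G @^-1` A `&` D.
  apply/seteqP; split => [x [k _ [xI xA]]|x [xA Dx]].
    by split => //; apply: xI; apply: ballxx; rewrite invr_gt0.
  have /nbhs_ballP[d /= d0 dD] := open_nbhs_nbhs (conj oD Dx).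
  have [k _ /(_ k (leqnn k)) kd] := near_infty_natSinv_lt (PosNum d0).
  by exists k => //; split => //; apply: subset_trans dD; apply: le_ball; exact: ltW kd.
have mU : measurable (\bigcup_k F k : set (mR3 R)) by exact: bigcup_measurable.
have ndF : nondecreasing_seq (F : (set (R3 R))^nat).
  move=> a b ab; apply/subsetPset => x [xI xA]; split => //; apply: subset_trans xI.
  by apply: le_ball; rewrite lef_pV2 ?posrE// ler_nat.
have cv : (mu \o F) n @[n --> \oo] --> mu (\bigcup_k F k).
  exact: nondecreasing_cvg_mu.
have E : lim ((mu \o F) n @[n --> \oo]) = mu (\bigcup_k F k) by exact: cvg_lim.
rewrite -FU; apply: (@le_trans _ _ (lim ((mu \o F) n @[n --> \oo]))); first by rewrite E.
apply: lime_le; first by apply/cvg_ex; exists (mu (\bigcup_k F k)).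
by apply: nearW => n; exact: measure_inner.
Qed.

Lemma integral_glue (f : R3 R -> \bar R) : measurable_fun [set: mR3 R] f ->
  (forall x, 0 <= f x)%E -> (\int[mu]_x f (glue D G x) <= 65%:E * \int[mu]_x f x)%E.
Proof.
move=> mf f0; pose m65 : {measure set (mR3 R) -> \bar R} := mscale (NngNum (ler0n R 65)) mu.
have mle S : measurable S -> (pushforward mu glue_mfun S <= m65 S)%E by exact: measure_glue.
apply: (@le_trans _ _ (\int[pushforward mu glue_mfun]_x f x)%E).
  by rewrite ge0_integral_pushforward.
have := ge0_le_measure_integral mle measurableT f0 mf => /(_ measurable_glue) h.
by apply: le_trans h _; rewrite /m65 ge0_integral_mscale.
Qed.

Lemma negligible_glue A : mu.-negligible A -> mu.-negligible (glue D G @^-1` A).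
Proof.
move=> [N [mN N0 AN]]; exists (glue D G @^-1` N); split.
- by have := measurable_glue measurableT mN; rewrite setTI.
- apply/eqP; rewrite eq_le measure_ge0 andbT (le_trans (measure_glue mN))//.
  by move: N0 => /= ->; rewrite mule0.
- by move=> x /AN.
Qed.

End pushforward.

End lift.

(** * Taylor bounds for tensor products and mass of the bumps *)

Section taylor.
Context {R : realType}.
Implicit Types (k b : R -> R) (s r M : R).

Lemma mean_value k k' s r : (forall x, is_derive x (1:R) k (k' x)) ->
  exists2 c, `|c - s| <= `|r - s| & k r - k s = k' c * (r - s).
Proof.
move=> dk.
have cont x y : {within `[x, y], continuous k}.
  apply: continuous_subspaceT => z; apply: differentiable_continuous.
  by apply/derivable1_diffP; have [] := dk z.
have [sr|rs] := leP s r.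
  have [c] := MVT_segment sr (fun x _ => dk x) (cont s r).
  rewrite in_itv /= => /andP[sc cr] ->; exists c => //.
  by rewrite !ger0_norm ?subr_ge0// lerD2r.
have [c] := MVT_segment (ltW rs) (fun x _ => dk x) (cont r s).
rewrite in_itv /= => /andP[rc cs] E; exists c.
  have h1 : c - s <= 0 by rewrite subr_le0.
  have h2 : r - s <= 0 by rewrite subr_le0 ltW.
  by rewrite (ler0_norm h1) (ler0_norm h2); lra.
by rewrite -opprB E -mulrN opprB.
Qed.

Lemma taylor2 k k' k'' M s r : (forall x, is_derive x (1:R) k (k' x)) ->
  (forall x, is_derive x (1:R) k' (k'' x)) -> (forall x, `|k' x| <= M) -> (forall x, `|k'' x| <= M) ->
  `|k r - k s| <= M * `|r - s| /\ `|k r - k s - k' s * (r - s)| <= M * `|r - s| ^+ 2.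
Proof.
move=> dk dk' M1 M2; split.
  by have [c _ ->] := mean_value s r dk; rewrite normrM ler_wpM2r.
have [c cs ->] := mean_value s r dk; rewrite -mulrBl normrM.
have [c' _ ->] := mean_value s c dk'; rewrite normrM expr2 mulrA.
by apply: ler_pM => //; exact: ler_pM.
Qed.

Lemma smooth_is_derive b x : smooth b -> is_derive x (1:R) b (derive1 b x).
Proof. by move=> sb; rewrite derive1E; apply: derivableP; exact: smooth_derivable. Qed.

Lemma derive1_out b (p q : R) : (forall s, s \notin `[p, q] -> b s = 0) ->
  forall s, s \notin `[p, q] -> derive1 b s = 0.
Proof.
move=> b0 s spq; rewrite derive1E (@near_eq_derive _ _ _ b (cst 0)) ?derive_cst ?oner_neq0//.
have : \forall t \near s, t \notin `[p, q].
  move: spq; rewrite in_itv /= negb_and -!ltNge => /orP[sp|qs].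
    near=> t; rewrite in_itv /= negb_and -!ltNge; apply/orP; left; near: t; exact: lt_nbhsl.
  near=> t; rewrite in_itv /= negb_and -!ltNge; apply/orP; right; near: t; exact: lt_nbhsr.
by apply: filterS => t /b0.
Unshelve. all: by end_near.
Qed.

Lemma smooth_bounded b (p q : R) : smooth b -> (forall s, s \notin `[p, q] -> b s = 0) ->
  exists2 M, 0 <= M & forall s, `|b s| <= M.
Proof.
move=> sb b0; have [pq|qp] := leP p q; last first.
  exists 0 => // s; rewrite b0 ?normr0// in_itv /= negb_and -!ltNge; apply/orP.
  by have [sp|ps] := ltP s p; [left|right; exact: lt_le_trans ps].
have cb : {within `[p, q], continuous (fun s => `|b s|)}.
  apply: continuous_subspaceT => s; apply: (@continuous_comp _ _ _ b (fun z : R => `|z|)).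
    exact: smooth_continuous.
  exact: norm_continuous.
have [c _ cM] := EVT_max pq cb; exists `|b c| => // s.
by have [/cM//|/b0 ->] := boolP (s \in `[p, q]); rewrite normr0.
Qed.

Lemma smooth_taylor b (p q : R) : smooth b -> (forall s, s \notin `[p, q] -> b s = 0) ->
  exists2 M, 0 <= M & forall s r, [/\ `|b s| <= M, `|derive1 b s| <= M, `|b r - b s| <= M * `|r - s| &
    `|b r - b s - derive1 b s * (r - s)| <= M * `|r - s| ^+ 2].
Proof.
move=> sb b0; have sb1 := smooth_derive1 sb; have sb2 := smooth_derive1 sb1.
have b1 := derive1_out b0; have b2 := derive1_out b1.
have [M0 M00 h0] := smooth_bounded sb b0; have [M1 M10 h1] := smooth_bounded sb1 b1.
have [M2 M20 h2] := smooth_bounded sb2 b2.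
exists (M0 + M1 + M2); first by rewrite !addr_ge0.
move=> s r; have [||h3 h4] := @taylor2 b (derive1 b) (derive1 (derive1 b)) (M0 + M1 + M2) s r
  (fun x => smooth_is_derive x sb) (fun x => smooth_is_derive x sb1).
- by move=> x; apply: le_trans (h1 x) _; rewrite -addrA addrCA lerDl addr_ge0.
- by move=> x; apply: le_trans (h2 x) _; rewrite lerDr addr_ge0.
split => //; first by apply: le_trans (h0 s) _; rewrite -addrA lerDl addr_ge0.
by apply: le_trans (h1 s) _; rewrite -addrA addrCA lerDl addr_ge0.
Qed.

(** By telescoping. The second-order remainder consists of three remainders of single factors and
    three products of two increments, whence [6 = 3 + 3]. *)
Lemma prod3_taylor (M e a0 a1 a2 b0 b1 b2 d0 d1 d2 : R) : 0 <= M -> 0 <= e ->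
  `|a0| <= M -> `|a1| <= M -> `|a2| <= M -> `|b0| <= M -> `|b1| <= M -> `|b2| <= M ->
  `|b0 - a0| <= M * e -> `|b1 - a1| <= M * e -> `|b2 - a2| <= M * e ->
  `|b0 - a0 - d0| <= M * e ^+ 2 -> `|b1 - a1 - d1| <= M * e ^+ 2 -> `|b2 - a2 - d2| <= M * e ^+ 2 ->
  `|b0 * b1 * b2 - a0 * a1 * a2| <= 3 * M ^+ 3 * e /\
  `|b0 * b1 * b2 - a0 * a1 * a2 - (d0 * a1 * a2 + a0 * d1 * a2 + a0 * a1 * d2)| <= 6 * M ^+ 3 * e ^+ 2.
Proof.
move=> M0 e0 a0M a1M a2M b0M b1M b2M h0 h1 h2 k0 k1 k2.
have p3 (x y z X Y Z : R) : `|x| <= X -> `|y| <= Y -> `|z| <= Z -> `|x * y * z| <= X * Y * Z.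
  by move=> hx hy hz; rewrite !normrM; apply: ler_pM => //; exact: ler_pM.
split.
  have -> : b0 * b1 * b2 - a0 * a1 * a2 = (b0 - a0) * b1 * b2 + a0 * (b1 - a1) * b2 + a0 * a1 * (b2 - a2) by ring.
  have -> : 3 * M ^+ 3 * e = M * e * M * M + M * (M * e) * M + M * M * (M * e) by ring.
  apply: le_trans (ler_normD _ _) _; apply: lerD; last exact: p3.
  by apply: le_trans (ler_normD _ _) _; apply: lerD; exact: p3.
have -> : b0 * b1 * b2 - a0 * a1 * a2 - (d0 * a1 * a2 + a0 * d1 * a2 + a0 * a1 * d2) =
  (b0 - a0 - d0) * a1 * a2 + a0 * (b1 - a1 - d1) * a2 + a0 * a1 * (b2 - a2 - d2) +
  ((b0 - a0) * (b1 - a1) * b2 + (b0 - a0) * a1 * (b2 - a2) + a0 * (b1 - a1) * (b2 - a2)) by ring.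
have -> : 6 * M ^+ 3 * e ^+ 2 = M * e ^+ 2 * M * M + M * (M * e ^+ 2) * M + M * M * (M * e ^+ 2) +
  (M * e * (M * e) * M + M * e * M * (M * e) + M * (M * e) * (M * e)) by ring.
apply: le_trans (ler_normD _ _) _; apply: lerD;
  by apply: le_trans (ler_normD _ _) _; apply: lerD; [apply: le_trans (ler_normD _ _) _; apply: lerD|]; exact: p3.
Qed.

Lemma tensor_taylor (b : R -> R) (p q : R) : smooth b -> (forall s, s \notin `[p, q] -> b s = 0) ->
  exists2 M, 0 <= M & forall w w' : R3 R,
    [/\ `|tensor (fun=> b) w| <= M,
     `|tensor (fun=> b) w' - tensor (fun=> b) w| <= M * `|w' - w| &
     `|tensor (fun=> b) w' - tensor (fun=> b) w -
       \sum_(i < 3) tensor (derive_tensor i (fun=> b)) w * coord i (w' - w)| <= M * `|w' - w| ^+ 2].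
Proof.
move=> sb b0; have [M M0 h] := smooth_taylor sb b0.
have M3 : 0 <= M ^+ 3 by rewrite exprn_ge0.
exists (6 * M ^+ 3) => [|w w']; first by rewrite mulr_ge0.
have nw := normr_ge0 (w' - w).
have hb j : `|b (coord j w') - b (coord j w)| <= M * `|w' - w|.
  have [_ _ + _] := h (coord j w) (coord j w'); move/le_trans; apply.
  by apply: ler_wpM2l => //; rewrite -coordB; exact: normr_coord.
have kb j : `|b (coord j w') - b (coord j w) - derive1 b (coord j w) * coord j (w' - w)| <= M * `|w' - w| ^+ 2.
  have [_ _ _] := h (coord j w) (coord j w'); rewrite coordB; move/le_trans; apply.
  apply: ler_wpM2l => //; rewrite ler_sqr ?nnegrE// -coordB; exact: normr_coord.
have ab s : `|b s| <= M by have [] := h s s.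
have [h1 h2] := prod3_taylor M0 nw (ab (coord ord0 w)) (ab (coord (inord 1) w)) (ab (coord ord_max w))
  (ab (coord ord0 w')) (ab (coord (inord 1) w')) (ab (coord ord_max w')) (hb _) (hb _) (hb _) (kb _) (kb _) (kb _).
split.
- rewrite /tensor !normrM; apply: (@le_trans _ _ (M * M * M)).
    by apply: ler_pM => //; exact: ler_pM.
  by rewrite -!expr2 -exprSr ler_peMl// ler1n.
- apply: le_trans h1 _; apply: ler_wpM2r => //; apply: ler_wpM2r => //; lra.
apply: le_trans h2; rewrite le_eqVlt; apply/orP; left; apply/eqP; congr (`|_ - _|).
have sum3 (F : 'I_3 -> R) : \sum_(i < 3) F i = F ord0 + F (inord 1) + F ord_max.
  rewrite !big_ord_recl big_ord0 addr0 addrA; congr (F _ + F _ + F _); apply/val_inj => //=.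
  by rewrite inordK.
rewrite sum3 /tensor /derive_tensor ?eqxx ?inord1_eq0 ?inord1_eq2 ?(eq_sym _ (inord 1))
  ?inord1_eq0 ?inord1_eq2 /=; ring.
Qed.

(** By dominated convergence the masses of the bumps tend to the volume [rho ^+ 3] of the box. A
    fixed lower bound relative to [rho ^+ 3] makes the normalisation of the mollifier harmless as
    [rho] tends to 0. *)
Lemma bump3_mass (rho : R) : 0 < rho -> exists n,
  ((rho ^+ 3 / 2)%:E <= \int[leb3]_v (bump3 0 (vec3 (fun=> rho)) n v)%:E)%E.
Proof.
move=> rho0; set q : R3 R := vec3 _; pose mu := @leb3 R.
pose f n (v : mR3 R) : \bar R := (bump3 0 q n v)%:E.
have mC := @measurable_cbox R 0 q.
have mf n : measurable_fun [set: mR3 R] (f n) by apply/measurable_EFinP; exact: measurable_bump3.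
have CE : cbox 0 q = cube 0 rho.
  by congr cbox; apply: coord_inj => j; rewrite coord_vec3; elim/ord3_ind: j; rewrite coordE.
have muC : mu (cbox 0 q) = (rho ^+ 3)%:E by rewrite CE /mu leb3_cube ?ltW// subr0.
have fcvg v : setT v -> f n v @[n --> \oo] --> ((\1_(box 0 q) v)%:E : \bar R).
  by move=> _; apply: cvg_EFin; [exact: nearW|exact: bump3_cvg].
have iC : mu.-integrable setT (fun v => (\1_(cbox 0 q) v)%:E).
  have mI : measurable_fun [set: mR3 R] (fun v => (\1_(cbox 0 q) v)%:E : \bar R).
    by apply/measurable_EFinP; exact: (@measurable_indic _ (mR3 R) R setT (cbox 0 q) mC).
  apply/integrableP; split; first exact: mI.
  under eq_integral do rewrite gee0_abs ?lee_fin//.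
  by rewrite (integral_indic mu measurableT mC) setIT muC ltry.
have fC v n : setT v -> (`|f n v| <= (\1_(cbox 0 q) v)%:E)%E.
  move=> _; rewrite lee_fin ger0_norm ?bump3_ge0// indicE; have [|vC] := boolP (v \in _).
    by rewrite bump3_le1.
  by rewrite bump3_out// => /box_cbox vC'; rewrite mem_set in vC.
have mB := @box_measurable R 0 q.
have mg : measurable_fun [set: mR3 R] (fun v => (\1_(box 0 q) v)%:E : \bar R) by exact/measurable_EFinP/measurable_indic.
have [_ _] := dominated_convergence measurableT mf mg (aeW _ fcvg) iC (aeW _ fC).
have -> : (\int[leb3]_x (\1_(box 0 q) x)%:E = (rho ^+ 3)%:E)%E.
  rewrite integral_indic// setIT /box leb3X//= !lebesgue_measure_itv/= !lte_fin rho0 !sube0.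
  by rewrite -!EFinM !exprS expr0 mulr1 mulrA.
move=> cv; have lt2 : ((rho ^+ 3 / 2)%:E < (rho ^+ 3)%:E :> \bar R)%E.
  by rewrite lte_fin ltr_pdivrMr// ltr_pMr ?ltr1n// exprn_gt0.
have [N _ HN] : \forall n \near \oo, ((rho ^+ 3 / 2)%:E < \int[mu]_v f n v)%E.
  by apply: (cv [set r | ((rho ^+ 3 / 2)%:E < r)%E]); apply: open_nbhs_nbhs; split => //; exact: open_ereal_gt_ereal.
by exists N; apply: ltW; apply: HN => /=.
Qed.

End taylor.

Lemma integral_bounded_mul_le d (T : measurableType d) (R : realType)
    (m : {measure set T -> \bar R}) (u h : T -> R) (k : R) :
  m.-integrable setT (EFin \o u) -> measurable_fun setT h -> (forall x, `|h x| <= k) ->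
  `|fine (\int[m]_x (u x * h x)%:E)| <= k * fine (\int[m]_x `|u x|%:E)%E.
Proof.
move=> iu mh hk.
have iuh := integrable_bounded_mul measurableT iu mh (fun x _ => hk x).
have iau : m.-integrable setT (fun x => `|u x|%:E) by exact: (integrable_abse iu).
rewrite -lee_fin EFinM -abse_EFin (fineK (integrable_fin_num measurableT iuh)).
rewrite (fineK (integrable_fin_num measurableT iau)) -(integralZl measurableT iau).
apply: le_trans (le_abse_integral m measurableT (measurable_int m iuh)) _.
apply: ge0_le_integral => //.
- by apply: measurableT_comp => //; exact: measurable_int iuh.
- by apply: measurable_int; exact: (integrableZl measurableT k iau).
by move=> x _; rewrite -EFinM lee_fin normrM mulrC ler_wpM2r.
Qed.

Lemma sqr_scale (R : realType) (q D c s : R) : 0 < q -> q / 2 <= c ->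
  (D * c) ^+ 2 <= q * s -> D ^+ 2 <= 4 * s / q.
Proof.
move=> q0 cq; rewrite exprMn => h.
have h4 : (q / 2) ^+ 2 <= c ^+ 2 by apply: lerXn2r; rewrite ?nnegrE//; lra.
have h5 : D ^+ 2 * (q / 2) ^+ 2 <= q * s.
  by apply: le_trans h; apply: ler_wpM2l => //; exact: sqr_ge0.
rewrite ler_pdivlMr// -(ler_pM2l q0); move: h5; rewrite exprMn expr2 => h5.
have e4 : (2^-1 : R) ^+ 2 = 4^-1 by field.
by rewrite e4 in h5; lra.
Qed.

Lemma taylor_combine (R : realType) (c w w' w0 w1 w2 d0 d1 d2 : R) : c != 0 ->
  w' / c - w / c - (- w0 / c * d0 + - w1 / c * d1 + - w2 / c * d2) =
  (w' + -1 * w + (d0 * w0 + d1 * w1 + d2 * w2)) / c.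
Proof. by move=> c0; field. Qed.

(** * Mollification and the chain rule *)

Section mollifier.
Context {R : realType}.
Implicit Types (u : R3 R -> R) (x y z v w : R3 R) (i j : 'I_3).
Local Notation mu := (@leb3 R).
Variables (rho : R) (n : nat).
Hypothesis rho0 : 0 < rho.
Hypothesis mass : ((rho ^+ 3 / 2)%:E <= \int[leb3]_v (bump3 0 (vec3 (fun=> rho)) n v)%:E)%E.

Let b := bump 0 rho n.
Let T : R3 R -> R := tensor (fun=> b).
Let Q := cube 0 rho.

Let TE : bump3 0 (vec3 (fun=> rho)) n = T.
Proof.
have z0 j : coord j (0 : R3 R) = 0 by exact: (raddf0 (coord j)).
by apply/funext => v; rewrite /bump3 /T /tensor /b !coord_vec3 !z0.
Qed.

Let T_out v : ~ Q v -> T v = 0.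
Proof. by move=> nQ; rewrite -TE bump3_out// => h; apply: nQ; apply/cubeE => j;
  move/boxE: h => /(_ j); rewrite coord_vec3 (raddf0 (coord j)) => /andP[/ltW -> /ltW ->]. Qed.

Let T01 v : `|T v| <= 1.
Proof. by rewrite -TE ger0_norm ?bump3_ge0// bump3_le1. Qed.

Let mT : measurable_on setT T. Proof. by rewrite -TE; exact: measurable_bump3. Qed.

Let mQ : measurable (Q : set (mR3 R)). Proof. exact: measurable_cbox. Qed.

Let muQ : mu Q = (rho ^+ 3)%:E. Proof. by rewrite /Q leb3_cube ?ltW// subr0. Qed.

Let iT : mu.-integrable setT (EFin \o T).
Proof.
have -> : EFin \o T = EFin \o (T \_ Q).
  apply/funext => v; rewrite /= patchE; case: ifPn => // vQ; rewrite T_out// => Qv.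
  by rewrite mem_set in vQ.
apply: integrable_patch; first exact: mQ.
apply: (@integrable_bounded _ _ R mu Q (T : mR3 R -> R) 1 mQ).
- by rewrite muQ ltry.
- exact: measurable_funTS.
- by move=> v _; exact: T01.
Qed.

Let c := fine (\int[mu]_v (T v)%:E).

Let c_ge : rho ^+ 3 / 2 <= c.
Proof.
by rewrite -lee_fin fineK; [rewrite -TE|exact: (integrable_fin_num measurableT iT)].
Qed.

Let c0 : 0 < c. Proof. by apply: lt_le_trans c_ge; rewrite divr_gt0// exprn_gt0. Qed.

(** A normalised average over the cube with lowest corner [y] and side [rho]. The kernel is
    off-centre so that its support matches the cube in [oscillation]. *)
Definition mollify u y := fine (\int[mu]_z (u z * T (z - y))%:E) / c.

(** It contains the support of every kernel based at a point of norm at most [L], so a locally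
    integrable function may be cut off to it. *)
Let B (L : R) : set (R3 R) := cube (- (L + rho)) (L + rho).

Let mTs y : measurable_on setT (fun z => T (z - y)).
Proof. exact: (@measurable_comp_shift R T (- y) mT). Qed.

Let patch_eq u L y z k : `|y| <= L -> (~ Q (z - y) -> k = 0) -> u z * k = (u \_ (B L)) z * k.
Proof.
move=> yL k0; rewrite patchE; case: ifPn => // zB.
rewrite k0 ?mulr0// => /cubeE h; move/negP: zB; apply; apply/mem_set/cubeE => j.
have := h j; rewrite coordB; have := le_trans (normr_coord j y) yL.
by rewrite ler_norml => /andP[? ?] /andP[? ?]; apply/andP; split; lra.
Qed.

Let iB u L : loc_integrable setT u -> mu.-integrable setT (EFin \o (u \_ (B L))).
Proof.
move=> iu; apply: integrable_patch; first exact: measurable_cbox.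
by apply: iu => //; exact: compact_cbox.
Qed.

Let NB u L := fine (\int[mu]_z `|(u \_ (B L)) z|%:E)%E.

Let NB0 u L : 0 <= NB u L. Proof. by apply: fine_ge0; exact: integral_ge0. Qed.

Let mollifyE u L y : `|y| <= L ->
  mollify u y = fine (\int[mu]_z ((u \_ (B L)) z * T (z - y))%:E) / c.
Proof.
move=> yL; rewrite /mollify; congr (fine _ / _); apply: eq_integral => z _; congr EFin.
by apply: (@patch_eq u L y z (T (z - y)) yL) => nQ; exact: T_out.
Qed.

Let iBT u L y : loc_integrable setT u ->
  mu.-integrable setT (fun z => ((u \_ (B L)) z * T (z - y))%:E).
Proof.
move=> iu; exact: (integrable_bounded_mul measurableT (iB L iu) (mTs y) (fun x _ => T01 (x - y))).
Qed.

(** Bounds on the kernel and on its increments are integrated against the function cut off to [B L].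
    The constant may depend on [rho] and [n]. *)
Lemma mollify_bound u L : loc_integrable setT u ->
  exists2 M, 0 <= M & forall y y', `|y| <= L -> `|y'| <= L ->
    `|mollify u y| <= M /\ `|mollify u y' - mollify u y| <= M * `|y' - y|.
Proof.
move=> iu; have sb : smooth b by exact: smooth_bump.
have b0 s : s \notin `[0, rho] -> b s = 0.
  by move=> h; apply: bump_out; apply: contra h; exact: subset_itv_oo_cc.
have [M M0 hM] := tensor_taylor sb b0.
exists ((1 + M) * NB u L / c); first exact: (divr_ge0 (mulr_ge0 (addr_ge0 ler01 M0) (NB0 u L)) (ltW c0)).
move=> y y' yL y'L; rewrite (mollifyE u yL) (mollifyE u y'L); split.
  rewrite normrM normfV (gtr0_norm c0) ler_pM2r ?invr_gt0//.
  apply: le_trans (integral_bounded_mul_le (iB L iu) (mTs y) (fun z => T01 (z - y))) _.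
  by apply: ler_wpM2r; [exact: NB0|rewrite lerDl].
rewrite -mulrBl normrM normfV (gtr0_norm c0) mulrAC ler_pM2r ?invr_gt0//.
have fin y0 := integrable_fin_num measurableT (iBT L y0 iu).
rewrite -fineB// -(integralB measurableT (iBT L y' iu) (iBT L y iu)).
under eq_integral do rewrite -EFinB -mulrBr.
have mD : measurable_on setT (fun z => T (z - y') - T (z - y)).
  exact: (measurable_funB (mTs y') (mTs y)).
have hD z : `|T (z - y') - T (z - y)| <= M * `|y' - y|.
  have [_ + _] := hM (z - y) (z - y'); rewrite (_ : z - y' - (z - y) = - (y' - y)) ?normrN//.
  by apply: coord_inj => j; rewrite raddfN /= !coordB; ring.
apply: le_trans (integral_bounded_mul_le (iB L iu) mD hD) _.
by rewrite mulrAC; apply: ler_wpM2r => //; apply: ler_wpM2r; [exact: NB0|rewrite lerDr].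
Qed.

Lemma sum_ord3 (F : 'I_3 -> R) : \sum_(i < 3) F i = F ord0 + F (inord 1) + F ord_max.
Proof.
rewrite !big_ord_recl big_ord0 addr0 addrA; congr (F _ + F _ + F _); apply/val_inj => //=.
by rewrite inordK.
Qed.

Let weighted u h := fine (\int[mu]_z (u z * h z)%:E).

Let iw u h := mu.-integrable setT (fun z : mR3 R => (u z * h z)%:E).

Let weightedD u h k : iw u h -> iw u k ->
  iw u (fun z => h z + k z) /\ weighted u (fun z => h z + k z) = weighted u h + weighted u k.
Proof.
move=> ih ik; have E : (fun z : mR3 R => (u z * (h z + k z))%:E) = (fun z => (u z * h z)%:E + (u z * k z)%:E)%E.
  by apply/funext => z; rewrite mulrDr.
split; first by rewrite /iw E; exact: (integrableD measurableT ih ik).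
rewrite /weighted E (integralD measurableT ih ik) fineD//; exact: (integrable_fin_num measurableT).
Qed.

Let weightedZ u h (r : R) : iw u h ->
  iw u (fun z => r * h z) /\ weighted u (fun z => r * h z) = r * weighted u h.
Proof.
move=> ih; have E : (fun z : mR3 R => (u z * (r * h z))%:E) = (fun z => r%:E * (u z * h z)%:E)%E.
  by apply/funext => z; rewrite mulrCA.
split; first by rewrite /iw E; exact: (integrableZl measurableT r ih).
by rewrite /weighted E (integralZl measurableT ih) fineM//; exact: (integrable_fin_num measurableT).
Qed.

Let derive1_shift (d s : R) : derive1 (fun s => b (s - d)) s = derive1 b (s - d).
Proof.
have sb : smooth b by exact: smooth_bump.
have h := @is_derive1_comp R b (fun s => s - d) s (derive1 b (s - d)) 1 _ _.
rewrite derive1E; have [] := h (smooth_is_derive (s - d) sb) _; last by rewrite mulr1.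
by rewrite -[X in is_derive _ _ _ X]addr0; exact: (@is_deriveD _ _ _ (@id R) (cst (- d))).
Qed.

(** The kernel is expanded to first order under the integral, and its derivatives are moved onto [u]
    by the weak derivative: mollification commutes with differentiation. *)
Lemma mollify_taylor u (g : 'I_3 -> R3 R -> R) L : (forall i, weak_partial setT i u (g i)) ->
  exists2 M, 0 <= M & forall y y', `|y| <= L -> `|y'| <= L ->
    `|mollify u y' - mollify u y - \sum_(i < 3) mollify (g i) y * coord i (y' - y)| <= M * `|y' - y| ^+ 2.
Proof.
move=> w; have sb : smooth b by exact: smooth_bump.
have iu : loc_integrable setT u by have [] := w ord0.
have b0 s : s \notin `[0, rho] -> b s = 0.
  by move=> h; apply: bump_out; apply: contra h; exact: subset_itv_oo_cc.
have [M M0 hM] := tensor_taylor sb b0.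
pose Ti i := tensor (derive_tensor i (fun=> b)).
have sbs : forall j : 'I_3, smooth b by [].
have mTi i : measurable_on setT (Ti i).
  by apply: continuous_measurable3; apply: continuous_tensor => j; exact: (@smooth_derive_tensor R i (fun=> b) sbs j).
have mTis i y : measurable_on setT (fun z => Ti i (z - y)).
  exact: (@measurable_comp_shift R (Ti i) (- y) (mTi i)).
have Ti_out i v : ~ Q v -> Ti i v = 0.
  move=> /cubeE/existsNP[j nj].
  have h : derive_tensor i (fun=> b) j (coord j v) = 0.
    rewrite /derive_tensor; case: ifP => _; [apply: (derive1_out b0)|apply: b0]; rewrite in_itv /=; exact/negP.
  rewrite /Ti /tensor; elim/ord3_ind: j h {nj} => ->; by rewrite !(mulr0, mul0r).
have [K K0 hK] : exists2 K, 0 <= K & forall i v, `|Ti i v| <= K.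
  have [N N0 hN] := smooth_taylor sb b0; exists (N * N * N); first by rewrite !mulr_ge0.
  have hd i j s : `|derive_tensor i (fun=> b) j s| <= N.
    by rewrite /derive_tensor; have [] := hN s s; case: ifP.
  by move=> i v; rewrite /Ti /tensor !normrM; apply: ler_pM => //; apply: ler_pM.
(* The translated kernel is a tensor of smooth functions supported between [y] and [y] shifted by
   [rho] in each coordinate, hence admissible in [weak_partial]. *)
have giE i y : `|y| <= L -> mollify (g i) y = - weighted (u \_ (B L)) (fun z => Ti i (z - y)) / c.
  move=> yL; rewrite /mollify; congr (_ / _).
  pose a (j : 'I_3) (s : R) := b (s - coord j y).
  have sa j : smooth (a j).
    move=> m; have := @nsmooth_affine R m b 1 (- coord j y) (sb m).
    by congr nsmooth; apply/funext => s; rewrite mul1r.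
  have a0 j s : s \notin `[coord j y, coord j (y + vec3 (fun=> rho))] -> a j s = 0.
    move=> h; apply: b0; apply: contra h; rewrite !in_itv /= coordD coord_vec3 => /andP[? ?].
    by apply/andP; split; lra.
  have [_ _ /(_ a y (y + vec3 (fun=> rho)) sa a0 (@subsetT _ _)) h] := w i.
  have E1 : (\int[mu]_z (g i z * T (z - y))%:E = \int[mu]_z (g i z * tensor a z)%:E)%E.
    by apply: eq_integral => z _; rewrite /T /tensor !coordB.
  have E2 : (\int[mu]_z ((u \_ (B L)) z * Ti i (z - y))%:E = \int[mu]_z (u z * tensor (derive_tensor i a) z)%:E)%E.
    apply: eq_integral => z _; congr EFin.
    rewrite -(@patch_eq u L y z (Ti i (z - y)) yL) => [|nQ]; last exact: Ti_out.
    congr (_ * _); rewrite /Ti /tensor !coordB /derive_tensor /a.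
    by do 3![case: ifP => _; rewrite ?derive1_shift].
  by rewrite /weighted E2 h fineN opprK E1.
exists (M * NB u L / c); first exact: (divr_ge0 (mulr_ge0 M0 (NB0 u L)) (ltW c0)).
move=> y y' yL y'L; rewrite (mollifyE u yL) (mollifyE u y'L).
rewrite sum_ord3 !giE//.
pose U := u \_ (B L).
have iTi i : iw U (fun z => Ti i (z - y)).
  exact: (integrable_bounded_mul measurableT (iB L iu) (mTis i y) (fun x _ => hK i (x - y))).
have iT0 y0 : iw U (fun z => T (z - y0)) by exact: iBT.
pose d i := coord i (y' - y).
have [i0 E0] := weightedZ (d ord0) (iTi ord0).
have [i1 E1] := weightedZ (d (inord 1)) (iTi (inord 1)).
have [i2 E2] := weightedZ (d ord_max) (iTi ord_max).
have [im Em] := weightedZ (-1) (iT0 y).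
have [i01 E01] := weightedD i0 i1; have [i012 E012] := weightedD i01 i2.
have [iTm ETm] := weightedD (iT0 y') im; have [iall Eall] := weightedD iTm i012.
set h := (X in weighted _ X = _) in Eall.
have mh : measurable_on setT h.
  have mZ r f : measurable_on setT f -> measurable_on setT (fun z => r * f z).
    by move=> mf; exact: (measurable_funM (measurable_cst r) mf).
  exact: (measurable_funD (measurable_funD (mTs y') (mZ _ _ (mTs y)))
    (measurable_funD (measurable_funD (mZ _ _ (mTis ord0 y)) (mZ _ _ (mTis (inord 1) y)))
      (mZ _ _ (mTis ord_max y)))).
have hh z : `|h z| <= M * `|y' - y| ^+ 2.
  have [_ _] := hM (z - y) (z - y').
  have e : z - y' - (z - y) = - (y' - y).
    by apply: coord_inj => j; rewrite raddfN /= !coordB; ring.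
  rewrite e normrN sum_ord3 !raddfN -!/(d _); apply: le_trans.
  by rewrite le_eqVlt; apply/orP; left; apply/eqP; congr (`|_|); rewrite /h -/T -!/(Ti _ _); ring.
have := integral_bounded_mul_le (iB L iu) mh hh; rewrite -/U -/(weighted U h) -/(NB u L) => key.
rewrite (_ : _ - _ = weighted U h / c).
  rewrite normrM normfV (gtr0_norm c0) [leRHS]mulrAC; apply: ler_wpM2r; first by rewrite invr_ge0 ltW.
  by rewrite [leRHS]mulrAC.
rewrite Eall ETm E012 E01 E0 E1 E2 Em /weighted -/U -!/(d _).
exact: taylor_combine (lt0r_neq0 c0).
Qed.

(** The difference times the mass [c] is a weighted integral of increments over a cube, so
    Cauchy-Schwarz bounds its square by [rho ^+ 3] times the oscillation. Dividing by
    [c ^+ 2 >= (rho ^+ 3 / 2) ^+ 2] leaves [4 / rho ^+ 3]. *)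
Lemma mollify_oscillation u y : loc_integrable setT u ->
  (((mollify u y - u y) ^+ 2)%:E <= (4 / rho ^+ 3)%:E * oscillation u rho y)%E.
Proof.
move=> iu; pose L := `|y|.
have mu_ : measurable_on setT u by apply: loc_integrable_measurable => //; exact: openT.
pose h z := (u \_ (B L)) z * T (z - y).
have ih : mu.-integrable setT (EFin \o h) by exact: iBT.
have hE v : h (v + y) = u (v + y) * T v.
  rewrite /h addrK; apply/esym/(@patch_eq u L y (v + y)) => //.
  by rewrite addrK; exact: T_out.
pose k v := (u (v + y) - u y) * T v.
have ish : mu.-integrable setT (fun v => (u (v + y) * T v)%:E).
  by rewrite (_ : (fun v => _) = fun v => (h (v + y))%:E); [exact: integrable_shift|apply/funext => v; rewrite hE].
have icT : mu.-integrable setT (fun v => (u y)%:E * (T v)%:E)%E by exact: (integrableZl measurableT _ iT).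
have kE : EFin \o k = (fun v => (u (v + y) * T v)%:E - (u y)%:E * (T v)%:E)%E.
  by apply/funext => v; rewrite /k /= mulrBl.
have ik : mu.-integrable setT (EFin \o k) by rewrite kE; exact: (integrableB measurableT ish icT).
have IkE : (\int[mu]_v (k v)%:E = ((mollify u y - u y) * c)%:E)%E.
  transitivity (\int[mu]_v ((u (v + y) * T v)%:E - (u y)%:E * (T v)%:E))%E.
    by apply: eq_integral => v _; exact: (congr1 (fun f => f v) kE).
  rewrite (integralB measurableT ish icT) (integralZl measurableT iT).
  rewrite -(fineK (integrable_fin_num measurableT iT)) -/c -EFinM.
  have -> : (\int[mu]_v (u (v + y) * T v)%:E = \int[mu]_z (h z)%:E)%E.
    by rewrite -(integral_shift y ih); apply: eq_integral => v _; rewrite hE.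
  rewrite -(fineK (integrable_fin_num measurableT ih)) -EFinB mulrBl; congr (_ - _)%:E.
  by rewrite (mollifyE u (lexx L)) divfK// gt_eqF.
have IQ : (\int[mu]_(v in Q) (k v)%:E = \int[mu]_v (k v)%:E)%E.
  rewrite integral_mkcond; apply: eq_integral => v _; rewrite patchE; case: ifPn => // vQ.
  by rewrite /k T_out ?mulr0// => Qv; rewrite mem_set in vQ.
have r30 : 0 < rho ^+ 3 by rewrite exprn_gt0.
have ikQ : mu.-integrable Q (EFin \o k) by exact: (integrableS measurableT mQ _ ik).
have := sqr_integral_le mQ muQ r30 ikQ; rewrite IQ IkE /= => h1.
have O0 := oscillation_ge0 u rho y.
have h2 : (\int[mu]_(v in Q) (k v ^+ 2)%:E <= oscillation u rho y)%E.
  apply: ge0_le_integral => //.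
  - by move=> v _; rewrite lee_fin sqr_ge0.
  - by apply/measurable_EFinP; apply: measurable_funX; apply/measurable_EFinP; exact: measurable_int ikQ.
  - apply/measurable_EFinP; apply: measurable_funX; apply: measurable_funB => //.
    apply: measurable_funTS; rewrite (_ : (fun v => _) = fun v => u (v + y)); first exact: measurable_comp_shift.
    by apply/funext => v; rewrite addrC.
  move=> v _; rewrite lee_fin /k exprMn [y + _]addrC ler_piMr ?sqr_ge0//.
  by rewrite -[T v ^+ 2]ger0_norm ?sqr_ge0// normrX exprn_ile1.
have : ((((mollify u y - u y) * c) ^+ 2)%:E <= (rho ^+ 3)%:E * oscillation u rho y)%E.
  by apply: le_trans h1 _; apply: lee_wpmul2l => //; rewrite lee_fin ltW.
have p0 : 0 < 4 / rho ^+ 3 by rewrite divr_gt0.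
case: (oscillation u rho y) O0 => [s| |] // s0; last by move=> _; rewrite gt0_muley ?lte_fin// leey.
rewrite -!EFinM !lee_fin => h3.
rewrite mulrAC; apply: (sqr_scale _ c_ge) h3; first exact: exprn_gt0.
Qed.

End mollifier.

(** * Uniform bounds on test functions *)

Section test_functions.
Context {R : realType}.
Implicit Types (x y z v : R3 R) (i j : 'I_3) (D K : set (R3 R)) (phi : R3 R -> R) (s t : R).
Local Notation mu := (@leb3 R).

Lemma is_derive_line phi x v s : differentiable phi (x + s *: v) ->
  is_derive s (1 : R) (fun s => phi (x + s *: v)) ('D_v phi (x + s *: v)).
Proof.
move=> dphi; have E : (fun h : R => h^-1 *: (phi (x + (h *: (1 : R) + s) *: v) - phi (x + s *: v))) =
    (fun h : R => h^-1 *: (phi (h *: v + (x + s *: v)) - phi (x + s *: v))).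
  apply/funext => h; congr (_ *: (phi _ - _)).
  by rewrite scalerDl addrCA [h *: (1 : R)]mulr1.
have dv : derivable phi (x + s *: v) v by exact: diff_derivable.
apply: DeriveDef; first by rewrite /derivable E.
by rewrite /derive E.
Qed.

Lemma continuous_compact_bounded (u : R3 R -> R) K : continuous u -> compact K ->
  (forall x, ~ K x -> u x = 0) -> exists2 M, 0 <= M & forall x, `|u x| <= M.
Proof.
move=> cu cK u0.
have /compact_bounded[N [_ hN]] : compact (u @` K).
  by apply: continuous_compact => //; exact: continuous_subspaceT.
exists (`|N| + 1); first by rewrite addr_ge0.
move=> x; have [Kx|/u0 ->] := pselect (K x); last by rewrite normr0 addr_ge0.
by apply: (hN (`|N| + 1)); [rewrite (le_lt_trans (ler_norm N))// ltrDl|exists x].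
Qed.

Lemma derive_out phi K v : closed K -> (forall x, ~ K x -> phi x = 0) ->
  forall x, ~ K x -> 'D_v phi x = 0.
Proof.
move=> cK p0 x nKx; rewrite (@near_eq_derive _ _ _ phi (cst 0)) ?derive_cst//.
have : nbhs x (~` K) by apply: open_nbhs_nbhs; split => //; exact: closed_openC.
by apply: filterS => y /p0.
Qed.

(** Derivatives up to order two along direction [i] are continuous and vanish off one compact set. A
    single constant then serves for values, increments and the first-order expansion. *)
Lemma test_function_bounds D phi i : test_function D phi -> exists K M,
  [/\ compact K, K `<=` D, 0 <= M,
     forall x, ~ K x -> phi x = 0 /\ pderiv [:: i] phi x = 0 &
     forall x t, [/\ `|phi x| <= M, `|pderiv [:: i] phi x| <= M,
       `|phi (x + t *: basis3 i) - phi x| <= M * `|t|,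
       `|pderiv [:: i] phi (x + t *: basis3 i) - pderiv [:: i] phi x| <= M * `|t| &
       `|phi (x + t *: basis3 i) - phi x - pderiv [:: i] phi x * t| <= M * `|t| ^+ 2]].
Proof.
move=> [sphi [K [cK KD p0]]]; set e := basis3 i.
have clK : closed K by apply: compact_closed => //; exact: norm_hausdorff.
pose p1 := pderiv [:: i] phi; pose p2 := pderiv [:: i; i] phi.
have z1 : forall x, ~ K x -> p1 x = 0 by exact: derive_out.
have z2 : forall x, ~ K x -> p2 x = 0 by exact: derive_out.
have cont w : continuous (pderiv w phi).
  by move=> x; apply: differentiable_continuous; exact: sphi.
have [M0 M00 h0] := continuous_compact_bounded (cont [::]) cK p0.
have [M1 M10 h1] := continuous_compact_bounded (cont [:: i]) cK z1.
have [M2 M20 h2] := continuous_compact_bounded (cont [:: i; i]) cK z2.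
pose M := M0 + M1 + M2.
have l0 : M0 <= M by rewrite /M -addrA lerDl addr_ge0.
have l1 : M1 <= M by rewrite /M -addrA addrCA lerDl addr_ge0.
have l2 : M2 <= M by rewrite /M lerDr addr_ge0.
exists K, M; split => //; first by rewrite !addr_ge0.
  by move=> x nKx; split; [exact: p0|exact: z1].
move=> x t.
have d1 s : is_derive s (1 : R) (fun s => phi (x + s *: e)) (p1 (x + s *: e)).
  by apply: is_derive_line; exact: (sphi [::]).
have d2 s : is_derive s (1 : R) (fun s => p1 (x + s *: e)) (p2 (x + s *: e)).
  by apply: is_derive_line; exact: (sphi [:: i]).
have b1 s : `|p1 (x + s *: e)| <= M by exact: le_trans (h1 _) l1.
have b2 s : `|p2 (x + s *: e)| <= M by exact: le_trans (h2 _) l2.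
have [] := taylor2 0 t d1 d2 b1 b2; rewrite subr0 scale0r addr0 => t1 t2.
split => //; [exact: le_trans (h0 x) l0|exact: le_trans (h1 x) l1|].
have [c _] := mean_value 0 t d2; rewrite subr0 scale0r addr0 => ->.
by rewrite normrM; apply: ler_wpM2r.
Qed.

(** A Lebesgue number for the covering of [K] by balls inside [D]. *)
Lemma compact_tube D K : open D -> compact K -> K `<=` D ->
  exists2 r, 0 < r & forall x, K x -> ball x r `<=` D.
Proof.
move=> oD cK KD.
have /compact_near_coveringP/(_ R (0^'+) (fun r x => ball x r `<=` D) _) : compact K by [].
have key x : K x -> \forall x' \near x & r \near (0 : R)^'+, ball x' r `<=` D.
  move=> /KD Dx; have /nbhs_ballP[d /= d0 dD] := open_nbhs_nbhs (conj oD Dx).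
  have d2 : 0 < d / 2 by rewrite divr_gt0.
  exists (ball x (d / 2), [set r | r < d / 2]) => /=.
    by split; [exact: nbhsx_ballx|exact: nbhs_right_lt].
  move=> -[y r] [/= xy rd] z yz; apply: dD; rewrite [d]splitr; apply: ball_triangle xy _.
  by apply: le_ball yz; exact: ltW.
move=> /(_ key) [d /= d0 dP]; exists (d / 2); first by rewrite divr_gt0.
move=> x Kx; apply: (dP (d / 2)) => //=; last by rewrite divr_gt0.
rewrite sub0r normrN gtr0_norm ?divr_gt0//; lra.
Qed.

End test_functions.

(** Linearity of the integral applied to an approximation with frozen coefficients. In the chain
    rule the [a0], [a1], [a2] are derivatives of the components of [G] along a segment. *)
Lemma integral_affine3 d (T : measurableType d) (R : realType) (m : {measure set T -> \bar R})
    (I : set T) (t c k p0 p1 p2 : R) (q a0 a1 a2 : T -> R) :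
  measurable I -> m I = t%:E ->
  m.-integrable I (EFin \o q) -> m.-integrable I (EFin \o a0) ->
  m.-integrable I (EFin \o a1) -> m.-integrable I (EFin \o a2) ->
  (forall s, I s -> `|q s - (k + (p0 * a0 s + p1 * a1 s + p2 * a2 s))| <= c) ->
  `|fine (\int[m]_(s in I) (q s)%:E) - (k * t + (p0 * fine (\int[m]_(s in I) (a0 s)%:E) +
     p1 * fine (\int[m]_(s in I) (a1 s)%:E) + p2 * fine (\int[m]_(s in I) (a2 s)%:E)))| <= c * t.
Proof.
move=> mI It iq i0 i1 i2 hc.
have fin f : m.-integrable I (EFin \o f) -> (\int[m]_(s in I) (f s)%:E \is a fin_num)%E.
  by move=> h; exact: integrable_fin_num h.
have Z (p : R) f : m.-integrable I (EFin \o f) -> m.-integrable I (EFin \o (fun s => p * f s)) /\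
    fine (\int[m]_(s in I) (p * f s)%:E) = p * fine (\int[m]_(s in I) (f s)%:E).
  move=> h; split; first exact: (integrableZl mI p h).
  transitivity (fine (p%:E * \int[m]_(s in I) (f s)%:E)%E); last by rewrite fineM// fin.
  by congr fine; exact: (integralZl mI h p).
have S f1 f2 : m.-integrable I (EFin \o f1) -> m.-integrable I (EFin \o f2) ->
    m.-integrable I (EFin \o (fun s => f1 s + f2 s)) /\
    fine (\int[m]_(s in I) (f1 s + f2 s)%:E) = fine (\int[m]_(s in I) (f1 s)%:E) + fine (\int[m]_(s in I) (f2 s)%:E).
  move=> h1 h2; split; first exact: (integrableD mI h1 h2).
  transitivity (fine (\int[m]_(s in I) (f1 s)%:E + \int[m]_(s in I) (f2 s)%:E)%E); last by rewrite fineD// fin.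
  by congr fine; exact: (integralD mI h1 h2).
have cst_int (r : R) : m.-integrable I (EFin \o cst r) /\ (\int[m]_(s in I) r%:E = (r * t)%:E)%E.
  split; last by rewrite integral_cst// It.
  by apply: (@integrable_bounded _ _ _ m _ (cst r) `|r|) => //; rewrite It ltry.
have [ik _] := cst_int k.
have [j0 e0] := Z p0 _ i0; have [j1 e1] := Z p1 _ i1; have [j2 e2] := Z p2 _ i2.
have [j01 e01] := S _ _ j0 j1; have [j012 e012] := S _ _ j01 j2.
have [jk ek] := S _ _ ik j012; have [jm em] := Z (-1) _ jk; have [jh eh] := S _ _ iq jm.
have -> : fine (\int[m]_(s in I) (q s)%:E) - (k * t + (p0 * fine (\int[m]_(s in I) (a0 s)%:E) +
     p1 * fine (\int[m]_(s in I) (a1 s)%:E) + p2 * fine (\int[m]_(s in I) (a2 s)%:E))) =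
   fine (\int[m]_(s in I) (q s + -1 * (k + (p0 * a0 s + p1 * a1 s + p2 * a2 s)))%:E).
  by rewrite eh em ek e012 e01 e0 e1 e2 (cst_int k).2 /= mulN1r.
rewrite -lee_fin -abse_EFin fineK ?fin// -(cst_int c).2.
apply: le_trans (le_abse_integral m mI (measurable_int m jh)) _.
apply: ge0_le_integral => //.
- by apply: measurableT_comp => //; exact: measurable_int jh.
by move=> s Is; rewrite lee_fin mulN1r; exact: hc.
Qed.

Section line_average.
Context {R : realType}.
Implicit Types (x y z v e : R3 R) (i j : 'I_3) (D K A : set (R3 R)) (s t r : R).
Local Notation mu := (@leb3 R).
Local Notation lam := (@lebesgue_measure R).

Lemma integrable_compact_support (u : R3 R -> R) K C : measurable_on setT u -> compact K ->
  (forall x, ~ K x -> u x = 0) -> (forall x, `|u x| <= C) -> mu.-integrable setT (EFin \o u).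
Proof.
move=> mu_ cK u0 uC; have mK := compact_measurable3 cK.
have -> : EFin \o u = EFin \o (u \_ K).
  apply/funext => x; rewrite /= patchE; case: ifPn => // xK; rewrite u0// => Kx.
  by rewrite mem_set in xK.
apply: integrable_patch; first exact: mK.
apply: (@integrable_bounded _ _ R mu K (u : mR3 R -> R) C mK) => //.
- exact: compact_leb3_lty.
- exact: measurable_funTS.
Qed.

Definition line_mean (q : R3 R -> R) e t x := fine (\int[lam]_s line_integrand q e t (x, s))%E.

Lemma line_mean_integral q e t : 0 < t -> mu.-integrable setT (EFin \o q) ->
  mu.-integrable setT (EFin \o line_mean q e t) /\
  (\int[mu]_x (line_mean q e t x)%:E = t%:E * \int[mu]_x (q x)%:E)%E.
Proof.
move=> t0 iq; have iL := line_integrand_integrable e t iq.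
have mF := measurable_fubini_F iL; have iF := integrable_fubini_F iL.
have mm : measurable_fun [set: mR3 R] (EFin \o line_mean q e t).
  by apply/measurable_EFinP; exact: (measurableT_comp (@fine_measurable R setT measurableT) mF).
have im : mu.-integrable setT (EFin \o line_mean q e t).
  apply: (le_integrable measurableT mm _ iF) => x _; rewrite /line_mean /fubini_F /=.
  by case: (\int[_]_s _)%E => [r| |] /=; rewrite ?normr0 ?lexx ?leey.
split=> //.
transitivity (\int[mu]_x ((\int[lam]_s line_integrand q e t (x, s)) * 1%:E))%E.
  have mF1 : measurable_fun [set: mR3 R] (fun x => (\int[lam]_s line_integrand q e t (x, s)) * 1%:E)%E.
    exact: (emeasurable_funM mF (measurable_cst _)).
  apply: (@ae_eq_integral _ _ _ mu setT _ _ measurableT mm mF1).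
  have := ae_integrable1 iL; apply: filterS => x iLx _.
  by rewrite mule1 /line_mean /= (fineK (integrable_fin_num measurableT iLx)).
have n1 x : `|(1 : R)| <= 1 by rewrite normr1.
rewrite (line_integral_swap e t iq (H := fun=> 1) (measurable_cst _) n1).
have -> : (fun x : mR3 R => (q x)%:E * \int[lam]_(s in `[0%R, t]) 1%:E)%E = (fun x => t%:E * (q x)%:E)%E.
  apply/funext => x; rewrite integral_cst// mul1e [X in (_ * X)%E](_ : _ = t%:E) 1?muleC//.
  by rewrite /= lebesgue_measure_itv/= lte_fin t0 oppr0 adde0.
exact: (integralZl measurableT iq).
Qed.

(* If q is the derivative of P along e up to an error of order t^2 at scale t,
   its line means integrate to O(t^2), while they integrate to t times the
   integral of q. *)
Lemma integral_eq0_line (P q : R3 R -> R) e A (C r : R) :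
  mu.-integrable setT (EFin \o P) -> mu.-integrable setT (EFin \o q) ->
  measurable (A : set (mR3 R)) -> (mu A < +oo)%E -> 0 < r -> 0 <= C ->
  (forall t, 0 < t -> t < r -> mu.-negligible
    [set x | ~ (`|P (x + t *: e) - P x - line_mean q e t x| <= C * t ^+ 2 * \1_A x)]) ->
  (\int[mu]_x (q x)%:E = 0)%E.
Proof.
move=> iP iq mA Aoo r0 C0 H.
have fq := integrable_fin_num measurableT iq.
rewrite -(fineK fq); congr EFin; set Q := fine _.
have fA : mu A \is a fin_num by rewrite ge0_fin_numE// measure_ge0.
pose al := fine (mu A); have al0 : 0 <= al by apply: fine_ge0; exact: measure_ge0.
have key t : 0 < t -> t < r -> `|Q| <= C * al * t.
  move=> t0 tr; have [im Im] := line_mean_integral e t0 iq.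
  have iPt : mu.-integrable setT (EFin \o (fun x => P (x + t *: e))) by exact: integrable_shift.
  have iPP := integrableB measurableT iPt iP.
  have iW := integrableB measurableT iPP im.
  pose W x := P (x + t *: e) - P x - line_mean q e t x.
  have IW : (\int[mu]_x (W x)%:E = (- (t * Q))%:E)%E.
    rewrite (integralB measurableT iPP im) (integralB measurableT iPt iP) Im.
    rewrite (integral_shift (t *: e) iP) -(fineK fq) -(fineK (integrable_fin_num measurableT iP)).
    by rewrite -!EFinM -!EFinB subrr sub0r.
  have mW : measurable_fun [set: mR3 R] (fun x => (W x)%:E) by exact: measurable_int iW.
  have m1 : measurable_fun [set: mR3 R] (fun x => (C * t ^+ 2)%:E * (\1_A x)%:E : \bar R)%E.
    by apply: measurable_funeM; apply/measurable_EFinP; exact: (@measurable_indic _ (mR3 R) R setT A mA).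
  have : (`|\int[mu]_x (W x)%:E| <= (C * t ^+ 2)%:E * mu A)%E.
    apply: le_trans (le_abse_integral mu measurableT mW) _.
    have -> : ((C * t ^+ 2)%:E * mu A = \int[mu]_x ((C * t ^+ 2)%:E * (\1_A x)%:E))%E.
      have mi : measurable_fun [set: mR3 R] (fun x => (\1_A x)%:E : \bar R).
        by apply/measurable_EFinP; exact: (@measurable_indic _ (mR3 R) R setT A mA).
      have z0 : (0 <= (C * t ^+ 2)%:E)%E by rewrite lee_fin mulr_ge0// sqr_ge0.
      have i0 x : (setT x -> 0 <= (\1_A x)%:E :> \bar R)%E by rewrite lee_fin.
      by rewrite (ge0_integralZl mu measurableT mi i0 z0) (integral_indic mu measurableT mA) setIT.
    apply: ae_ge0_le_integral => //.
    - exact: measurableT_comp.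
    - by move=> x _; rewrite -EFinM lee_fin mulr_ge0// mulr_ge0// sqr_ge0.
    apply: negligibleS (H t t0 tr) => x; apply: contra_not => h _.
    by rewrite -EFinM lee_fin.
  rewrite IW -(fineK fA) -/al -EFinM abse_EFin lee_fin normrN normrM gtr0_norm// => h.
  by rewrite -(ler_pM2l t0); apply: le_trans h _; rewrite le_eqVlt; apply/orP; left; apply/eqP; ring.
apply/eqP; rewrite -normr_le0; apply/ler_addgt0Pr => eps eps0; rewrite add0r.
have Ca : 0 < C * al + 1 by rewrite ltr_wpDl// mulr_ge0.
(* The bound [C * al * t] holds for all small [t]; this choice keeps [t] below [r] and the bound
   below [eps], also when [C * al] is zero. *)
pose t := Num.min (r / 2) (eps / (C * al + 1)).
have t0 : 0 < t by rewrite lt_min !divr_gt0.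
have tr : t < r by rewrite gt_min ltr_pdivrMr// ltr_pMr ?ltr1n.
apply: le_trans (key t t0 tr) _.
have h : t * (C * al + 1) <= eps by rewrite -ler_pdivlMr// ge_min lexx orbT.
by move: h t0; nra.
Qed.

End line_average.

Section chain_rule.
Context {R : realType}.
Implicit Types (x y z v : R3 R) (i j k : 'I_3) (s t r : R).
Local Notation mu := (@leb3 R).
Local Notation lam := (@lebesgue_measure R).

Lemma prod_increment_le (a b a' b' A B da db : R) : `|a| <= A -> `|b'| <= B ->
  `|a' - a| <= da -> `|b' - b| <= db -> `|a' * b' - a * b| <= da * B + A * db.
Proof.
move=> ha hb hda hdb; rewrite (_ : a' * b' - a * b = (a' - a) * b' + a * (b' - b)); last by ring.
by apply: le_trans (ler_normD _ _) _; rewrite !normrM; apply: lerD; apply: ler_pM.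
Qed.

Lemma norm_line i s : `|s *: basis3 i : R3 R| <= `|s|.
Proof.
apply: norm3_le => j; rewrite coordZ coord_basis3 normrM.
by case: (j == i); rewrite ?normr1 ?mulr1// normr0 mulr0.
Qed.

Lemma dist_le2 (a b c u v : R) : `|a - c| <= u -> `|b - c| <= v -> `|a - b| <= u + v.
Proof. by rewrite !ler_norml => /andP[? ?] /andP[? ?]; apply/andP; split; lra. Qed.

Lemma sum4_dist_le (a0 a1 a2 a3 b0 b1 b2 b3 u v : R) : u <= v ->
  `|a0 - b0| <= 3 * u -> `|a1 - b1| <= 3 * u * 2 -> `|a2 - b2| <= 3 * u * 2 ->
  `|a3 - b3| <= 3 * u * 2 ->
  `|a0 + (a1 + a2 + a3) - (b0 + (b1 + b2 + b3))| <= 21 * v.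
Proof.
by rewrite !ler_norml => ? /andP[? ?] /andP[? ?] /andP[? ?] /andP[? ?]; apply/andP; split; lra.
Qed.

Lemma small_le1 (e : R) : 3 * e <= 1 / 2 -> e <= 1.
Proof. lra. Qed.

Variables (D : set (R3 R)) (G : R3 R -> R3 R) (g : 'I_3 -> 'I_3 -> R3 R -> R) (e : R).
Hypothesis (oD : open D).
Hypothesis (cG : forall x, D x -> {for x, continuous G}).
Hypothesis wG : forall i j, weak_partial D j (coord i \o G) (g i j).
Hypothesis ge : forall i j z, `|g i j z - (i == j)%:R| <= e.
Hypothesis mg : forall i j, measurable_on setT (g i j).
Hypothesis e_small : 3 * e <= 1 / 2.
Variables (F : R3 R -> R) (f : 'I_3 -> R3 R -> R) (L M : R).
Hypotheses (GL : forall x, D x -> `|G x| <= L) (M0 : 0 <= M).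
Hypotheses (mF : measurable_on setT F) (mf : forall k, measurable_on setT (f k)).
Hypothesis F_regular : forall y y', `|y| <= L -> `|y'| <= L ->
  [/\ `|F y| <= M, `|F y' - F y| <= M * `|y' - y| &
    `|F y' - F y - \sum_(k < 3) f k y * coord k (y' - y)| <= M * `|y' - y| ^+ 2].
Hypothesis f_regular : forall k y y', `|y| <= L -> `|y'| <= L ->
  `|f k y| <= M /\ `|f k y' - f k y| <= M * `|y' - y|.

Lemma g_le2 i j z : `|g i j z| <= 2.
Proof.
set d : R := (i == j)%:R; have d1 : `|d| <= 1.
  by rewrite /d; case: (i == j); rewrite ?normr1 ?normr0.
have := ler_normD (g i j z - d) d; rewrite subrK => h1.
have e1 : e <= 1 by exact: small_le1.
rewrite [2](_ : _ = 1 + 1); last by ring.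
by apply: le_trans h1 _; apply: lerD => //; exact: le_trans (ge i j z) e1.
Qed.

(** [q] is the expected derivative of [P], the product of [F] composed with [G] and of [phi]; the
    claim is that its integral vanishes. By [integral_eq0_line] it suffices to compare increments of
    [P] with line integrals of [q] to second order: [F] and [phi] are expanded to first order, and
    the increments of [G] are exact line integrals of [g]. *)
Lemma chain_rule_regular i phi : test_function D phi ->
  (\int[mu]_(x in D) (F (G x) * pderiv [:: i] phi x)%:E =
   - \int[mu]_(x in D) ((\sum_(k < 3) g k i x * f k (G x)) * phi x)%:E)%E.
Proof.
move=> tphi; have [K [N [cK KD N0 out bnd]]] := test_function_bounds i tphi.
have [r r0 tube] := compact_tube oD cK KD.
pose ei : R3 R := basis3 i; pose p1 := pderiv [:: i] phi.
have mphi : measurable_on setT phi.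
  apply: continuous_measurable3 => x; apply: differentiable_continuous.
  by have [s _] := tphi; exact: (s [::]).
have mp1 : measurable_on setT p1.
  apply: continuous_measurable3 => x; apply: differentiable_continuous.
  by have [s _] := tphi; exact: (s [:: i]).
have mgl := measurable_glue oD cG.
pose U x := F (glue D G x); pose V k x := f k (glue D G x).
have mU : measurable_on setT U by exact: (measurableT_comp mF mgl).
have mV k : measurable_on setT (V k) by exact: (measurableT_comp (mf k) mgl).
have glD x : D x -> glue D G x = G x by move=> Dx; rewrite /glue mem_set.
have UM x : D x -> `|U x| <= M by move=> Dx; rewrite /U glD//; have [] := F_regular (GL Dx) (GL Dx).
have VM k x : D x -> `|V k x| <= M by move=> Dx; rewrite /V glD//; have [] := f_regular k (GL Dx) (GL Dx).
pose P x := U x * phi x.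
pose h k x := V k x * phi x * g k i x.
pose q x := U x * p1 x + (h ord0 x + h (inord 1) x + h ord_max x).
have P0 x : ~ K x -> P x = 0 by move=> /out[+ _]; rewrite /P => ->; rewrite mulr0.
have h0 k x : ~ K x -> h k x = 0 by move=> /out[+ _]; rewrite /h => ->; rewrite mulr0 mul0r.
have Up0 x : ~ K x -> U x * p1 x = 0 by move=> /out[_]; rewrite -/p1 => ->; rewrite mulr0.
have q0 x : ~ K x -> q x = 0 by move=> nK; rewrite /q !h0// Up0// !addr0.
have MN0 : 0 <= M * N by exact: mulr_ge0.
have PM x : `|P x| <= M * N.
  have [Kx|/P0 ->] := pselect (K x); last by rewrite normr0.
  by rewrite normrM; apply: ler_pM => //; [exact/UM/KD|have [] := bnd x 0].
have hM k x : `|h k x| <= M * N * 2.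
  have [Kx|/h0 ->] := pselect (K x); last by rewrite normr0 mulr_ge0.
  rewrite normrM; apply: ler_pM; [exact: normr_ge0|exact: normr_ge0| |exact: g_le2].
  by rewrite normrM; apply: ler_pM => //; [exact/VM/KD|have [] := bnd x 0].
have UpM x : `|U x * p1 x| <= M * N.
  have [Kx|/Up0 ->] := pselect (K x); last by rewrite normr0.
  by rewrite normrM; apply: ler_pM => //; [exact/UM/KD|have [] := bnd x 0].
have mP : measurable_on setT P by exact: (measurable_funM mU mphi).
have mh k : measurable_on setT (h k) by exact: (measurable_funM (measurable_funM (mV k) mphi) (mg k i)).
have mUp : measurable_on setT (fun x => U x * p1 x) by exact: (measurable_funM mU mp1).
have iP : mu.-integrable setT (EFin \o P) by exact: (integrable_compact_support mP cK P0 PM).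
have ih k : mu.-integrable setT (EFin \o h k) by exact: (integrable_compact_support (mh k) cK (h0 k) (hM k)).
have iUp : mu.-integrable setT (EFin \o (fun x => U x * p1 x)).
  exact: (integrable_compact_support mUp cK Up0 UpM).
pose H x := h ord0 x + h (inord 1) x + h ord_max x.
have iH : mu.-integrable setT (EFin \o H).
  exact: (integrableD measurableT (integrableD measurableT (ih _) (ih _)) (ih _)).
have iq : mu.-integrable setT (EFin \o q) by exact: (integrableD measurableT iUp iH).
have mD : measurable (D : set (mR3 R)) by exact: open_measurable3.
have E1 : (\int[mu]_(x in D) (F (G x) * pderiv [:: i] phi x)%:E = \int[mu]_x (U x * p1 x)%:E)%E.
  rewrite integral_mkcond; apply: eq_integral => x _; rewrite patchE.
  case: ifPn => [/set_mem Dx|xD]; first by rewrite /U glD.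
  by rewrite Up0// => /KD Dx; rewrite mem_set in xD.
have E2 : (\int[mu]_(x in D) ((\sum_(k < 3) g k i x * f k (G x)) * phi x)%:E = \int[mu]_x (H x)%:E)%E.
  rewrite integral_mkcond; apply: eq_integral => x _; rewrite patchE.
  case: ifPn => [/set_mem Dx|xD].
    by rewrite sum_ord3 /H /h /V glD//; congr EFin; ring.
  by rewrite /H !h0 ?addr0// => /KD Dx; rewrite mem_set in xD.
suff qz : (\int[mu]_x (q x)%:E = 0)%E.
  move: qz; rewrite (integralD measurableT iUp iH) E1 E2.
  rewrite -(fineK (integrable_fin_num measurableT iUp)) -(fineK (integrable_fin_num measurableT iH)).
  by rewrite -EFinD -EFinN => -[] /eqP; rewrite addr_eq0 => /eqP ->.
have [R0 R00 KR0] := bounded_sub_ball (compact_bounded cK).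
pose A : set (R3 R) := ball 0 (R0 + r).
have mA : measurable (A : set (mR3 R)) by exact: measurable_ball3.
have Aoo : (mu A < +oo)%E by rewrite /A leb3_ball ?ltry// addr_ge0 ?ltW.
(* The constant is [28 = 21 + 7]: 21 from freezing the factors of [q] on the segment, 7 from the
   expansion of [P]. The local Lipschitz bound on a ball of radius [r / 2] asks for [t] below a
   quarter of that radius. *)
apply: (@integral_eq0_line R P q ei A (28 * (M * N)) (r / 8) iP iq mA Aoo).
- by rewrite divr_gt0.
- by rewrite mulr_ge0.
move=> t t0 tr; have r2 : t < r / 2 by lra.
pose bad k := [set x | ball x (r / 2) `<=` D /\ ~ line_difference (coord k \o G) (g k i) i t x].
have nbad k : mu.-negligible (bad k) by exact: (line_difference_ae oD (wG k i) t0 r2).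
have nL : mu.-negligible (~` [set x | lam.-integrable setT (fun s => line_integrand q ei t (x, s))]).
  exact: (ae_integrable1 (line_integrand_integrable ei t iq)).
have := negligibleU (negligibleU (negligibleU (nbad ord0) (nbad (inord 1))) (nbad ord_max)) nL.
apply: negligibleS => x; apply: contra_notP => /not_orP[/not_orP[/not_orP[n0 n1] n2] /contrapT iLx].
have [iqx qxE] := line_integrand_integrableE iLx.
(* A segment that misses the support contributes zero. One that meets it lies in the tube around
   [K], so the bounds on [G] hold along it. *)
have [[s0 [s00 s0t Ks0]]|miss] := pselect (exists s, [/\ 0 <= s, s <= t & K (x + s *: ei)]); last first.
  have nK s : 0 <= s -> s <= t -> ~ K (x + s *: ei) by move=> s0 st Ks; apply: miss; exists s.
  have -> : line_mean q ei t x = 0.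
    rewrite /line_mean qxE integral0_eq// => s; rewrite /= in_itv /= => /andP[s0 st].
    by rewrite q0//; exact: nK.
  have Pt : P (x + t *: ei) = 0 by apply: P0; exact: (nK t (ltW t0) (lexx t)).
  have Px : P x = 0 by apply: P0; have := nK 0 (lexx _) (ltW t0); rewrite scale0r addr0.
  rewrite Pt Px !subrr normr0; apply: mulr_ge0; last by rewrite indicE.
  by apply: mulr_ge0; [exact: mulr_ge0|exact: sqr_ge0].
have xD : ball x (r / 2) `<=` D.
  move=> y; rewrite -ball_normE /= => xy; apply: (tube _ Ks0); rewrite -ball_normE /=.
  rewrite addrAC (le_lt_trans (ler_normD _ _))//; have := norm_line i s0; rewrite ger0_norm//; lra.
have Dxs s : 0 <= s -> s <= t -> D (x + s *: ei).
  move=> s_0 st; apply: xD; rewrite -ball_normE /= opprD addNKr normrN.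
  by apply: le_lt_trans (norm_line i s) _; rewrite ger0_norm//; lra.
have Dx : D x by apply: xD; apply: ballxx; rewrite divr_gt0.
have Gs s : 0 <= s -> s <= t -> `|G (x + s *: ei) - G x| <= 2 * s.
  move=> s_0 st; have ns : `|x + s *: ei - x| <= s.
    by rewrite addrAC subrr add0r (le_trans (norm_line i s))// ger0_norm.
  have lt4 : `|x + s *: ei - x| < r / 2 / 4 by apply: le_lt_trans ns _; lra.
  have [_ h2] := near_identity_contract e_small (near_identity_le oD wG cG ge xD lt4).
  by apply: le_trans h2 _; rewrite ler_pM2l.
have Us s : 0 <= s -> s <= t -> `|U (x + s *: ei) - U x| <= 2 * M * s.
  move=> s_0 st; rewrite /U !glD//; last exact: Dxs.
  have [_ + _] := F_regular (GL Dx) (GL (Dxs s s_0 st)); move/le_trans; apply.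
  by rewrite [2 * M]mulrC -mulrA; apply: ler_wpM2l => //; exact: Gs.
have Vs k s : 0 <= s -> s <= t -> `|V k (x + s *: ei) - V k x| <= 2 * M * s.
  move=> s_0 st; rewrite /V !glD//; last exact: Dxs.
  have [_] := f_regular k (GL Dx) (GL (Dxs s s_0 st)); move/le_trans; apply.
  by rewrite [2 * M]mulrC -mulrA; apply: ler_wpM2l => //; exact: Gs.
have ld k : ~ bad k x -> line_difference (coord k \o G) (g k i) i t x.
  by move=> nb; apply: contrapT => nl; apply: nb.
have [i0 J0] := ld _ n0; have [i1 J1] := ld _ n1; have [i2 J2] := ld _ n2.
have mI : measurable (`[0, t]%classic : set (measurableTypeR R)) by [].
have lI : lam (`[0, t]%classic : set R) = t%:E.
  by rewrite lebesgue_measure_itv/= lte_fin t0 oppr0 adde0.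
(* The Lipschitz factors are frozen at [x], while [g], merely measurable and at most 2, keeps its
   moving argument. The cost is 3 for the first term and 6 for each of the three others. *)
have qle s : (`[0, t]%classic : set R) s -> `|q (x + s *: ei) - (U x * p1 x +
   (V ord0 x * phi x * g ord0 i (x + s *: ei) + V (inord 1) x * phi x * g (inord 1) i (x + s *: ei)
    + V ord_max x * phi x * g ord_max i (x + s *: ei)))| <= 21 * (M * N) * t.
  rewrite /= in_itv /= => /andP[s_0 st].
  have [_ p1N dphi dp1 _] := bnd x s; rewrite (ger0_norm s_0) -/p1 in dphi dp1.
  have [phiN p1sN _ _ _] := bnd (x + s *: ei) 0; rewrite -/p1 in p1sN.
  have a0 := prod_increment_le (UM x Dx) p1sN (Us s s_0 st) dp1.
  have ak k : `|V k (x + s *: ei) * phi (x + s *: ei) * g k i (x + s *: ei) - V k x * phi x * g k i (x + s *: ei)|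
      <= (2 * M * s * N + M * (N * s)) * 2.
    rewrite -mulrBl normrM; apply: ler_pM; [exact: normr_ge0|exact: normr_ge0| |exact: g_le2].
    exact: (prod_increment_le (VM k x Dx) phiN (Vs k s s_0 st) dphi).
  have a1 := ak ord0; have a2 := ak (inord 1); have a3 := ak ord_max.
  have MNs : M * N * s <= M * N * t by exact: ler_wpM2l.
  have eq0 : 2 * M * s * N + M * (N * s) = 3 * (M * N * s) by ring.
  rewrite eq0 in a0 a1 a2 a3.
  have -> : 21 * (M * N) * t = 21 * (M * N * t) by ring.
  exact: (sum4_dist_le MNs a0 a1 a2 a3).
have := integral_affine3 mI lI iqx i0 i1 i2 qle.
rewrite -J0 -J1 -J2 /= -qxE -/(line_mean q ei t x) => mean_le.
have xA : \1_A x = 1 :> R.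
  rewrite indicE mem_set// /A -ball_normE /= sub0r normrN.
  have := KR0 _ Ks0; rewrite -ball_normE /= sub0r normrN => kx.
  rewrite -[x](addrK (s0 *: ei)) (le_lt_trans (ler_normB _ _))//.
  by have := norm_line i s0; rewrite (ger0_norm s00); lra.
rewrite xA mulr1.
have Dxt := Dxs t (ltW t0) (lexx t).
have [_ _ dphi _ d2phi] := bnd x t; have [phiN _ _ _ _] := bnd x 0.
rewrite (gtr0_norm t0) -/p1 in dphi d2phi.
have [FM _ F2] := F_regular (GL Dx) (GL Dxt).
have Ut := Us t (ltW t0) (lexx t).
have {}F2 : `|F (G (x + t *: ei)) - F (G x) - \sum_(k < 3) f k (G x) * coord k (G (x + t *: ei) - G x)| <= 4 * (M * t ^+ 2).
  apply: le_trans F2 _; rewrite [leRHS]mulrCA; apply: ler_wpM2l => //.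
  have := Gs t (ltW t0) (lexx t) => h2; rewrite (_ : 4 * t ^+ 2 = (2 * t) ^+ 2); last by ring.
  by apply: lerXn2r; rewrite ?nnegrE// mulr_ge0// ltW.
(* Three errors: the remainder of [F], with the factor 4 because [G] at most doubles distances; the
   remainder of [phi], with 1; the product of both increments, with 2. *)
have key : `|P (x + t *: ei) - P x - (U x * p1 x * t + (V ord0 x * phi x * (coord ord0 (G (x + t *: ei)) - coord ord0 (G x)) +
    V (inord 1) x * phi x * (coord (inord 1) (G (x + t *: ei)) - coord (inord 1) (G x)) +
    V ord_max x * phi x * (coord ord_max (G (x + t *: ei)) - coord ord_max (G x))))| <= 7 * (M * N) * t ^+ 2.
  have -> : 7 * (M * N) * t ^+ 2 = 4 * (M * t ^+ 2) * N + M * (N * t ^+ 2) + 2 * M * t * (N * t) by ring.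
  have z1 : `|(F (G (x + t *: ei)) - F (G x) - \sum_(k < 3) f k (G x) * coord k (G (x + t *: ei) - G x)) * phi x| <= 4 * (M * t ^+ 2) * N.
    by rewrite normrM; apply: ler_pM.
  have z2 : `|F (G x) * (phi (x + t *: ei) - phi x - p1 x * t)| <= M * (N * t ^+ 2).
    by rewrite normrM; apply: ler_pM.
  have z3 : `|(U (x + t *: ei) - U x) * (phi (x + t *: ei) - phi x)| <= 2 * M * t * (N * t).
    by rewrite normrM; apply: ler_pM.
  apply: le_trans (le_trans (ler_normD _ _) (lerD (le_trans (ler_normD _ _) (lerD z1 z2)) z3)).
  rewrite le_eqVlt; apply/orP; left; apply/eqP; congr (`|_|).
  rewrite /P /U /V !glD// sum_ord3 !coordB; ring.
apply: le_trans (dist_le2 key mean_le) _.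
by rewrite le_eqVlt; apply/orP; left; apply/eqP; ring.
Qed.

End chain_rule.

(** * Weighted integrals of square-integrable functions *)

Section square_integrable.
Context {R : realType}.
Implicit Types (x y z v : R3 R) (i j k : 'I_3) (u w h : R3 R -> R) (s t r : R).
Local Notation mu := (@leb3 R).

Lemma integrable_energy w : measurable_on setT w -> (energy w < +oo)%E ->
  mu.-integrable setT (fun x => (w x ^+ 2)%:E).
Proof.
move=> mw wE; apply/integrableP; split; first exact: measurable_sqr.
by under eq_integral do rewrite gee0_abs ?lee_fin ?sqr_ge0//.
Qed.

(** Young's inequality: the absolute value of [w] is at most [r + w ^+ 2 / r] on [K]. The parameter
    stays free: for an error of energy of order [rho ^+ 2], taking [r = rho] bounds the integral by
    a multiple of [rho]. *)
Lemma energy_weight (K : set (R3 R)) w h (N : R) : compact K -> 0 <= N ->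
  measurable_on setT w -> (energy w < +oo)%E -> measurable_on setT h ->
  (forall x, ~ K x -> h x = 0) -> (forall x, `|h x| <= N) ->
  mu.-integrable setT (fun x => (w x * h x)%:E) /\
  forall r, 0 < r -> `|fine (\int[mu]_x (w x * h x)%:E)| <=
    N * (r * fine (mu K) + r^-1 * fine (energy w)).
Proof.
move=> cK N0 mw wE mh h0 hN; have mK := compact_measurable3 cK.
have Koo := compact_leb3_lty cK.
have fK : mu K \is a fin_num by rewrite ge0_fin_numE// measure_ge0.
have fw : energy w \is a fin_num by rewrite ge0_fin_numE// energy_ge0.
have iw2 := integrable_energy mw wE.
have mKi : measurable_on setT (\1_K : R3 R -> R) by exact: (@measurable_indic _ (mR3 R) R setT K mK).
have iK : mu.-integrable setT (EFin \o (\1_K : R3 R -> R)).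
  apply: (integrable_compact_support mKi cK (C := 1)) => x; first by move=> nK; rewrite indicE memNset.
  by rewrite indicE; case: (_ \in _); rewrite ?normr1 ?normr0.
pose B r x : R := N * r * \1_K x + N * r^-1 * w x ^+ 2.
have iB r : mu.-integrable setT (EFin \o B r) /\
    (\int[mu]_x (B r x)%:E = (N * (r * fine (mu K) + r^-1 * fine (energy w)))%:E)%E.
  have i1 := integrableZl measurableT (N * r) iK; have i2 := integrableZl measurableT (N * r^-1) iw2.
  split; first exact: (integrableD measurableT i1 i2).
  transitivity (\int[mu]_x ((N * r)%:E * (\1_K x)%:E) + \int[mu]_x ((N * r^-1)%:E * (w x ^+ 2)%:E))%E.
    exact: (integralD measurableT i1 i2).
  rewrite (integralZl measurableT iK) (integralZl measurableT iw2).
  rewrite (integral_indic mu measurableT mK) setIT -/(energy w).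
  by rewrite -{1}(fineK fK) -{1}(fineK fw) -!EFinM -EFinD mulrDr !mulrA.
have mwh : measurable_fun [set: mR3 R] (fun x => (w x * h x)%:E).
  by apply/measurable_EFinP; exact: measurable_funM.
have le r x : 0 < r -> `|w x * h x| <= B r x.
  move=> r0; rewrite /B indicE; have [/set_mem Kx|nK] := boolP (x \in K); last first.
    rewrite h0 ?mulr0 ?normr0 ?add0r; last by move=> Kx; rewrite mem_set in nK.
    by rewrite mulr_ge0 ?sqr_ge0// mulr_ge0 ?invr_ge0// ltW.
  rewrite normrM mulr1 -mulrA -mulrDr mulrC; apply: ler_pM => //.
  rewrite -(ler_pM2l r0) mulrDr mulrA divff ?gt_eqF// mul1r -(real_normK (num_real (w x))).
  by have := sqr_ge0 (r - `|w x|); have := sqr_ge0 (r + `|w x|); nra.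
have iwh : mu.-integrable setT (fun x => (w x * h x)%:E).
  apply: (le_integrable measurableT mwh _ (iB 1).1) => x _.
  by rewrite lee_fin (le_trans (le 1 x ltr01))// ler_norm.
split => // r r0; rewrite -lee_fin -(iB r).2 -abse_EFin (fineK (integrable_fin_num measurableT iwh)).
apply: le_trans (le_abse_integral mu measurableT mwh) _.
apply: ge0_le_integral => //.
- exact: measurableT_comp.
- exact: measurable_int (iB r).1.
- by move=> x _; rewrite lee_fin; exact: le.
Qed.

Lemma energyB_lty u w : measurable_on setT u -> measurable_on setT w ->
  (energy w < +oo)%E -> (energy (fun x => u x - w x)%R < +oo)%E -> (energy u < +oo)%E.
Proof.
move=> mu_ mw wE dE; have m0 : measurable_on setT (fun=> 0 : R) by exact: measurable_cst.
have := energyD3 mw (measurable_funB mu_ mw) m0.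
rewrite (_ : (fun x => _) = u); last by apply/funext => x; rewrite addr0 addrC subrK.
move/le_lt_trans; apply; rewrite lte_mul_pinfty ?lee_fin//.
have E0 : energy (fun=> 0 : R) = 0%E.
  by rewrite /energy integral0_eq// => x _; rewrite expr0n.
by rewrite E0 adde0 lte_add_pinfty.
Qed.

Lemma lipschitz_measurable u : (forall L, exists2 M, 0 <= M & forall y y' : R3 R, `|y| <= L ->
  `|y'| <= L -> `|u y' - u y| <= M * `|y' - y|) -> measurable_on setT u.
Proof.
move=> H; apply: continuous_measurable3 => y; apply/cvgrPdist_lt => eps eps0.
have [M M0 hM] := H (`|y| + 1).
have M1 : 0 < M + 1 by rewrite ltr_wpDl.
have d0 : 0 < Num.min 1 (eps / (M + 1)) by rewrite lt_min ltr01 divr_gt0.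
have : nbhs y (ball y (Num.min 1 (eps / (M + 1)))) by exact: nbhsx_ballx.
apply: filterS => z; rewrite -ball_normE /= lt_min => /andP[z1 ze].
have zL : `|z| <= `|y| + 1.
  by rewrite -(subrK y z) addrC (le_trans (ler_normD _ _))// lerD2l distrC ltW.
rewrite distrC; apply: le_lt_trans (hM y z _ zL) _; first by rewrite lerDl.
rewrite distrC; apply: (@le_lt_trans _ _ ((M + 1) * `|y - z|)); first by rewrite ler_wpM2r// lerDl.
by rewrite mulrC -ltr_pdivlMr.
Qed.

(** The pointwise bound [4 / rho ^+ 3] times the oscillation is integrated, and the integral of the
    oscillation is at most [3 * rho ^+ 5] times the gradient energy: the product is
    [12 * rho ^+ 2]. *)
Lemma mollify_energy (rho : R) n u (g : 'I_3 -> R3 R -> R) : 0 < rho ->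
  ((rho ^+ 3 / 2)%:E <= \int[leb3]_v (bump3 0 (vec3 (fun=> rho)) n v)%:E)%E ->
  (forall i, weak_partial setT i u (g i)) ->
  measurable_on setT (mollify rho n u) /\
  (energy (fun x => mollify rho n u x - u x)%R <= (12 * rho ^+ 2)%:E * gradient_energy g)%E.
Proof.
move=> rho0 mass w.
have iu : loc_integrable setT u by have [] := w ord0.
have mu_ := loc_integrable_measurable openT iu.
have mg i : measurable_on setT (g i) by have [_ ig _] := w i; exact: (loc_integrable_measurable openT ig).
have mm : measurable_on setT (mollify rho n u).
  apply: lipschitz_measurable => L; have [M M0 hM] := mollify_bound rho0 mass L iu.
  by exists M => // y y' yL y'L; have [] := hM y y' yL y'L.
split => //; have mo := measurable_oscillation rho mu_.
have r3 : 0 < 4 / rho ^+ 3 by rewrite divr_gt0// exprn_gt0.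
apply: (@le_trans _ _ (\int[mu]_x ((4 / rho ^+ 3)%:E * oscillation u rho x))%E).
  apply: ge0_le_integral => //.
  - by move=> x _; rewrite lee_fin sqr_ge0.
  - by apply: measurable_sqr; exact: measurable_funB.
  - exact: measurable_funeM.
  - by move=> x _; exact: mollify_oscillation.
rewrite (ge0_integralZl mu measurableT mo (fun x _ => oscillation_ge0 u rho x)); last by rewrite lee_fin ltW.
apply: le_trans (lee_wpmul2l _ (integral_oscillation mu_ mg w (ltW rho0))) _; first by rewrite lee_fin ltW.
rewrite muleA -EFinM le_eqVlt; apply/orP; left; apply/eqP; congr (_%:E * _)%E.
by field; rewrite gt_eqF.
Qed.

End square_integrable.

Lemma sum4_close (R : realType) (a a0 a1 a2 b b0 b1 b2 c c0 c1 c2 r : R) :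
  b = - (b0 + b1 + b2) -> `|a - b| <= c * r -> `|a0 - b0| <= c0 * r ->
  `|a1 - b1| <= c1 * r -> `|a2 - b2| <= c2 * r ->
  `|a + (a0 + a1 + a2)| <= (c + c0 + c1 + c2) * r.
Proof.
move=> -> ; rewrite !mulrDl !ler_norml => /andP[? ?] /andP[? ?] /andP[? ?] /andP[? ?].
by apply/andP; split; lra.
Qed.

Lemma sum5_ge (R : realType) (a b c d e : R) : 0 <= a -> 0 <= b -> 0 <= c -> 0 <= d -> 0 <= e ->
  [/\ a <= a + b + c + d + e, b <= a + b + c + d + e, c <= a + b + c + d + e,
      d <= a + b + c + d + e & e <= a + b + c + d + e].
Proof. by split; lra. Qed.

(** * The chain rule for Sobolev functions *)

Section chain_rule.
Context {R : realType}.
Implicit Types (x y z v : R3 R) (i j k : 'I_3) (u w h : R3 R -> R) (s t r : R).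
Local Notation mu := (@leb3 R).
Variables (D B : set (R3 R)) (G H : R3 R -> R3 R) (g : 'I_3 -> 'I_3 -> R3 R -> R) (e : R).
Hypotheses (oD : open D) (bD : bounded_set D) (cB : compact B).
Hypotheses (GB : forall x, D x -> B (G x) /\ H (G x) = x) (cH : {within B, continuous H}).
Hypothesis (cG : forall x, D x -> {for x, continuous G}).
Hypothesis wG : forall i j, weak_partial D j (coord i \o G) (g i j).
Hypothesis ge : forall i j z, `|g i j z - (i == j)%:R| <= e.
Hypothesis mg : forall i j, measurable_on setT (g i j).
Hypothesis e_small : 3 * e <= 1 / 2.

Let integral_gl := integral_glue oD bD cB GB cH cG wG ge e_small.

Lemma energy_glue u : measurable_on setT u ->
  (energy (fun x => u (glue D G x)) <= 65%:E * energy u)%E.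
Proof.
move=> mu_; apply: (integral_gl (f := fun x => (u x ^+ 2)%:E)); first exact: measurable_sqr.
by move=> x; rewrite lee_fin sqr_ge0.
Qed.

Let mgl u : measurable_on setT u -> measurable_on setT (fun x => u (glue D G x)).
Proof. by move=> mu_; exact: (measurableT_comp mu_ (measurable_glue oD cG)). Qed.

Lemma energy_glue_lty u : measurable_on setT u -> (energy u < +oo)%E ->
  (energy (fun x => u (glue D G x)) < +oo)%E.
Proof.
by move=> mu_ uE; apply: le_lt_trans (energy_glue mu_) _; rewrite lte_mul_pinfty ?lee_fin.
Qed.

Variables (f : R3 R -> R) (f1 : 'I_3 -> R3 R -> R) (f2 : 'I_3 -> 'I_3 -> R3 R -> R).
Hypotheses (wf : forall k, weak_partial setT k f (f1 k)).
Hypotheses (wf1 : forall k j, weak_partial setT j (f1 k) (f2 k j)).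
Hypotheses (Ef : (energy f < +oo)%E) (Ef1 : forall k, (energy (f1 k) < +oo)%E).
Hypothesis Ef2 : forall k j, (energy (f2 k j) < +oo)%E.

Variables (i : 'I_3) (phi : R3 R -> R).
Hypothesis tphi : test_function D phi.

Let F u h := fine (\int[mu]_x (u (glue D G x) * h x)%:E).

(** Both sides of the chain rule become sums of real numbers [F u h] with [h] supported in [K],
    which can be compared term by term for a function and its mollification. *)
Let split_integral u (u1 : 'I_3 -> R3 R -> R) K N : measurable_on setT u ->
  (forall k, measurable_on setT (u1 k)) -> (energy u < +oo)%E -> (forall k, (energy (u1 k) < +oo)%E) ->
  compact K -> K `<=` D -> 0 <= N -> (forall x, ~ K x -> phi x = 0 /\ pderiv [:: i] phi x = 0) ->
  (forall x, `|phi x| <= N) -> (forall x, `|pderiv [:: i] phi x| <= N) ->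
  measurable_on setT phi -> measurable_on setT (pderiv [:: i] phi) ->
  (\int[mu]_(x in D) (u (G x) * pderiv [:: i] phi x)%:E = (F u (pderiv [:: i] phi))%:E)%E /\
  (\int[mu]_(x in D) ((\sum_(k < 3) g k i x * u1 k (G x)) * phi x)%:E =
    (F (u1 ord0) (fun x => g ord0 i x * phi x) + F (u1 (inord 1)) (fun x => g (inord 1) i x * phi x)
     + F (u1 ord_max) (fun x => g ord_max i x * phi x))%:E)%E.
Proof.
move=> mu_ mu1 uE u1E cK KD N0 out phiN p1N mphi mp1.
have N2 : 0 <= N * 2 by exact: mulr_ge0.
have gp0 k x : ~ K x -> g k i x * phi x = 0 by move=> /out[-> _]; rewrite mulr0.
have gpN k x : `|g k i x * phi x| <= N * 2.
  rewrite normrM mulrC; apply: ler_pM; [exact: normr_ge0|exact: normr_ge0|exact: phiN|].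
  exact: (g_le2 ge e_small).
have mgp k : measurable_on setT (fun x => g k i x * phi x) by exact: (measurable_funM (mg k i) mphi).
have p10 x : ~ K x -> pderiv [:: i] phi x = 0 by move=> /out[].
have [iu _] := energy_weight cK N0 (mgl mu_) (energy_glue_lty mu_ uE) mp1 p10 p1N.
have iu1 k := (energy_weight cK N2 (mgl (mu1 k)) (energy_glue_lty (mu1 k) (u1E k)) (mgp k) (gp0 k) (gpN k)).1.
split.
  rewrite /F (fineK (integrable_fin_num measurableT iu)) [LHS]integral_mkcond; apply: eq_integral => x _.
  rewrite patchE; case: ifPn => xD; first by rewrite /glue xD.
  by rewrite p10 ?mulr0// => /KD Dx; rewrite mem_set in xD.
rewrite !EFinD /F !(fineK (integrable_fin_num measurableT (iu1 _))).
rewrite -(integralD measurableT (iu1 _) (iu1 _)).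
rewrite -(integralD measurableT (integrableD measurableT (iu1 _) (iu1 _)) (iu1 _)).
rewrite [LHS]integral_mkcond; apply: eq_integral => x _; rewrite patchE; case: ifPn => xD.
  by rewrite /glue xD sum_ord3 -!EFinD; congr EFin; ring.
by rewrite -!EFinD !gp0 ?mulr0 ?addr0// => /KD Dx; rewrite mem_set in xD.
Qed.

(** The identity holds for the mollifications of [f] and of its first derivatives. Each of its four
    terms changes by a multiple of [rho] when the mollification is removed, since composition with
    [glue] multiplies energies by at most 65; then [rho] tends to 0. *)
Lemma chain_rule :
  (\int[mu]_(x in D) (f (G x) * pderiv [:: i] phi x)%:E =
   - \int[mu]_(x in D) ((\sum_(k < 3) g k i x * f1 k (G x)) * phi x)%:E)%E.
Proof.
have [K [N [cK KD N0 out bnd]]] := test_function_bounds i tphi.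
have phiN x : `|phi x| <= N by have [] := bnd x 0.
have p1N x : `|pderiv [:: i] phi x| <= N by have [] := bnd x 0.
have msm (w' : seq 'I_3) : measurable_on setT (pderiv w' phi).
  apply: continuous_measurable3 => x; apply: differentiable_continuous.
  by have [s _] := tphi; exact: s.
have mphi : measurable_on setT phi := msm [::].
have mp1 := msm [:: i].
have mf : measurable_on setT f by have [h _ _] := wf ord0; exact: (loc_integrable_measurable openT h).
have mf1 k : measurable_on setT (f1 k) by have [_ h _] := wf k; exact: (loc_integrable_measurable openT h).
have [-> ->] := split_integral mf mf1 Ef Ef1 cK KD N0 out phiN p1N mphi mp1.
rewrite -EFinN; congr EFin; apply/eqP; rewrite -addr_eq0 -normr_le0.
set S := _ + _; have [L0 L00 BL] := bounded_sub_ball (compact_bounded cB).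
have GL x : D x -> `|G x| <= L0.
  by move=> /GB[/BL + _]; rewrite -ball_normE /= sub0r normrN => /ltW.
have N2 : 0 <= N * 2 by exact: mulr_ge0.
have gp0 k x : ~ K x -> g k i x * phi x = 0 by move=> /out[-> _]; rewrite mulr0.
have gpN k x : `|g k i x * phi x| <= N * 2.
  rewrite normrM mulrC; apply: ler_pM; [exact: normr_ge0|exact: normr_ge0|exact: phiN|].
  exact: (g_le2 ge e_small).
have mgp k : measurable_on setT (fun x => g k i x * phi x) by exact: (measurable_funM (mg k i) mphi).
have p10 x : ~ K x -> pderiv [:: i] phi x = 0 by move=> /out[].
have ge_lty (v : 'I_3 -> R3 R -> R) : (forall k, (energy (v k) < +oo)%E) -> (gradient_energy v < +oo)%E.
  by move=> h; apply: lte_add_pinfty => //; exact: lte_add_pinfty.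
have approx u (d : 'I_3 -> R3 R -> R) : measurable_on setT u -> (energy u < +oo)%E -> (forall k, weak_partial setT k u (d k)) ->
    (forall k, (energy (d k) < +oo)%E) -> exists2 C, 0 <= C &
    forall (rho : R) n, 0 < rho ->
    ((rho ^+ 3 / 2)%:E <= \int[leb3]_v (bump3 0 (vec3 (fun=> rho)) n v)%:E)%E ->
    [/\ measurable_on setT (mollify rho n u), (energy (mollify rho n u) < +oo)%E &
    forall h, measurable_on setT h -> (forall x, ~ K x -> h x = 0) -> (forall x, `|h x| <= N * 2) ->
      `|F u h - F (mollify rho n u) h| <= C * rho].
  move=> mu_ uE wu vE; set E := fine (gradient_energy d).
  have fE : gradient_energy d \is a fin_num by rewrite ge0_fin_numE ?ge_lty// gradient_energy_ge0.
  have E0 : 0 <= E by apply: fine_ge0; exact: gradient_energy_ge0.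
  (* [780 = 65 * 12]: the cost of composing with [glue] times the constant of [mollify_energy]. The
     factor 2 in [N * 2] bounds the entries of the Jacobian. *)
  exists (N * 2 * (fine (mu K) + 780 * E)).
    apply: mulr_ge0; first exact: N2.
    by apply: addr_ge0; [apply: fine_ge0; exact: measure_ge0|apply: mulr_ge0; [exact: ler0n|exact: E0]].
  move=> rho n rho0 mass; have [mm mE] := mollify_energy rho0 mass wu.
  have dE : (energy (fun x => mollify rho n u x - u x)%R < +oo)%E.
    by apply: le_lt_trans mE _; rewrite lte_mul_pinfty//; [rewrite lee_fin; apply: mulr_ge0; [exact: ler0n|exact: sqr_ge0]|exact: ge_lty].
  have mEn := energyB_lty mm mu_ uE dE; split => // h mh h0 hN.
  have md : measurable_on setT (fun x => mollify rho n u x - u x) by exact: measurable_funB.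
  have iu := (energy_weight cK N2 (mgl mu_) (energy_glue_lty mu_ uE) mh h0 hN).1.
  have im := (energy_weight cK N2 (mgl mm) (energy_glue_lty mm mEn) mh h0 hN).1.
  have [id key] := energy_weight cK N2 (mgl md) (energy_glue_lty md dE) mh h0 hN.
  have -> : F u h - F (mollify rho n u) h = - F (fun x => mollify rho n u x - u x) h.
    rewrite /F -opprB; congr (- _); rewrite -fineB ?(integrable_fin_num measurableT iu) ?(integrable_fin_num measurableT im)//.
    rewrite -(integralB measurableT im iu); congr fine; apply: eq_integral => x _.
    by rewrite -EFinB mulrBl.
  rewrite normrN; apply: le_trans (key rho rho0) _; rewrite -mulrA; apply: ler_wpM2l => //.
  rewrite mulrDl mulrC lerD2l mulrC ler_pdivrMr//.
  have := le_trans (energy_glue md) (lee_wpmul2l (ler0n R 65 : (0 <= 65%:E :> \bar R)%E) mE).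
  rewrite -(fineK fE) -/E -!EFinM.
  have fg : energy (fun x => mollify rho n u (glue D G x) - u (glue D G x)) \is a fin_num.
    by rewrite ge0_fin_numE ?energy_ge0//; exact: (energy_glue_lty md dE).
  rewrite -(fineK fg) lee_fin => /le_trans; apply.
  by rewrite le_eqVlt; apply/orP; left; apply/eqP; ring.
have [C C0 aC] := approx _ _ mf Ef wf Ef1.
have a1 k := approx _ _ (mf1 k) (Ef1 k) (wf1 k) (Ef2 k).
have [C1 C10 aC1] := a1 ord0; have [C2 C20 aC2] := a1 (inord 1); have [C3 C30 aC3] := a1 ord_max.
have main (rho : R) : 0 < rho -> `|S| <= (C + C1 + C2 + C3) * rho.
  move=> rho0; have [n mass] := bump3_mass rho0.
  have [mF FE dF] := aC rho n rho0 mass.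
  have [mF1 FE1 dF1] := aC1 rho n rho0 mass; have [mF2 FE2 dF2] := aC2 rho n rho0 mass.
  have [mF3 FE3 dF3] := aC3 rho n rho0 mass.
  pose m := mollify rho n.
  have mFk k : measurable_on setT (m (f1 k)).
    by elim/ord3_ind: k; [exact: mF1|exact: mF2|exact: mF3].
  have FEk k : (energy (m (f1 k)) < +oo)%E.
    by elim/ord3_ind: k; [exact: FE1|exact: FE2|exact: FE3].
  have il u : (exists k d, weak_partial setT k u d) -> loc_integrable setT u by case=> ? [? []].
  have [Ma Ma0 ha] := mollify_bound rho0 mass L0 (il f (ex_intro _ ord0 (ex_intro _ _ (wf ord0)))).
  have [Mt Mt0 ht] := mollify_taylor rho0 mass L0 wf.
  have hb k : exists2 M, 0 <= M & forall y y', `|y| <= L0 -> `|y'| <= L0 ->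
      `|m (f1 k) y| <= M /\ `|m (f1 k) y' - m (f1 k) y| <= M * `|y' - y|.
    exact: (mollify_bound rho0 mass L0 (il (f1 k) (ex_intro _ ord0 (ex_intro _ _ (wf1 k ord0))))).
  have [Mb Mb0 hMb] := hb ord0; have [Mc Mc0 hMc] := hb (inord 1); have [Md Md0 hMd] := hb ord_max.
  pose M := Ma + Mt + Mb + Mc + Md.
  have M0 : 0 <= M by do 4!apply: addr_ge0 => //.
  have [la lt lb lc ld] : [/\ Ma <= M, Mt <= M, Mb <= M, Mc <= M & Md <= M].
    exact: sum5_ge.
  have Freg y y' : `|y| <= L0 -> `|y'| <= L0 -> [/\ `|m f y| <= M, `|m f y' - m f y| <= M * `|y' - y| &
      `|m f y' - m f y - \sum_(k < 3) m (f1 k) y * coord k (y' - y)| <= M * `|y' - y| ^+ 2].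
    move=> yL y'L; have [h1 h2] := ha y y' yL y'L; split; first exact: le_trans la.
      by apply: le_trans h2 _; exact: ler_wpM2r.
    by apply: le_trans (ht y y' yL y'L) _; apply: ler_wpM2r => //; exact: sqr_ge0.
  have freg k y y' : `|y| <= L0 -> `|y'| <= L0 ->
      `|m (f1 k) y| <= M /\ `|m (f1 k) y' - m (f1 k) y| <= M * `|y' - y|.
    move=> yL y'L; elim/ord3_ind: k; [have [h1 h2] := hMb y y' yL y'L|have [h1 h2] := hMc y y' yL y'L|
      have [h1 h2] := hMd y y' yL y'L]; (split; [by apply: (le_trans h1)|by apply: (le_trans h2); exact: ler_wpM2r]).
  have := chain_rule_regular oD cG wG ge mg e_small GL M0 mF mFk Freg freg i tphi.
  have [-> ->] := split_integral mF mFk FE FEk cK KD N0 out phiN p1N mphi mp1.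
  rewrite -EFinN => -[E0].
  have k0 : `|F f (pderiv [:: i] phi) - F (m f) (pderiv [:: i] phi)| <= C * rho.
    by apply: dF => // x; apply: (le_trans (p1N x)); rewrite ler_peMr// ler1n.
  have k1 := dF1 _ (mgp ord0) (gp0 ord0) (gpN ord0).
  have k2 := dF2 _ (mgp (inord 1)) (gp0 (inord 1)) (gpN (inord 1)).
  have k3 := dF3 _ (mgp ord_max) (gp0 ord_max) (gpN ord_max).
  exact: (sum4_close E0 k0 k1 k2 k3).
apply/ler_addgt0Pr => eps eps0; rewrite add0r.
have Cp : 0 < C + C1 + C2 + C3 + 1 by rewrite ltr_wpDl// !addr_ge0.
apply: le_trans (main (eps / (C + C1 + C2 + C3 + 1)) _) _; first by rewrite divr_gt0.
by rewrite mulrCA ler_piMr ?(ltW eps0)// ler_pdivrMr// mul1r lerDl.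
Qed.

End chain_rule.

(** * Null sets of the mesh and of the boundary *)

Section null_sets.
Context {R : realType}.
Implicit Types (x y z v n c : R3 R) (i j k : 'I_3) (A B D : set (R3 R)) (s t r : R).
Local Notation mu := (@leb3 R).

Lemma dot3 x y : dot x y = coord ord0 x * coord ord0 y +
  coord (inord 1) x * coord (inord 1) y + coord ord_max x * coord ord_max y.
Proof. by rewrite /dot sum_ord3. Qed.

Lemma dot_shift n x i t : dot n (x + t *: basis3 i) = dot n x + t * coord i n.
Proof.
rewrite !dot3 !coord_shift; elim/ord3_ind: i;
  rewrite ?eqxx ?inord1_eq0 ?inord1_eq2 ?(eq_sym _ (inord 1)) ?inord1_eq0 ?inord1_eq2 /=
    ?(mulr1n, mulr0n); ring.
Qed.

Lemma neq0_coord n : n != 0 -> exists i, coord i n != 0.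
Proof.
move=> n0; apply: contrapT => h; move/eqP: n0; apply; apply: coord_inj => i.
rewrite (raddf0 (coord i)); apply/eqP/negPn/negP => ni; apply: h; by exists i.
Qed.

(** Along an axis on which the normal has a nonzero coordinate, a nonzero translation leaves the
    plane; [disjoint_translates_null] applies. *)
Lemma plane_negligible A : is_plane A -> mu.-negligible A.
Proof.
move=> [c [n [n0 ->]]]; have [i ni] := neq0_coord n0.
have mA : measurable ([set x | dot n (x - c) = 0] : set (mR3 R)).
  have mf : measurable_on setT (fun x => dot n (x - c)).
    rewrite (_ : (fun x => _) = fun x => coord ord0 n * coord ord0 (x - c) +
      coord (inord 1) n * coord (inord 1) (x - c) + coord ord_max n * coord ord_max (x - c)); last first.
      by apply/funext => x; rewrite dot3.
    have m j : measurable_on setT (fun x => coord j n * coord j (x - c)).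
      exact: (measurable_funM (measurable_cst _) (measurable_comp_shift (- c) (measurable_coord j))).
    exact: (measurable_funD (measurable_funD (m _) (m _)) (m _)).
  have := mf measurableT [set 0] (measurable_set1 0); rewrite setTI.
  by congr measurable; apply/seteqP; split.
exists [set x | dot n (x - c) = 0]; split => //.
apply: (disjoint_translates_null (v := basis3 i) mA) => x t /= x0 t0.
rewrite addrAC dot_shift x0 add0r => /eqP; rewrite mulf_eq0 (negbTE t0) /=; exact/negP.
Qed.

Lemma closed_frontier A : closed (Defs.frontier A).
Proof.
rewrite /Defs.frontier setDE; apply: closedI; first exact: closed_closure.
by apply: open_closedC; exact: open_interior.
Qed.

(** Near a boundary point some partial derivative of the defining function does not vanish. Two
    boundary points on a line in that direction would contradict this by Rolle's theorem, so the
    translates of a small piece are disjoint. *)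
Lemma frontier_negligible Om : smooth_boundary Om -> mu.-negligible (Defs.frontier Om).
Proof.
move=> sOm; apply: negligible_locally => a /[dup] Fa /sOm[V [rho [oV Va sm def]]].
have [g0 _ _] := def a Va; have [i] := neq0_coord g0.
rewrite coord_vec3 => di.
have cd : {for a, continuous (pderiv [:: i] rho)}.
  by apply: differentiable_continuous; exact: (sm [:: i]).
have nz : nbhs a [set x | pderiv [:: i] rho x != 0].
  exact: (cd [set z : R | z != 0] (open_nbhs_nbhs (conj (@open_neq R 0) di))).
have nV : nbhs a V by exact: open_nbhs_nbhs.
have /nbhs_ballP[r /= r0 rU] : nbhs a (V `&` [set x | pderiv [:: i] rho x != 0]) by exact: filterI.
exists (ball a r); first exact: nbhsx_ballx.
have mA : measurable (Defs.frontier Om `&` ball a r : set (mR3 R)).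
  by apply: measurableI; [apply: closed_measurable3; exact: closed_frontier|exact: measurable_ball3].
exists (Defs.frontier Om `&` ball a r); split => //.
have pos x t : 0 < t -> (Defs.frontier Om `&` ball a r) x ->
    ~ (Defs.frontier Om `&` ball a r) (x + t *: basis3 i).
  move=> t0 [Fx xr] [Fy yr].
  have rx : rho x = 0 by have [Vx _] := rU _ xr; have [_ _ [/(_ Fx)]] := def _ Vx.
  have ry : rho (x + t *: basis3 i) = 0 by have [Vx _] := rU _ yr; have [_ _ [/(_ Fy)]] := def _ Vx.
  have inb s : 0 <= s <= t -> ball a r (x + s *: basis3 i).
    move=> /andP[s0 st]; move: xr yr; rewrite -!ball_normE /= => xr yr.
    apply: norm3_lt => j; have := le_lt_trans (normr_coord j _) xr; have := le_lt_trans (normr_coord j _) yr.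
    rewrite !coordB !coord_shift !ltr_norml => /andP[? ?] /andP[? ?].
    have h1 : 0 <= s *+ (j == i) by rewrite mulrn_wge0.
    have h2 : s *+ (j == i) <= t *+ (j == i) by exact: ler_wMn2r.
    by apply/andP; split; lra.
  have dl s : 0 <= s <= t -> is_derive s (1 : R) (fun s => rho (x + s *: basis3 i)) (pderiv [:: i] rho (x + s *: basis3 i)).
    by move=> /inb/rU[Vs _]; apply: is_derive_line; exact: (sm [::]).
  have [|||c' ct [_ dc]] := @Rolle R (fun s => rho (x + s *: basis3 i)) 0 t t0.
  - by move=> s; rewrite in_itv /= => /andP[s0 st]; have [] := dl s; rewrite ?ltW.
  - apply: continuous_in_subspaceT => s; rewrite inE /= in_itv /= => st.
    by apply: differentiable_continuous; apply/derivable1_diffP; have [] := dl s st.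
  - by rewrite scale0r addr0 rx ry.
  have ct' : 0 <= c' <= t by move: ct; rewrite in_itv /= => /andP[/ltW -> /ltW ->].
  have [_ /= /eqP nz'] := rU _ (inb c' ct'); have [_ e1] := dl c' ct'.
  by apply: nz'; exact: etrans (esym e1) dc.
apply: (disjoint_translates_null (v := basis3 i) mA) => x t Ax; case: (ltgtP t 0) => // [t0|t0] _ Ay.
  have nt : 0 < - t by rewrite oppr_gt0.
  by apply: (pos _ _ nt Ay); rewrite scaleNr addrK.
exact: (pos _ _ t0 Ax).
Qed.

(** The index type is arbitrary, so the union is numbered by an injection of [S] into the natural
    numbers. *)
Lemma negligible_finite_bigcup (T : Type) (S : set T) (F : T -> set (R3 R)) : finite_set S ->
  (forall w : T, S w -> mu.-negligible (F w)) -> mu.-negligible (\bigcup_(w in S) F w).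
Proof.
move=> /finite_set_countable/countable_injP[f fi] H.
have : mu.-negligible (\bigcup_m \bigcup_(w in [set w | S w /\ f w = m]) F w).
  apply: negligible_bigcup => m.
  have [[w [Sw fw]]|nw] := pselect (exists w, S w /\ f w = m); last first.
    by apply: negligibleS (negligible_set0 mu) => z [w wm _]; case: nw; exists w.
  apply: negligibleS (H w Sw) => z [w' [Sw' fw']].
  by rewrite (fi w w') ?inE// fw fw'.
by apply: negligibleS => z [w Sw Fz]; exists (f w) => //; exists w.
Qed.

Lemma compact_finite_bigcup (T : Type) (S : set T) (F : T -> set (R3 R)) : finite_set S ->
  (forall w : T, S w -> compact (F w)) -> compact (\bigcup_(w in S) F w).
Proof.
move=> fS H; pose T' := {classic T}.
rewrite -(@bigsetU_fset_set (R3 R) T' S F fS) big_seq_cond; apply: bigsetU_compact => w.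
by rewrite andbT in_fset_set// inE; exact: H.
Qed.

Section mesh.
Variables (Om : set (R3 R)) (gamma1 gamma2 h : R) (M : set (polyhedron R)).
Hypothesis mesh : bulk_surface_mesh Om gamma1 gamma2 h M.

Lemma compact_bulk : compact (bulk M).
Proof. by apply: compact_finite_bigcup (mesh_finite mesh) _ => E /(mesh_valid mesh)[]. Qed.

Lemma compact_exterior_bulk : compact (exterior_bulk M).
Proof.
apply: compact_finite_bigcup; last by move=> E [/(mesh_valid mesh)[]].
by apply: sub_finite_set (mesh_finite mesh) => E [].
Qed.

Lemma mesh_surface_negligible : mu.-negligible (mesh_surface M).
Proof.
rewrite (mesh_boundary mesh); apply: negligible_finite_bigcup.
  apply: (@sub_finite_set _ _ (mesh_faces M)); first by move=> F [].
  by apply: (@bigcup_finite (polyhedron R)); [exact: mesh_finite mesh|move=> E /(mesh_valid mesh)[]].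
move=> F [MF _]; have [P [pP FP _]] := mesh_star_face mesh MF.
by apply: negligibleS (plane_negligible pP).
Qed.

Lemma bulkE : bulk M = interior (bulk M) `|` mesh_surface M.
Proof.
apply/seteqP; split => x.
  have [xi|nxi] := pselect (interior (bulk M) x); first by left.
  by right; split => //; exact: subset_closure.
case => [/interior_subset//|[]].
by rewrite -(proj1 (closure_id _)) //; exact: compact_closed (@norm_hausdorff _ _) compact_bulk.
Qed.

End mesh.
End null_sets.

Section extended_squares.
Context {R : realType}.
Local Open Scope ereal_scope.

Lemma expe2E (x : \bar R) : x ^+ 2 = x * x. Proof. by []. Qed.

Lemma sqre_half (x : \bar R) : 0 <= x -> (x `^ 2^-1) ^+ 2 = x.
Proof.
rewrite expe2E; case: x => [r| |] // r0; last by rewrite poweRyr ?invr_eq0// mulyy.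
by rewrite poweR_EFin -EFinM powR12_sqrt// -expr2 sqr_sqrtr.
Qed.

Lemma lee_sqre (x y : \bar R) : 0 <= x -> 0 <= y -> x ^+ 2 <= y ^+ 2 -> x <= y.
Proof.
rewrite !expe2E; case: x y => [r| |] [s| |] // r0 s0; rewrite ?leey//.
by rewrite -!EFinM !lee_fin -!expr2 ler_sqr ?nnegrE.
Qed.

End extended_squares.

(** * The lifted error *)

Section weak_derivatives.
Context {R : realType}.
Implicit Types (x y p q : R3 R) (i j k : 'I_3) (D : set (R3 R)) (u g phi : R3 R -> R).
Local Notation mu := (@leb3 R).

Lemma L2norm_ge0 D u : (0 <= L2norm D u)%E.
Proof. by rewrite /L2norm unlock; exact: poweR_ge0. Qed.

Lemma L2norm_sqr D u : (L2norm D u ^+ 2 = \int[mu]_(x in D) (u x ^+ 2)%:E)%E.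
Proof.
have n2 : (2 : R) != 0 by [].
rewrite /L2norm unlock sqre_half; last by apply: integral_ge0 => x _; exact: poweR_ge0.
rewrite [RHS]integral_mkcond; apply: eq_integral => x _; rewrite !patchE; case: ifPn => _ /=.
  by rewrite powR_mulrn// real_normK// num_real.
by rewrite normr0 powR0.
Qed.

Lemma L2norm_setT u : (L2norm setT u ^+ 2 = energy u)%E.
Proof. exact: L2norm_sqr. Qed.

Lemma wderivP D w u : (exists g, is_wderiv D w u g) -> is_wderiv D w u (wderiv D w u).
Proof. exact: xgetPex. Qed.

Lemma bump3_test_function D p q n : cbox p q `<=` D -> test_function D (bump3 p q n).
Proof.
move=> pqD; apply: (tensor_test_function _ _ pqD) => j; first exact: smooth_bump.
by move=> t h; apply: bump_out; apply: contra h; exact: subset_itv_oo_cc.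
Qed.

(** The term of order zero in [Hnorm] involves [wderiv] for the empty word, a chosen representative;
    this identifies it with the function itself. *)
Lemma is_wderiv_nil_ae D u g : open D -> is_wderiv D [::] u g ->
  mu.-negligible [set x | D x /\ u x <> g x].
Proof.
move=> oD [iu ig w]; have mD : measurable (D : set (mR3 R)) by exact: open_measurable3.
have : mu.-negligible [set x | D x /\ u x - g x <> 0].
  apply: (fundamental_lemma oD) => [K cK KD|p q pqD n].
    exact: (integrableB (compact_measurable3 cK) (iu K cK KD) (ig K cK KD)).
  have i1 := integrable_bump3 n mD iu pqD; have i2 := integrable_bump3 n mD ig pqD.
  transitivity (\int[mu]_(x in D) ((u x * bump3 p q n x)%:E - (g x * bump3 p q n x)%:E))%E.
    by apply: eq_integral => x _; rewrite -EFinB mulrBl.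
  rewrite (integralB mD i1 i2); have := w _ (bump3_test_function n pqD).
  rewrite /= expr0 mul1e => ->; rewrite subee//; exact: (integrable_fin_num mD i2).
by apply: negligibleS => x [Dx ne]; split => // /eqP; rewrite subr_eq0 => /eqP.
Qed.

Lemma loc_integrable_ae D u v : measurable (D : set (mR3 R)) -> loc_integrable D u ->
  measurable_on D v -> mu.-negligible [set x | D x /\ u x <> v x] -> loc_integrable D v.
Proof.
move=> mD iu mv N K cK KD; have mK := compact_measurable3 cK.
have mKv : measurable_fun (K : set (mR3 R)) (EFin \o v).
  by apply/measurable_EFinP; exact: (measurable_funS mD KD mv).
have /integrableP[mKu uK] := iu K cK KD.
apply/integrableP; split => //; apply: le_lt_trans uK; rewrite le_eqVlt; apply/orP; left; apply/eqP.
apply: (@ae_eq_integral _ _ _ mu _ _ _ mK).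
- by apply: measurableT_comp.
- by apply: measurableT_comp.
apply: negligibleS N => x; apply: contra_notP => /not_andP[nD|/contrapT E] Kx; last by rewrite /= E.
by case: nD; exact: KD.
Qed.

Lemma weak_partial_ae D i u g g' : open D -> weak_partial D i u g -> measurable_on D g' ->
  mu.-negligible [set x | D x /\ g x <> g' x] -> weak_partial D i u g'.
Proof.
move=> oD [iu ig w] mg' N; have mD : measurable (D : set (mR3 R)) by exact: open_measurable3.
have mg := loc_integrable_measurable oD ig.
split => // [|a p q sa a0 pqD]; first exact: (loc_integrable_ae mD ig mg' N).
rewrite (w a p q sa a0 pqD); congr (- _)%E.
have mt : measurable_on D (tensor a).
  by apply: measurable_funTS; apply: continuous_measurable3; exact: continuous_tensor.
apply: (@ae_eq_integral _ _ _ mu _ _ _ mD).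
- by apply/measurable_EFinP; exact: measurable_funM.
- by apply/measurable_EFinP; exact: measurable_funM.
by apply: negligibleS N => x; apply: contra_notP => /not_andP[nD|/contrapT E] Dx; [|rewrite E].
Qed.

Lemma enum_ord3 : enum 'I_3 = [:: ord0; inord 1; ord_max].
Proof.
by apply: (inj_map val_inj); rewrite val_enum_ord /= inordK.
Qed.

Lemma wordE (k : nat) (al : multi_index k) : word al = nseq (al ord0) ord0 ++
  nseq (al (inord 1)) (inord 1) ++ nseq (al ord_max) ord_max.
Proof. by rewrite /word enum_ord3 /= cats0. Qed.

Lemma orderE (k : nat) (al : multi_index k) :
  Defs.order al = (al ord0 + al (inord 1) + al ord_max)%N.
Proof.
rewrite /Defs.order !big_ord_recl big_ord0 addn0 addnA; congr (al _ + al _ + al _)%N;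
  by apply/val_inj; rewrite //= inordK.
Qed.

Definition index3 (k : nat) (a b c : nat) : multi_index k := [ffun i : 'I_3 =>
  inord (if i == ord0 then a else if i == ord_max then c else b)].

Lemma index3E (k : nat) a b c : (a <= k)%N -> (b <= k)%N -> (c <= k)%N ->
  word (index3 k a b c) = nseq a ord0 ++ nseq b (inord 1) ++ nseq c ord_max /\
  Defs.order (index3 k a b c) = (a + b + c)%N.
Proof.
move=> ak bk ck; rewrite wordE orderE !ffunE !eqxx inord1_eq0 inord1_eq2 /=.
by rewrite !inordK ?ltnS.
Qed.

Lemma word1 (k : nat) i : (0 < k)%N -> exists2 al : multi_index k, Defs.order al = 1%N & word al = [:: i].
Proof.
move=> k0; have z := leq0n k; elim/ord3_ind: i.
- by exists (index3 k 1 0 0); have [h1 h2] := @index3E k 1 0 0 k0 z z; rewrite ?h1 ?h2.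
- by exists (index3 k 0 1 0); have [h1 h2] := @index3E k 0 1 0 z k0 z; rewrite ?h1 ?h2.
by exists (index3 k 0 0 1); have [h1 h2] := @index3E k 0 0 1 z z k0; rewrite ?h1 ?h2.
Qed.

Lemma word0 (k : nat) : exists2 al : multi_index k, Defs.order al = 0%N & word al = [::].
Proof.
by have z := leq0n k; exists (index3 k 0 0 0); have [h1 h2] := @index3E k 0 0 0 z z z; rewrite ?h1 ?h2.
Qed.

(** [word] lists the directions in increasing order, whence the disjunction, which
    [is_wderiv2_weak_partial] accepts. *)
Lemma word2 i j : exists2 al : multi_index 2, Defs.order al = 2%N &
  word al = [:: i; j] \/ word al = [:: j; i].
Proof.
have z : (0 <= 2)%N by []. have o : (1 <= 2)%N by []. have t : (2 <= 2)%N by [].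
have [a1 b1] := @index3E 2 2 0 0 t z z; have [a2 b2] := @index3E 2 0 2 0 z t z.
have [a3 b3] := @index3E 2 0 0 2 z z t; have [a4 b4] := @index3E 2 1 1 0 o o z.
have [a5 b5] := @index3E 2 1 0 1 o z o; have [a6 b6] := @index3E 2 0 1 1 z o o.
elim/ord3_ind: i; elim/ord3_ind: j.
- by exists (index3 2 2 0 0); rewrite ?b1//; left; rewrite a1.
- by exists (index3 2 1 1 0); rewrite ?b4//; left; rewrite a4.
- by exists (index3 2 1 0 1); rewrite ?b5//; left; rewrite a5.
- by exists (index3 2 1 1 0); rewrite ?b4//; right; rewrite a4.
- by exists (index3 2 0 2 0); rewrite ?b2//; left; rewrite a2.
- by exists (index3 2 0 1 1); rewrite ?b6//; left; rewrite a6.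
- by exists (index3 2 1 0 1); rewrite ?b5//; right; rewrite a5.
- by exists (index3 2 0 1 1); rewrite ?b6//; right; rewrite a6.
by exists (index3 2 0 0 2); rewrite ?b3//; left; rewrite a3.
Qed.

Lemma slobodeckij_sq_ge0 D (sigma : R) u : (0 <= slobodeckij_sq D sigma u)%E.
Proof.
apply: integral_ge0 => x _; apply: integral_ge0 => y _.
by rewrite lee_fin divr_ge0 ?sqr_ge0 ?powR_ge0.
Qed.

Lemma Hnorm_ge0 D (s : R) u : (0 <= Hnorm D s u)%E.
Proof. exact: poweR_ge0. Qed.

Lemma wderiv_le_Hnorm D (s : R) u (al : multi_index (Num.truncn s)) :
  (Defs.order al <= Num.truncn s)%N ->
  (L2norm D (wderiv D (word al) u) ^+ 2 <= Hnorm D s u ^+ 2)%E.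
Proof.
move=> al_le; pose S : \bar R := (\sum_(al : multi_index (Num.truncn s) | (Defs.order al <= Num.truncn s)%N)
  L2norm D (wderiv D (word al) u) ^+ 2)%E.
pose T : \bar R := (if (s - (Num.truncn s)%:R == 0)%R then 0 else \sum_(al : multi_index (Num.truncn s) | Defs.order al == Num.truncn s)
  slobodeckij_sq D (s - (Num.truncn s)%:R)%R (wderiv D (word al) u))%E.
have S0 b : (0 <= L2norm D (wderiv D (word b) u) ^+ 2)%E by rewrite expe2E mule_ge0 ?L2norm_ge0.
have T0 : (0 <= T)%E.
  by rewrite /T; case: ifP => // _; apply: sume_ge0 => b _; exact: slobodeckij_sq_ge0.
have -> : (Hnorm D s u ^+ 2 = S + T)%E.
  by rewrite /Hnorm sqre_half// adde_ge0// sume_ge0.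
rewrite /S (bigD1 al)//= -addeA leeDl// adde_ge0// sume_ge0// => b _; exact: S0.
Qed.

End weak_derivatives.

Section identity.
Context {R : realType}.
Implicit Types (x y p q : R3 R) (i j k : 'I_3) (D : set (R3 R)) (u phi : R3 R -> R) (s t r : R).
Local Notation mu := (@leb3 R).
Local Notation lam := (@lebesgue_measure R).

(** Needed where [G] is the identity. The product of the coordinate and the test function has line
    integrals of its derivative equal to its increments, so [integral_eq0_line] applies with
    constant 0 and the empty set. *)
Lemma coord_weak_partial D i j : open D ->
  weak_partial D j (coord i : R3 R -> R) (cst (i == j)%:R).
Proof.
move=> oD; set d : R := (i == j)%:R.
have ic (u : R3 R -> R) K : compact K -> continuous u -> mu.-integrable K (EFin \o u).
  move=> cK cu; have /compact_bounded[N [_ hN]] : compact (u @` K).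
    by apply: continuous_compact => //; exact: continuous_subspaceT.
  apply: (@integrable_bounded _ _ R mu K (u : mR3 R -> R) (`|N| + 1)).
  - exact: compact_measurable3.
  - exact: compact_leb3_lty.
  - by apply: measurable_funTS; exact: continuous_measurable3.
  by move=> x Kx; apply: (hN (`|N| + 1)); [rewrite (le_lt_trans (ler_norm N))// ltrDl|exists x].
split; [by move=> K cK _; apply: ic => //; exact: continuous_coord|by move=> K cK _; apply: ic => //; exact: cst_continuous|].
move=> a p q sa a0 pqD; set phi := tensor a; pose p1 := tensor (derive_tensor j a).
have mD : measurable (D : set (mR3 R)) by exact: open_measurable3.
have cphi : continuous phi by exact: continuous_tensor.
have cp1 : continuous p1 by apply: continuous_tensor => k; exact: smooth_derive_tensor.
have z0 x : ~ cbox p q x -> phi x = 0.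
  move=> /cboxE/existsNP[k nk]; have h : a k (coord k x) = 0 by apply: a0; rewrite in_itv /=; exact/negP.
  by rewrite /phi /tensor; elim/ord3_ind: k h {nk} => ->; rewrite !(mulr0, mul0r).
have z1 x : ~ cbox p q x -> p1 x = 0.
  move=> /cboxE/existsNP[k nk]; have h : derive_tensor j a k (coord k x) = 0.
    by rewrite /derive_tensor; case: ifP => _; [apply: (derive1_out (a0 k))|apply: a0]; rewrite in_itv /=; exact/negP.
  by rewrite /p1 /tensor; elim/ord3_ind: k h {nk} => ->; rewrite !(mulr0, mul0r).
pose P x := coord i x * phi x; pose Q x := d * phi x + coord i x * p1 x.
have cP : continuous P.
  by move=> x; apply: continuousM; [exact: continuous_coord|exact: cphi].
have c1 : continuous (fun x => d * phi x).
  by move=> x; apply: (@continuousM _ _ (cst d : R3 R -> R) phi); [exact: cst_continuous|exact: cphi].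
have c2 : continuous (fun x => coord i x * p1 x).
  by move=> x; apply: continuousM; [exact: continuous_coord|exact: cp1].
have cQ : continuous Q.
  by move=> x; apply: (@continuousD _ _ _ (fun x => d * phi x) (fun x => coord i x * p1 x)); [exact: c1|exact: c2].
have int u : continuous u -> (forall x, ~ cbox p q x -> u x = 0) -> mu.-integrable setT (EFin \o u).
  move=> cu u0; have [M M0 hM] := continuous_compact_bounded cu (@compact_cbox R p q) u0.
  exact: (integrable_compact_support (continuous_measurable3 cu) (@compact_cbox R p q) u0 hM).
have i1 : mu.-integrable setT (EFin \o (fun x => d * phi x)) by apply: int => // x /z0 ->; rewrite mulr0.
have i2 : mu.-integrable setT (EFin \o (fun x => coord i x * p1 x)) by apply: int => // x /z1 ->; rewrite mulr0.
have iP : mu.-integrable setT (EFin \o P) by apply: int => // x /z0 h; rewrite /P h mulr0.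
have iQ : mu.-integrable setT (EFin \o Q) by exact: (integrableD measurableT i1 i2).
have dP x s : is_derive s (1 : R) (fun s => P (x + s *: basis3 j)) (Q (x + s *: basis3 j)).
  have [dphi Dphi] := derive_tensorE j (x + s *: basis3 j) sa.
  have h1 := is_derive_line dphi; rewrite Dphi in h1.
  have h2 : is_derive s (1 : R) (fun s => coord i (x + s *: basis3 j)) d.
    have := is_derive_line (differentiable_coord3 i (x + s *: basis3 j)).
    have did : derivable (@id R) (coord i (x + s *: basis3 j)) 1 by exact: derivable_id.
    have [_] := @is_derive_coord_comp R id i (x + s *: basis3 j) (basis3 j) did.
    by rewrite derive1E derive_id mul1r coord_basis3 => E; congr is_derive.
  have := is_deriveM h2 h1; congr is_derive.
  by rewrite /Q /GRing.scale /= -/phi -/p1; ring.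
have ftc x t : 0 < t -> line_mean Q (basis3 j) t x = P (x + t *: basis3 j) - P x.
  move=> t0; have iLE : (\int[lam]_s line_integrand Q (basis3 j) t (x, s) = \int[lam]_(s in `[0%R, t]) (Q (x + s *: basis3 j))%:E)%E.
    rewrite [RHS]integral_mkcond; apply: eq_integral => s _.
    by rewrite /line_integrand /= patchE indicE; case: ifP; rewrite ?mulr1 ?mulr0.
  rewrite /line_mean iLE (@continuous_FTC2 R _ (fun s => P (x + s *: basis3 j)))//=.
  - by rewrite scale0r addr0.
  - apply: continuous_subspaceT => s; apply: (@continuous_comp _ _ _ (fun s : R => x + s *: basis3 j) Q); last exact: cQ.
    by apply: continuousD; [exact: cst_continuous|exact: scalel_continuous].
  - have cs s : {for s, continuous (fun s => P (x + s *: basis3 j))}.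
      by apply: differentiable_continuous; apply/derivable1_diffP; have [] := dP x s.
    split; [by move=> s _; have [] := dP x s|apply: cvg_at_right_filter; exact: cs|apply: cvg_at_left_filter; exact: cs].
  by move=> s _; rewrite derive1E; have [] := dP x s.
have qz : (\int[mu]_x (Q x)%:E = 0)%E.
  apply: (@integral_eq0_line R P Q (basis3 j) set0 0 1 iP iQ) => //; first by rewrite measure0.
  move=> t t0 _; apply: negligibleS (negligible_set0 mu) => x; apply.
  by rewrite ftc// subrr normr0 mul0r mul0r.
have toT u h : (forall x, ~ cbox p q x -> h x = 0) ->
    (\int[mu]_(x in D) (u x * h x)%:E = \int[mu]_x (u x * h x)%:E)%E.
  move=> h0; rewrite [LHS]integral_mkcond; apply: eq_integral => x _; rewrite patchE.
  by case: ifPn => // xD; rewrite h0 ?mulr0// => /pqD Dx; rewrite mem_set in xD.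
rewrite (toT _ _ z1) (toT _ _ z0) -/phi; move: qz; rewrite (integralD measurableT i1 i2).
rewrite -(fineK (integrable_fin_num measurableT i1)) -(fineK (integrable_fin_num measurableT i2)).
by rewrite -EFinD -EFinN => -[] /eqP; rewrite addrC addr_eq0 => /eqP ->.
Qed.

End identity.

Section displacement.
Context {R : realType}.
Implicit Types (x y : R3 R) (f : R3 R -> R) (r : R).
Local Notation mu := (@leb3 R).

(** [pair_oscillation] is integrated with [y' = T x]. The constant is [2 * 66 * 3 * 3 ^+ 5]: 2 from
    the pair, [66 = 1 + 65] from the oscillations at [x] and at [T x], and [3 * (3 * r) ^+ 5] from
    [integral_oscillation], divided by [r ^+ 3]. *)
Lemma energy_displacement f (g : 'I_3 -> R3 R -> R) (T : R3 R -> R3 R) (r : R) :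
  measurable_on setT f -> (forall i, measurable_on setT (g i)) ->
  (forall i, weak_partial setT i f (g i)) ->
  measurable_fun [set: mR3 R] (T : mR3 R -> mR3 R) -> 0 < r ->
  (forall u : R3 R -> \bar R, measurable_fun [set: mR3 R] u -> (forall x, 0 <= u x)%E ->
    (\int[mu]_x u (T x) <= 65%:E * \int[mu]_x u x)%E) ->
  mu.-negligible [set x | ~ (`|x - T x| <= r)] ->
  (energy (fun x => f x - f (T x))%R <= (396 * 3 ^+ 5 * r ^+ 2)%:E * gradient_energy g)%E.
Proof.
move=> mf mg w mT r0 pushT near; pose O := oscillation f (3 * r).
have r3 : 0 < r ^+ 3 by rewrite exprn_gt0.
have mO : measurable_fun [set: mR3 R] O by exact: measurable_oscillation.
have mOT : measurable_fun [set: mR3 R] (fun x => O (T x)) by exact: (measurableT_comp mO mT).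
have O0 x : (0 <= O x)%E by exact: oscillation_ge0.
have mfT : measurable_on setT (fun x => f (T x)) by exact: (measurableT_comp mf mT).
have c0 : (0 <= (2 / r ^+ 3)%:E :> \bar R)%E by rewrite lee_fin divr_ge0 ?ltW.
have mS : measurable_fun [set: mR3 R] (fun x => O x + O (T x))%E by exact: emeasurable_funD.
have S0 x : (setT x -> 0 <= O x + O (T x))%E by move=> _; exact: adde_ge0.
apply: (@le_trans _ _ (\int[mu]_x ((2 / r ^+ 3)%:E * (O x + O (T x))))%E).
  apply: ae_ge0_le_integral => //.
  - by move=> x _; rewrite lee_fin sqr_ge0.
  - by apply: measurable_sqr; exact: measurable_funB.
  - by move=> x _; exact: (mule_ge0 c0 (S0 x I)).
  - exact: measurable_funeM.
  apply: negligibleS near => x; apply: contra_not => near_x _.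
  have := pair_oscillation mf r0 near_x; rewrite -/O.
  have : (O x + O (T x) >= 0)%E by exact: S0.
  case: (O x + O (T x))%E => [s| |] // s0; last by move=> _; rewrite gt0_muley ?leey// lte_fin divr_gt0.
  by rewrite -!EFinM !lee_fin mulrC -ler_pdivlMr// mulrAC.
rewrite (ge0_integralZl mu measurableT mS S0 c0).
rewrite (ge0_integralD mu measurableT (fun x _ => O0 x) mO (fun x _ => O0 (T x)) mOT).
have h1 := integral_oscillation mf mg w (ltW (mulr_gt0 (ltr0n R 3) r0)).
have h2 := pushT O mO O0; rewrite -/O in h1.
have I0 : (0 <= \int[mu]_x O x)%E by exact: integral_ge0.
apply: (@le_trans _ _ ((2 / r ^+ 3)%:E * (66%:E * \int[mu]_x O x))%E).
  apply: lee_wpmul2l => //; rewrite (_ : 66 = 1 + 65)%R; last by ring.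
  by rewrite EFinD ge0_muleDl ?lee_fin// mul1e leeD2l.
apply: (@le_trans _ _ ((2 / r ^+ 3)%:E * (66%:E * ((3 * (3 * r) ^+ 5)%:E * gradient_energy g)))%E).
  by apply: lee_wpmul2l => //; apply: lee_wpmul2l; rewrite ?lee_fin.
rewrite !muleA -!EFinM le_eqVlt; apply/orP; left; apply/eqP; congr (_%:E * _)%E.
by field; rewrite gt_eqF.
Qed.

End displacement.

(** * Data extracted from the mesh and the lifting map *)

Lemma clamp_bound (R : realType) (d z c : R) : 0 <= c ->
  `|Num.max (d - c) (Num.min z (d + c)) - d| <= c.
Proof.
move=> c0; rewrite ler_norml.
by case: (leP z (d + c)) => h1; [case: (leP (d - c) z)|case: (leP (d - c) (d + c))] => h2; apply/andP; split; lra.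
Qed.

Lemma clamp_id (R : realType) (d z c : R) : `|z - d| <= c ->
  Num.max (d - c) (Num.min z (d + c)) = z.
Proof.
rewrite ler_norml => /andP[h1 h2]; rewrite min_l; last by lra.
by rewrite max_r//; lra.
Qed.

Section lifting.
Context {R : realType}.
Implicit Types (x y p q : R3 R) (i j k : 'I_3) (A D : set (R3 R)) (s t r : R).
Local Notation mu := (@leb3 R).

Lemma Linfnorm_ae A (u : R3 R -> R) (c : R) : (Linfnorm A u <= c%:E)%E ->
  mu.-negligible [set x | A x /\ ~ (`|u x| <= c)].
Proof.
(* The norm of infinite exponent is an essential supremum only when the whole space has positive
   measure. *)
rewrite /Linfnorm unlock; have -> : (0 < mu setT)%E.
  apply: (@lt_le_trans _ _ (mu (ball 0 1))).
    by rewrite leb3_ball// lte_fin exprn_gt0.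
  apply: le_leb3 => //; exact: measurable_ball3.
move=> /ess_supP; apply: negligibleS => x [Ax nu] h; apply: nu.
by move: h; rewrite /= patchE mem_set// -abse_EFin lee_fin.
Qed.

Lemma mx_norm_entry (N : 'M[R]_3) i j : `|N i j| <= `|N|.
Proof.
suff : `|N i j| <= mx_norm N by [].
rewrite mx_normE; exact: (@le_bigmax _ _ _ _ (fun ij : 'I_3 * 'I_3 => `|N ij.1 ij.2|%:nng) (i, j)).
Qed.

Variables (Om : set (R3 R)) (gamma1 gamma2 CG h : R) (M : set (polyhedron R)) (G : R3 R -> R3 R).
Hypothesis mesh : bulk_surface_mesh Om gamma1 gamma2 h M.
Hypothesis lift : lifting_map Om M CG h G.
Hypothesis h0 : 0 < h.

Let D := interior (bulk M).

(** On the exterior elements the bound is assumed. Off them, on an open set, [G] is the identity,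
    and uniqueness of weak derivatives gives the Kronecker symbol. The absolute value of [CG] makes
    the bound nonnegative there too. *)
Lemma weak_jacobian_bound i j :
  mu.-negligible [set x | D x /\ ~ (`|wderiv D [:: j] (coord i \o G) x - (i == j)%:R| <= `|CG| * h)].
Proof.
have oD : open D by exact: open_interior.
have w : weak_partial D j (coord i \o G) (wderiv D [:: j] (coord i \o G)).
  apply: is_wderiv_weak_partial; apply: wderivP.
  by have [_ /(_ j)[]] := lifting_W1oo lift i.
have cX : closed (exterior_bulk M).
  exact: compact_closed (@norm_hausdorff _ _) (compact_exterior_bulk mesh).
pose D' := D `\` exterior_bulk M.
have oD' : open D' by rewrite /D' setDE; apply: openI => //; exact: closed_openC.
have D'D : D' `<=` D by move=> x [].
have GI x : D' x -> G x = x.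
  by move=> [/interior_subset Dx nX]; apply: (lifting_id lift); split.
have mD := open_measurable3 oD; have mD' := open_measurable3 oD'.
have sub (u v : R3 R -> R) : loc_integrable D u -> (forall x, D' x -> u x = v x) -> loc_integrable D' v.
  move=> iu uv K cK KD'; apply: eq_integrable (iu K cK (subset_trans KD' D'D)).
    exact: compact_measurable3.
  by move=> x /set_mem/KD'/uv /= ->.
have w' : weak_partial D' j (coord i) (wderiv D [:: j] (coord i \o G)).
  have [iG ig wG] := w; split.
  - by apply: sub iG _ => x /GI /= ->.
  - by apply: sub ig _ => x.
  move=> a p q sa a0 pqD'; have := wG a p q sa a0 (subset_trans pqD' D'D).
  have z0 k (b : 'I_3 -> R -> R) x : (forall s, s \notin `[coord k p, coord k q] -> b k s = 0) ->
      ~ coord k p <= coord k x <= coord k q -> tensor b x = 0.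
    move=> b0 nk; have hk : b k (coord k x) = 0 by apply: b0; rewrite in_itv /=; exact/negP.
    by rewrite /tensor; elim/ord3_ind: k hk {b0 nk} => ->; rewrite !(mulr0, mul0r).
  have z1 x : ~ cbox p q x -> tensor a x = 0.
    by move=> /cboxE/existsNP[k nk]; exact: (z0 k a x (a0 k) nk).
  have z2 x : ~ cbox p q x -> tensor (derive_tensor j a) x = 0.
    move=> /cboxE/existsNP[k nk]; apply: (z0 k _ x _ nk) => s sk.
    by rewrite /derive_tensor; case: ifP => _; [apply: (derive1_out (a0 k))|apply: a0].
  have res (u v b : R3 R -> R) : (forall x, ~ cbox p q x -> b x = 0) -> (forall x, D' x -> u x = v x) ->
      (\int[mu]_(x in D) (u x * b x)%:E = \int[mu]_(x in D') (v x * b x)%:E)%E.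
    move=> b0 uv; rewrite [LHS]integral_mkcond [RHS]integral_mkcond; apply: eq_integral => x _.
    rewrite !patchE; have [xb|nb] := pselect (cbox p q x).
      by rewrite (mem_set (pqD' _ xb)) (mem_set (D'D _ (pqD' _ xb))) uv//; exact: pqD'.
    by rewrite b0// !mulr0; case: ifP; case: ifP.
  rewrite (res _ (coord i) _ z2); last by move=> x /GI /= ->.
  by rewrite (res _ (wderiv D [:: j] (coord i \o G)) _ z1).
have N1 := weak_partial_unique oD' w' (coord_weak_partial i j oD').
have N2 := Linfnorm_ae (lifting_jacobian lift).
have := negligibleU N1 N2; apply: negligibleS => x [Dx nle].
have ch : CG * h <= `|CG| * h by rewrite ler_pM2r// ler_norm.
have [Xx|nX] := pselect (exterior_bulk M x).
  right; split => // le; apply: nle; apply: le_trans ch; apply: le_trans le.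
  have := mx_norm_entry (weak_jacobian D G x - 1%:M) i j.
  by rewrite !mxE => /le_trans; apply; exact: ler_norm.
left; split; first by split.
by move=> E; apply: nle; rewrite E subrr normr0 mulr_ge0// ltW.
Qed.

Lemma lifting_setup : exists (H : R3 R -> R3 R) (g : 'I_3 -> 'I_3 -> R3 R -> R),
  [/\ compact (closure Om), (forall x, D x -> closure Om (G x) /\ H (G x) = x),
      {within closure Om, continuous H}, forall x, D x -> {for x, continuous G} &
      [/\ forall i j, weak_partial D j (coord i \o G) (g i j),
       forall i j z, `|g i j z - (i == j)%:R| <= `|CG| * h &
       forall i j, measurable_on setT (g i j)]].
Proof.
have oD : open D by exact: open_interior.
have [H [cG cH GH HG]] := lifting_homeo lift.
pose ga i j := wderiv D [:: j] (coord i \o G).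
have wga i j : weak_partial D j (coord i \o G) (ga i j).
  apply: is_wderiv_weak_partial; apply: wderivP.
  by have [_ /(_ j)[]] := lifting_W1oo lift i.
pose gD i j := ga i j \_ D.
have mgD i j : measurable_on setT (gD i j).
  have [_ ig _] := wga i j; apply/(measurable_restrictT _ (open_measurable3 oD)).
  exact: loc_integrable_measurable ig.
have c0 : 0 <= `|CG| * h by rewrite mulr_ge0// ltW.
(* Clamping turns the almost everywhere bound on the derivatives into one that
   holds everywhere. *)
pose cl (d z : R) := Num.max (d - `|CG| * h) (Num.min z (d + `|CG| * h)).
exists H, (fun i j x => cl (i == j)%:R (gD i j x)); split.
(* [G] maps the compact bulk onto the closed domain, which is therefore compact. *)
- have -> : closure Om = G @` bulk M.
    apply/seteqP; split => [y /HG[My <-]|y [x /GH[+ _] <-]//].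
    by exists (H y).
  by apply: continuous_compact => //; exact: compact_bulk mesh.
- by move=> x /interior_subset /GH.
- exact: cH.
- move=> x Dx; have /subspace_continuousP/(_ x (interior_subset Dx)) := cG.
  by rewrite within_interior.
have cl_bound d z : `|cl d z - d| <= `|CG| * h.
  exact: clamp_bound.
have mcl i j : measurable_on setT (fun x => cl (i == j)%:R (gD i j x)).
  exact: (measurable_maxr (measurable_cst _) (measurable_minr (mgD i j) (measurable_cst _))).
split => //.
move=> i j; apply: (weak_partial_ae oD (wga i j)); first exact: (measurable_funTS (mcl i j)).
apply: negligibleS (weak_jacobian_bound i j) => x [Dx ne]; split => // le; apply: ne.
by rewrite /cl /gD patchE mem_set// clamp_id.
Qed.

End lifting.

Section estimates.
Context {R : realType}.
Implicit Types (x y p q : R3 R) (i j k : 'I_3) (A D : set (R3 R)) (u v f : R3 R -> R) (s t r : R).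
Local Notation mu := (@leb3 R).

Lemma energy_loc_integrable D u : measurable_on setT u -> (energy u < +oo)%E -> loc_integrable D u.
Proof.
move=> mu_ uE K cK _; have mK := compact_measurable3 cK.
have mi : measurable_on setT (\1_K : R3 R -> R) by exact: (@measurable_indic _ (mR3 R) R setT K mK).
have [||iK _] := energy_weight cK ler01 mu_ uE mi.
- by move=> x nK; rewrite indicE memNset.
- by move=> x; rewrite indicE; case: (_ \in _); rewrite ?normr1 ?normr0.
have iK' : mu.-integrable K (fun x => (u x * \1_K x)%:E) by exact: (integrableS measurableT mK _ iK).
by apply: eq_integrable iK' => // x xK; rewrite indicE xK mulr1.
Qed.

Lemma L2norm_le_energy A u v : measurable (A : set (mR3 R)) -> measurable_on A u ->
  measurable_on setT v -> mu.-negligible [set x | A x /\ u x <> v x] ->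
  (L2norm A u ^+ 2 <= energy v)%E.
Proof.
move=> mA mu_ mv N; rewrite L2norm_sqr [leLHS]integral_mkcond; apply: ae_ge0_le_integral => //.
- by move=> x _; rewrite patchE; case: ifP; rewrite // lee_fin sqr_ge0.
- by apply/(measurable_restrictT _ mA)/measurable_EFinP; exact: measurable_funX.
- by move=> x _; rewrite lee_fin sqr_ge0.
- exact: measurable_sqr.
apply: negligibleS N => x; apply: contra_notP => nx _; rewrite patchE; case: ifPn => [/set_mem Ax|_].
  have E : u x = v x by apply: contrapT => ne; apply: nx; split.
  by rewrite E.
by change (0%:E <= (v x ^+ 2)%:E)%E; rewrite lee_fin sqr_ge0.
Qed.

Lemma energy_bounded_mul u v c : measurable_on setT u -> measurable_on setT v ->
  (forall x, `|v x| <= c) -> (energy (fun x => v x * u x)%R <= (c ^+ 2)%:E * energy u)%E.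
Proof.
move=> mu_ mv vc; have mu2 := measurable_sqr mu_.
have c0 : (0 <= (c ^+ 2)%:E :> \bar R)%E by rewrite lee_fin sqr_ge0.
have u0 x : (setT x -> 0 <= (u x ^+ 2)%:E :> \bar R)%E by rewrite lee_fin sqr_ge0.
rewrite /energy -(ge0_integralZl mu measurableT mu2 u0 c0); apply: ge0_le_integral => //.
- by move=> x _; rewrite lee_fin sqr_ge0.
- by apply: measurable_sqr; exact: measurable_funM.
- exact: measurable_funeM.
move=> x _; rewrite -EFinM lee_fin exprMn; apply: ler_wpM2r; first exact: sqr_ge0.
rewrite -(real_normK (num_real (v x))); apply: lerXn2r; rewrite ?nnegrE ?normr_ge0//.
exact: le_trans (normr_ge0 _) (vc x).
Qed.

Lemma energyD u v : measurable_on setT u -> measurable_on setT v ->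
  (energy (fun x => u x + v x)%R <= 3%:E * (energy u + energy v))%E.
Proof.
move=> mu_ mv; have m0 : measurable_on setT (fun=> 0 : R) by exact: measurable_cst.
have := energyD3 mu_ mv m0.
have E0 : energy (fun=> 0 : R) = 0%E.
  by rewrite /energy integral0_eq// => x _; rewrite expr0n.
by rewrite E0 adde0; congr (energy _ <= _)%E; apply/funext => x; rewrite addr0.
Qed.

Lemma norm_le_enorm x : `|x| <= enorm x.
Proof.
apply: norm3_le => j; rewrite /enorm -sqrtr_sqr; apply: ler_wsqrtr; rewrite dot3 !expr2.
by elim/ord3_ind: j; rewrite ?(addrAC _ _ (coord ord_max x * _)) ?lerDl ?lerDr ?addr_ge0 -?expr2 ?sqr_ge0//;
  rewrite -?addrA ?lerDl ?addr_ge0 ?sqr_ge0// addrCA lerDl addr_ge0 ?sqr_ge0.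
Qed.

Lemma size_word n (al : multi_index n) : size (word al) = Defs.order al.
Proof. by rewrite wordE orderE !size_cat !size_nseq addnA. Qed.

(** Each derivative of order at most two is one of the terms that [Hnorm] sums, so its squared norm
    is at most that of [f]. A second derivative of [f] is a weak derivative of a first one. *)
Lemma sobolev2 s f : Num.truncn s = 2%N -> in_H setT s f ->
  exists (f1 : 'I_3 -> R3 R -> R) (f2 : 'I_3 -> 'I_3 -> R3 R -> R),
  [/\ forall k, is_wderiv setT [:: k] f (f1 k), forall k j, weak_partial setT j (f1 k) (f2 k j),
    (energy f <= Hnorm setT s f ^+ 2)%E, forall k, (energy (f1 k) <= Hnorm setT s f ^+ 2)%E &
    forall k j, (energy (f2 k j) <= Hnorm setT s f ^+ 2)%E].
Proof.
move=> s2 [ex _].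
(* The type of multi-indices depends on the integer part of [s]; the equation [e] transports
   statements about [multi_index 2] to it. *)
have W (n : nat) (e : Num.truncn s = n) (al : multi_index n) : (Defs.order al <= n)%N ->
    is_wderiv setT (word al) f (wderiv setT (word al) f) /\
    (energy (wderiv setT (word al) f) <= Hnorm setT s f ^+ 2)%E.
  case: n / e al => al al_le; split; first exact/wderivP/ex.
  by rewrite -L2norm_setT; exact: wderiv_le_Hnorm.
have [al0 o0 w0] := word0 2; have [] := W _ s2 al0; rewrite ?o0// w0 => d0 e0.
have d1 k : is_wderiv setT [:: k] f (wderiv setT [:: k] f) /\ (energy (wderiv setT [:: k] f) <= Hnorm setT s f ^+ 2)%E.
  by have [al o w] := @word1 2 k isT; have := W _ s2 al; rewrite o w; apply.
have d2 k j : exists g, weak_partial setT j (wderiv setT [:: k] f) g /\ (energy g <= Hnorm setT s f ^+ 2)%E.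
  have [al o w] := word2 j k; have [] := W _ s2 al; rewrite ?o// => dw ew.
  exists (wderiv setT (word al) f); split => //.
  by apply: (is_wderiv2_weak_partial (d1 k).1); case: w dw => ->; [left|right].
exists (fun k => wderiv setT [:: k] f), (fun k j => xget (cst 0) [set g | weak_partial setT j (wderiv setT [:: k] f) g /\ (energy g <= Hnorm setT s f ^+ 2)%E]).
split.
- by move=> k; exact: (d1 k).1.
- by move=> k j; have [] := xgetPex (cst 0) (d2 k j).
- apply: le_trans e0; rewrite -L2norm_setT; apply: L2norm_le_energy => //.
  + by have [h _ _] := d0; exact: (loc_integrable_measurable openT h).
  + by have [_ h _] := d0; exact: (loc_integrable_measurable openT h).
  exact: is_wderiv_nil_ae openT d0.
- by move=> k; exact: (d1 k).2.
- by move=> k j; have [] := xgetPex (cst 0) (d2 k j).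
Qed.

End estimates.

Section lifted_functions.
Context {R : realType}.
Implicit Types (x y p q : R3 R) (i j k : 'I_3) (A : set (R3 R)) (u v w f : R3 R -> R) (s t r : R).
Local Notation mu := (@leb3 R).
Variables (Om : set (R3 R)) (gamma1 gamma2 CG h : R) (M : set (polyhedron R)) (G : R3 R -> R3 R).
Hypotheses (oOm : open Om) (sOm : smooth_boundary Om).
Hypothesis mesh : bulk_surface_mesh Om gamma1 gamma2 h M.
Hypothesis lift : lifting_map Om M CG h G.
Hypotheses (h0 : 0 < h) (h_small : 3 * (`|CG| * h) <= 1 / 2).

Let D : set (R3 R) := interior (bulk M).
Let gl := glue D G.
(** A bound on the displacement; adding 1 keeps it positive when [CG = 0], as [energy_displacement]
    requires. *)
Let r := (`|CG| + 1) * h ^+ 2.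

Let oD : open D. Proof. exact: open_interior. Qed.
Let mD : measurable (D : set (mR3 R)). Proof. exact: open_measurable3. Qed.

Let bD : bounded_set D.
Proof.
have [n [nr hn]] := compact_bounded (compact_bulk mesh).
by exists n; split => // m nm x /interior_subset; exact: hn.
Qed.

Let r0 : 0 < r. Proof. by rewrite mulr_gt0 ?exprn_gt0// ltr_wpDl. Qed.

Lemma glue_near : mu.-negligible [set x | ~ (`|x - gl x| <= r)].
Proof.
apply: negligibleS (Linfnorm_ae (lifting_dist lift)) => x nle.
have [xD|xD] := boolP (x \in D); last first.
  by case: nle; rewrite /gl /glue (negbTE xD) subrr normr0 ltW.
have [Xx|nX] := pselect (exterior_bulk M x); last first.
  case: nle; rewrite /gl /glue xD (lifting_id lift) ?subrr ?normr0 ?ltW//.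
  by split => //; apply: interior_subset; exact/set_mem.
split => // le; apply: nle; rewrite /gl /glue xD distrC; apply: le_trans (norm_le_enorm _) _.
apply: le_trans (ler_norm _) (le_trans le _).
by rewrite ler_pM2r ?exprn_gt0// (le_trans (ler_norm _))// lerDl.
Qed.

Lemma measurable_inverse_lift u : measurable_on Om u -> measurable_on (bulk M) (inverse_lift Om G u).
Proof.
move=> mu_; have mB := compact_measurable3 (compact_bulk mesh).
have mOm := open_measurable3 oOm.
have mU : measurable_on setT (u \_ Om) by apply/(measurable_restrictT _ mOm).
apply: (@measurableT_comp _ _ _ (mR3 R) (mR3 R) R _ _ G mU).
apply/measurable_fun3P; have [H [cG _ _ _]] := lifting_homeo lift.
have mGi i : measurable_on (bulk M) (coord i \o G).
  apply: within_continuous_measurable_fun => // x.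
  by apply: (@continuous_comp (subspace (bulk M)) _ _ G (coord i) x (cG x)); exact: continuous_coord.
by split; [have := mGi ord0|have := mGi (inord 1)|have := mGi ord_max];
  apply: eq_measurable_fun => x _; rewrite /= coordE.
Qed.

Variables (H : R3 R -> R3 R) (g : 'I_3 -> 'I_3 -> R3 R -> R).
Hypotheses (cB : compact (closure Om)) (GB : forall x, D x -> closure Om (G x) /\ H (G x) = x).
Hypotheses (cH : {within closure Om, continuous H}) (cG : forall x, D x -> {for x, continuous G}).
Hypothesis wG : forall i j, weak_partial D j (coord i \o G) (g i j).
Hypothesis ge : forall i j z, `|g i j z - (i == j)%:R| <= `|CG| * h.
Hypothesis mg : forall i j, measurable_on setT (g i j).

Let mgl u : measurable_on setT u -> measurable_on setT (fun x => u (gl x)).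
Proof. by move=> mu_; exact: (measurableT_comp mu_ (measurable_glue oD cG)). Qed.

Let energy_gl u : measurable_on setT u -> (energy (fun x => u (gl x)) <= 65%:E * energy u)%E.
Proof. by move=> mu_; exact: (energy_glue oD bD cB GB cH cG wG ge h_small mu_). Qed.

(** Two exceptional sets are pulled back by [glue]: the one where [f] and [u] differ, and the
    frontier, where the zero extension of [u] takes its default value. Preimages of null sets are
    null by [negligible_glue]. *)
Lemma inverse_lift_ae u f : mu.-negligible [set x | Om x /\ f x <> u x] ->
  mu.-negligible [set x | D x /\ inverse_lift Om G u x <> f (gl x)].
Proof.
move=> N; have := negligibleU N (frontier_negligible sOm).
move/(negligible_glue oD bD cB GB cH cG wG ge h_small); apply: negligibleS => x [Dx].
have -> : gl x = G x by rewrite /gl /glue mem_set.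
rewrite /inverse_lift /= patchE => ne; rewrite /preimage /= /glue mem_set//.
have [Ox|nO] := pselect (Om (G x)).
  by left; split => // E; move: ne; rewrite mem_set// E.
right; split; first by have [] := GB Dx.
by move/interior_subset.
Qed.

Variables (f : R3 R -> R) (f1 : 'I_3 -> R3 R -> R) (f2 : 'I_3 -> 'I_3 -> R3 R -> R) (N : R).
Hypotheses (wf : forall k, is_wderiv setT [:: k] f (f1 k)).
Hypotheses (wf1 : forall k j, weak_partial setT j (f1 k) (f2 k j)).
Hypotheses (Ef : (energy f <= (N ^+ 2)%:E)%E) (Ef1 : forall k, (energy (f1 k) <= (N ^+ 2)%:E)%E).
Hypothesis Ef2 : forall k j, (energy (f2 k j) <= (N ^+ 2)%:E)%E.

Let wp k : weak_partial setT k f (f1 k). Proof. exact: is_wderiv_weak_partial. Qed.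
Let mf : measurable_on setT f.
Proof. by have [hf _ _] := wp ord0; exact: (loc_integrable_measurable openT hf). Qed.
Let mf1 k : measurable_on setT (f1 k).
Proof. by have [_ hf _] := wp k; exact: (loc_integrable_measurable openT hf). Qed.
Let mf2 k j : measurable_on setT (f2 k j).
Proof. by have [_ hf _] := wf1 k j; exact: (loc_integrable_measurable openT hf). Qed.

(** The power of 3 is one more than in [energy_displacement] because the gradient energy has three
    terms. It serves for [f] and for each of its first derivatives. *)
Lemma displacement_bound w (w1 : 'I_3 -> R3 R -> R) : measurable_on setT w ->
  (forall k, measurable_on setT (w1 k)) -> (forall k, weak_partial setT k w (w1 k)) ->
  (forall k, (energy (w1 k) <= (N ^+ 2)%:E)%E) ->
  (energy (fun x => w x - w (gl x))%R <= (396 * 3 ^+ 6 * r ^+ 2 * N ^+ 2)%:E)%E.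
Proof.
move=> mw mw1 ww w1E.
have := energy_displacement mw mw1 ww (measurable_glue oD cG) r0
  (fun u : R3 R -> \bar R => integral_glue oD bD cB GB cH cG wG ge h_small (f := u)) glue_near.
move=> /le_trans; apply; apply: (@le_trans _ _ ((396 * 3 ^+ 5 * r ^+ 2)%:E * (3 * N ^+ 2)%:E)%E).
  apply: lee_pmul; [|exact: gradient_energy_ge0|exact: lexx|].
    rewrite lee_fin; exact: (mulr_ge0 (mulr_ge0 (ler0n R 396) (exprn_ge0 5 (ler0n R 3))) (sqr_ge0 r)).
  rewrite [3](_ : _ = 1 + 1 + 1); last by ring.
  by rewrite !mulrDl mul1r !EFinD; apply: leeD; [apply: leeD|].
by rewrite -EFinM lee_fin le_eqVlt; apply/orP; left; apply/eqP; ring.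
Qed.

Let v x := f x - f (gl x).
Let mv : measurable_on setT v. Proof. exact: measurable_funB mf (mgl mf). Qed.

Lemma L2_displacement : (energy v <= (396 * 3 ^+ 6 * r ^+ 2 * N ^+ 2)%:E)%E.
Proof. exact: displacement_bound mf mf1 wp Ef1. Qed.

(** As [g k i] is the derivative of component [k] of [G] in direction [i], the sum is a component of
    the transposed Jacobian applied to the gradient of [f] at the image point. *)
Definition lifted_gradient i x := f1 i x - \sum_(k < 3) g k i x * f1 k (gl x).

Let W := lifted_gradient.

Let mS i : measurable_on setT (fun x => \sum_(k < 3) g k i x * f1 k (gl x)).
Proof.
rewrite (_ : (fun x => _) = (fun x => g ord0 i x * f1 ord0 (gl x) + g (inord 1) i x * f1 (inord 1) (gl x)
  + g ord_max i x * f1 ord_max (gl x))); last by apply/funext => x; rewrite sum_ord3.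
have m k : measurable_on setT (fun x => g k i x * f1 k (gl x)) by exact: measurable_funM (mg k i) (mgl (mf1 k)).
exact: (measurable_funD (measurable_funD (m ord0) (m (inord 1))) (m ord_max)).
Qed.

Lemma measurable_lifted_gradient i : measurable_on setT (lifted_gradient i).
Proof. exact: (measurable_funB (mf1 i) (mS i)). Qed.

Let mW := measurable_lifted_gradient.

(** The displacement error of [f1 i] is separated from the three terms with an entry of [Id - JG].
    The latter have energy at most 65 times the square of the bound on that entry; [585 = 65 * 9],
    with 9 from a sum of three terms, and the outer 3 comes from [energyD]. *)
Lemma gradient_displacement i : (energy (W i) <=
  (3 * (396 * 3 ^+ 6 * r ^+ 2 + 585 * (`|CG| * h) ^+ 2) * N ^+ 2)%:E)%E.
Proof.
pose a x := f1 i x - f1 i (gl x).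
pose b k x := ((k == i)%:R - g k i x) * f1 k (gl x).
have ma : measurable_on setT a by exact: measurable_funB (mf1 i) (mgl (mf1 i)).
have mc k : measurable_on setT (fun x => (k == i)%:R - g k i x).
  exact: (measurable_funB (@measurable_cst _ _ (mR3 R) R setT _) (mg k i)).
have mb k : measurable_on setT (b k) by exact: measurable_funM (mc k) (mgl (mf1 k)).
have -> : W i = (fun x => a x + (b ord0 x + b (inord 1) x + b ord_max x)).
  apply/funext => x; rewrite /W /lifted_gradient sum_ord3 /a /b.
  have : \sum_(k < 3) (k == i)%:R * f1 k (gl x) = f1 i (gl x).
    rewrite (bigD1 i)//= eqxx mul1r big1 ?addr0// => k /negbTE ->; exact: mul0r.
  by rewrite sum_ord3 => <-; ring.
have mbs : measurable_on setT (fun x => b ord0 x + b (inord 1) x + b ord_max x).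
  exact: (measurable_funD (measurable_funD (mb ord0) (mb (inord 1))) (mb ord_max)).
have bE k : (energy (b k) <= ((`|CG| * h) ^+ 2 * 65 * N ^+ 2)%:E)%E.
  have bd x : `|(k == i)%:R - g k i x| <= `|CG| * h by rewrite distrC.
  apply: le_trans (energy_bounded_mul (mgl (mf1 k)) (mc k) bd) _.
  rewrite [leRHS](_ : _ = ((`|CG| * h) ^+ 2)%:E * (65%:E * (N ^+ 2)%:E))%E; last first.
    by rewrite -!EFinM; congr EFin; ring.
  apply: lee_pmul; [by rewrite lee_fin sqr_ge0|exact: energy_ge0|exact: lexx|].
  by apply: le_trans (energy_gl (mf1 k)) _; apply: lee_pmul => //; exact: energy_ge0.
have aE : (energy a <= (396 * 3 ^+ 6 * r ^+ 2 * N ^+ 2)%:E)%E.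
  exact: displacement_bound (mf1 i) (mf2 i) (wf1 i) (Ef2 i).
apply: le_trans (energyD ma mbs) _.
have bsE := energyD3 (mb ord0) (mb (inord 1)) (mb ord_max).
set c := ((`|CG| * h) ^+ 2 * 65 * N ^+ 2) in bE.
have bE3 : (energy (fun x => b ord0 x + b (inord 1) x + b ord_max x)%R <= (3 * (c + c + c))%:E)%E.
  apply: le_trans bsE _; rewrite EFinM; apply: lee_pmul => //.
    by apply: adde_ge0; [apply: adde_ge0|]; exact: energy_ge0.
  by rewrite !EFinD; apply: leeD; [apply: leeD|].
apply: (@le_trans _ _ (3%:E * ((396 * 3 ^+ 6 * r ^+ 2 * N ^+ 2)%:E + (3 * (c + c + c))%:E))%E).
  apply: lee_pmul => //; [by apply: adde_ge0; exact: energy_ge0|exact: leeD].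
by rewrite -EFinD -EFinM lee_fin le_eqVlt; apply/orP; left; apply/eqP; rewrite /c; ring.
Qed.

Let lty u : (energy u <= (N ^+ 2)%:E)%E -> (energy u < +oo)%E.
Proof. by move/le_lt_trans; apply; exact: ltry. Qed.

(** The identity for [f] on the whole space, tested in [D], minus the chain rule. Finite energies
    make all the integrals finite, which allows the subtraction. *)
Lemma is_wderiv_displacement i : is_wderiv D [:: i] v (W i).
Proof.
have vE : (energy v < +oo)%E by apply: le_lt_trans L2_displacement _; exact: ltry.
have WE : (energy (W i) < +oo)%E by apply: le_lt_trans (gradient_displacement i) _; exact: ltry.
split.
- exact: (energy_loc_integrable mv vE).
- exact: (energy_loc_integrable (mW i) WE).
move=> phi tphi.
have [K [n [cK KD n0 out bnd]]] := test_function_bounds i tphi.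
have phiN x : `|phi x| <= n by have [] := bnd x 0.
have p1N x : `|pderiv [:: i] phi x| <= n by have [] := bnd x 0.
have msm (w' : seq 'I_3) : measurable_on setT (pderiv w' phi).
  apply: continuous_measurable3 => x; apply: differentiable_continuous.
  by have [s _] := tphi; exact: s.
have z0 x : ~ K x -> phi x = 0 by move=> /out[].
have z1 x : ~ K x -> pderiv [:: i] phi x = 0 by move=> /out[].
have tphi' : test_function setT phi.
  by have [sphi _] := tphi; split => //; exists K; split.
have i0 u : measurable_on setT u -> (energy u < +oo)%E -> mu.-integrable setT (fun x => (u x * phi x)%:E).
  by move=> mu_ uE; exact: (energy_weight cK n0 mu_ uE (msm [::]) z0 phiN).1.
have i1 u : measurable_on setT u -> (energy u < +oo)%E -> mu.-integrable setT (fun x => (u x * pderiv [:: i] phi x)%:E).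
  by move=> mu_ uE; exact: (energy_weight cK n0 mu_ uE (msm [:: i]) z1 p1N).1.
have S (u : R3 R -> \bar R) : mu.-integrable setT u -> mu.-integrable (D : set (mR3 R)) u.
  exact: integrableS measurableT mD (@subsetT _ _).
have res u b : (forall x, ~ K x -> b x = 0) ->
    (\int[mu]_(x in D) (u x * b x)%:E = \int[mu]_x (u x * b x)%:E)%E.
  move=> b0; rewrite [LHS]integral_mkcond; apply: eq_integral => x _; rewrite patchE; case: ifPn => // xD.
  by rewrite b0 ?mulr0// => /KD Dx; rewrite mem_set in xD.
have glE : (energy (fun x => f (gl x)) < +oo)%E.
  by apply: le_lt_trans (energy_gl mf) _; rewrite lte_mul_pinfty ?lee_fin// lty.
have [_ _ /(_ _ tphi')] := wf i; rewrite /= expr1 mulN1e -(res f _ z1) -(res (f1 i) _ z0) => E1.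
have E2 := chain_rule oD bD cB GB cH cG wG ge mg h_small wp wf1 (lty Ef) (fun k => lty (Ef1 k))
  (fun k j => lty (Ef2 k j)) i tphi.
pose c x := \sum_(k < 3) g k i x * f1 k (gl x).
have E2' : (\int[mu]_(x in D) (f (gl x) * pderiv [:: i] phi x)%:E = - \int[mu]_(x in D) (c x * phi x)%:E)%E.
  rewrite (_ : integral _ _ _ = \int[mu]_(x in D) (f (G x) * pderiv [:: i] phi x)%:E)%E; last first.
    by apply: eq_integral => x xD; rewrite /gl /glue xD.
  by rewrite E2; congr (- _)%E; apply: eq_integral => x xD; rewrite /c /gl /glue xD.
have mc : measurable_on setT c by exact: mS.
have cE : (energy c < +oo)%E.
  have dE : (energy (fun x => c x - f1 i x)%R < +oo)%E.
    apply: le_lt_trans WE; rewrite /energy le_eqVlt; apply/orP; left; apply/eqP.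
    by apply: eq_integral => x _; rewrite /W /lifted_gradient -/(c x) -sqrrN opprB.
  exact: energyB_lty mc (mf1 i) (lty (Ef1 i)) dE.
transitivity (\int[mu]_(x in D) ((f x * pderiv [:: i] phi x)%:E - (f (gl x) * pderiv [:: i] phi x)%:E))%E.
  by apply: eq_integral => x _; rewrite -EFinB /v mulrBl.
rewrite (integralB mD (S _ (i1 _ mf (lty Ef))) (S _ (i1 _ (mgl mf) glE))) E1 E2' mulN1e.
transitivity (- \int[mu]_(x in D) ((f1 i x * phi x)%:E - (c x * phi x)%:E))%E; last first.
  by congr (- _)%E; apply: eq_integral => x _; rewrite -EFinB -mulrBl.
rewrite (integralB mD (S _ (i0 _ (mf1 i) (lty (Ef1 i)))) (S _ (i0 _ mc cE))).
have fc : (\int[mu]_(x in D) (c x * phi x)%:E)%E \is a fin_num by exact: (integrable_fin_num mD (S _ (i0 _ mc cE))).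
by rewrite oppeK fin_num_oppeB.
Qed.

End lifted_functions.

(** * Norms of the error and the final constants *)

Section estimate.
Context {R : realType}.
Implicit Types (x y p q : R3 R) (i j k : 'I_3) (A D : set (R3 R)) (u v w f : R3 R -> R) (s t r : R).
Local Notation mu := (@leb3 R).

(** [wderiv] is a chosen representative; uniqueness almost everywhere, for words of length 0 and 1,
    replaces it by the explicit [g]. *)
Lemma wderiv_energy D l u g : open D -> (size l <= 1)%N -> is_wderiv D l u g ->
  measurable_on setT g -> (L2norm D (wderiv D l u) ^+ 2 <= energy g)%E.
Proof.
move=> oD l1 ug mg; have wd : is_wderiv D l u (wderiv D l u) by apply: wderivP; exists g.
have mw : measurable_on D (wderiv D l u) by have [_ h _] := wd; exact: (loc_integrable_measurable oD h).
apply: (L2norm_le_energy (open_measurable3 oD) mw mg).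
case: l l1 ug wd {mw} => [|i [|//]] _ ug wd.
  have := negligibleU (is_wderiv_nil_ae oD ug) (is_wderiv_nil_ae oD wd).
  apply: negligibleS => x [Dx ne]; have [E|ne'] := pselect (u x = g x); last by left.
  by right; split => // E'; apply: ne; rewrite -E' E.
exact: (weak_partial_unique oD (is_wderiv_weak_partial wd) (is_wderiv_weak_partial ug)).
Qed.

Lemma is_wderiv_ae D l u v g : open D -> is_wderiv D l u g -> measurable_on D v ->
  mu.-negligible [set x | D x /\ u x <> v x] -> is_wderiv D l v g.
Proof.
move=> oD [iu ig ug] mv N; have mD := open_measurable3 oD; have mu_ := loc_integrable_measurable oD iu.
split => // [|phi tphi]; first exact: (loc_integrable_ae mD iu mv N).
rewrite -(ug _ tphi); have mp : measurable_on D (pderiv l phi).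
  apply: measurable_funTS; apply: continuous_measurable3 => x; apply: differentiable_continuous.
  by have [sphi _] := tphi; exact: sphi.
apply: (@ae_eq_integral _ _ _ mu _ _ _ mD).
- by apply/measurable_EFinP; exact: measurable_funM.
- by apply/measurable_EFinP; exact: measurable_funM.
by apply: negligibleS N => x; apply: contra_notP => /not_andP[nD|/contrapT E] Dx; [|rewrite E].
Qed.

Lemma H1_energy D w v (W : 'I_3 -> R3 R -> R) (c : R) : open D -> measurable_on D w ->
  measurable_on setT v -> (forall i, measurable_on setT (W i)) ->
  (energy v < +oo)%E -> (forall i, (energy (W i) <= c%:E)%E) ->
  (forall i, is_wderiv D [:: i] v (W i)) -> mu.-negligible [set x | D x /\ v x <> w x] ->
  in_H D 1 w /\ (H1seminorm D w ^+ 2 <= (3 * c)%:E)%E.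
Proof.
move=> oD mw mv mW vE WE vW N; have mD := open_measurable3 oD.
have dW i : is_wderiv D [:: i] w (W i) by exact: (is_wderiv_ae oD (vW i) mw N).
have iv : loc_integrable D v by have [] := vW ord0.
have dv : is_wderiv D [::] w v.
  apply: (is_wderiv_ae oD _ mw N); split => // phi tphi.
  by rewrite /= expr0 mul1e.
have dl l : (size l <= 1)%N -> exists2 g, is_wderiv D l w g &
    measurable_on setT g /\ (energy g < +oo)%E.
  case: l => [|i [|//]] _; first by exists v.
  by exists (W i) => //; split => //; exact: le_lt_trans (WE i) (ltry _).
have eW i : (L2norm D (wderiv D [:: i] w) ^+ 2 <= c%:E)%E.
  by apply: le_trans (WE i); exact: (wderiv_energy oD _ (dW i) (mW i)).
have sq0 l : (0 <= L2norm D (wderiv D l w) ^+ 2)%E by rewrite expe2E mule_ge0 ?L2norm_ge0.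
split; last first.
  rewrite /H1seminorm sqre_half ?sume_ge0//.
  apply: (@le_trans _ _ (\sum_(i < 3) c%:E)%E); first exact: lee_sum.
  by rewrite sumEFin big_const_ord /= lee_fin le_eqVlt; apply/orP; left; apply/eqP; ring.
have t1 : Num.truncn (1 : R) = 1%N by apply: truncn_def; rewrite lexx ltr1n.
have lt l : (size l <= 1)%N -> (L2norm D (wderiv D l w) ^+ 2 < +oo)%E.
  by move=> l1; have [g wg [mg gE]] := dl l l1; exact: le_lt_trans (wderiv_energy oD l1 wg mg) gE.
split.
  move=> al; rewrite -size_word [X in (_ <= X)%N]t1 => /dl[g wg _]; by exists g.
rewrite /Hnorm; apply: poweR_lty; have -> : (1 - (Num.truncn (1 : R))%:R == 0 :> R) by rewrite t1 subrr.
rewrite adde0; apply: lte_sum_pinfty => al al1; apply: lt; rewrite size_word.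
by rewrite -[X in (_ <= X)%N]t1.
Qed.

Variables (Om : set (R3 R)) (gamma1 gamma2 CG h : R) (M : set (polyhedron R)) (G : R3 R -> R3 R).
Hypotheses (oOm : open Om) (sOm : smooth_boundary Om).
Hypothesis mesh : bulk_surface_mesh Om gamma1 gamma2 h M.
Hypothesis lift : lifting_map Om M CG h G.
Hypotheses (h0 : 0 < h) (h_small : 3 * (`|CG| * h) <= 1 / 2).

Let D : set (R3 R) := interior (bulk M).
Let r := (`|CG| + 1) * h ^+ 2.

Lemma lifting_estimate s u f : measurable_on Om u -> Num.truncn s = 2%N -> in_H setT s f ->
  mu.-negligible [set x | Om x /\ f x <> u x] ->
  let w := fun x => f x - inverse_lift Om G u x in let N := fine (Hnorm setT s f) in
  [/\ measurable_on (bulk M) w,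
    (L2norm (bulk M) w ^+ 2 <= (396 * 3 ^+ 6 * r ^+ 2 * N ^+ 2)%:E)%E, in_H D 1 w &
    (H1seminorm D w ^+ 2 <= (3 * (3 * (396 * 3 ^+ 6 * r ^+ 2 + 585 * (`|CG| * h) ^+ 2) * N ^+ 2))%:E)%E].
Proof.
move=> mu_ s2 fH fu w N.
have oD : open D by exact: open_interior.
have HN : (Hnorm setT s f ^+ 2 = (N ^+ 2)%:E)%E.
  have [_ fin] := fH; rewrite -[in LHS](@fineK _ (Hnorm setT s f)); first by rewrite expe2E -EFinM.
  by rewrite ge0_fin_numE// Hnorm_ge0.
have [f1 [f2 []]] := sobolev2 s2 fH; rewrite HN => wf wf1 Ef Ef1 Ef2.
have [H [g [cB GB cH cG [wG ge mg]]]] := lifting_setup mesh lift h0.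
pose gl := glue D G; pose v x := f x - f (gl x).
have mf : measurable_on setT f by have [hf _ _] := wf ord0; exact: (loc_integrable_measurable openT hf).
have mgl b : measurable_on setT b -> measurable_on setT (fun x => b (gl x)).
  by move=> mb; exact: (measurableT_comp mb (measurable_glue oD cG)).
have mv : measurable_on setT v by exact: measurable_funB mf (mgl _ mf).
have mW := measurable_lifted_gradient cG mg wf.
have mw : measurable_on (bulk M) w.
  by apply: measurable_funB; [exact: measurable_funTS|exact: (measurable_inverse_lift oOm mesh lift mu_)].
have wvD : mu.-negligible [set x | D x /\ v x <> w x].
  apply: negligibleS (inverse_lift_ae sOm mesh h_small cB GB cH cG wG ge fu) => x [Dx ne]; split => // E.
  by apply: ne; rewrite /w E.
have vE := L2_displacement mesh lift h0 h_small cB GB cH cG wG ge wf Ef1.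
have WE := gradient_displacement mesh lift h0 h_small cB GB cH cG wG ge mg wf wf1 Ef1 Ef2.
have vW := is_wderiv_displacement mesh lift h0 h_small cB GB cH cG wG ge mg wf wf1 Ef Ef1 Ef2.
have [|inH semi] := H1_energy oD _ mv mW (le_lt_trans vE (ltry _)) WE vW wvD.
  by apply: measurable_funS mw; [exact: compact_measurable3 (compact_bulk mesh)|exact: interior_subset].
split => //; apply: le_trans vE; apply: (L2norm_le_energy (compact_measurable3 (compact_bulk mesh)) mw mv).
(* [w] and [v] are compared on the interior of the bulk; the rest of the bulk is the mesh surface, a
   null set. *)
have := negligibleU wvD (mesh_surface_negligible mesh); apply: negligibleS => x [].
rewrite (bulkE mesh) => -[Dx|Sx] ne; last by right.
by left; split => // E; apply: ne.
Qed.

End estimate.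

(** The threshold says [6 * a * h + 6 * h < 1]: the first term gives the contraction condition of
    [near_identity_contract], the second keeps [h] below 1. *)
Lemma small_mesh (R : realType) (a h : R) : 0 <= a -> 0 < h -> h < (6 * (a + 1))^-1 ->
  3 * (a * h) <= 1 / 2 /\ h <= 1.
Proof.
move=> a0 h0; have a1 : 0 < 6 * (a + 1) by lra.
rewrite -[_^-1]mul1r ltr_pdivlMr// => hh; have ah : 0 <= a * h by rewrite mulr_ge0// ltW.
by split; lra.
Qed.

Lemma L2_constant (R : realType) (z c K h N : R) : 1 <= c -> z <= c ->
  z * (K * h ^+ 2) ^+ 2 * N ^+ 2 <= (9 * c * K * h ^+ 2 * N) ^+ 2.
Proof.
move=> c1 zc; rewrite (_ : (9 * _ * _ * _ * _) ^+ 2 = 81 * c ^+ 2 * ((K * h ^+ 2) ^+ 2 * N ^+ 2)); last by ring.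
rewrite -[leLHS]mulrA; apply: ler_wpM2r; first by rewrite mulr_ge0 ?sqr_ge0.
apply: le_trans zc _; have : c * 1 <= c * c by rewrite ler_pM2l// (lt_le_trans ltr01).
by rewrite mulr1 expr2 => h1; apply: le_trans h1 _; rewrite ler_peMl// ?mulr_ge0 ?(le_trans ler01)// ler1n.
Qed.

Lemma nine_le (R : realType) (x y p q t : R) : x <= p -> y <= q -> p + q <= t -> 0 <= t ->
  3 * (3 * (x + y)) <= 81 * t.
Proof. move=> *; lra. Qed.

(** With [h <= 1] the squared displacement, of order [h ^+ 4], is absorbed in the squared Jacobian
    error, of order [h ^+ 2]. The factor 9 squared exceeds the two factors 3. *)
Lemma H1_constant (R : realType) (z y c a h N : R) : 0 <= z -> 0 <= y -> 1 <= c -> 0 <= a ->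
  0 < h -> h <= 1 -> z + y <= c ->
  3 * (3 * (z * ((a + 1) * h ^+ 2) ^+ 2 + y * (a * h) ^+ 2) * N ^+ 2) <=
  (9 * c * (a + 1) * h * N) ^+ 2.
Proof.
move=> z0 y0 c1 a0 h0 h1 hc; have p0 : 0 <= (a + 1) * h by rewrite mulr_ge0 ?addr_ge0// ltW.
have e1 : ((a + 1) * h ^+ 2) ^+ 2 <= ((a + 1) * h) ^+ 2.
  apply: lerXn2r; rewrite ?nnegrE ?mulr_ge0 ?addr_ge0 ?sqr_ge0 ?(ltW h0)//.
  by apply: ler_wpM2l; [rewrite addr_ge0|rewrite expr2 ler_piMl// ltW].
have e2 : (a * h) ^+ 2 <= ((a + 1) * h) ^+ 2.
  apply: lerXn2r; rewrite ?nnegrE ?mulr_ge0 ?addr_ge0 ?(ltW h0)//.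
  by rewrite ler_pM2r// lerDl.
set P := ((a + 1) * h) ^+ 2 in e1 e2; have P0 : 0 <= P by exact: sqr_ge0.
rewrite (_ : (9 * _ * _ * _ * _) ^+ 2 = 81 * c ^+ 2 * P * N ^+ 2); last by rewrite /P; ring.
rewrite mulrA; apply: ler_wpM2r; first exact: sqr_ge0.
have cc : c <= c ^+ 2 by rewrite expr2 ler_peMl// (le_trans ler01).
have i3 : (z + y) * P <= c ^+ 2 * P by apply: ler_wpM2r => //; exact: le_trans cc.
have i4 : 0 <= c ^+ 2 * P by rewrite mulr_ge0 ?sqr_ge0.
rewrite mulrDl in i3; rewrite -[81 * _ * _]mulrA.
exact: (nine_le (ler_wpM2l z0 e1) (ler_wpM2l y0 e2) i3 i4).
Qed.

Lemma in_H_measurable (R : realType) (D : set (R3 R)) s u : open D -> in_H D s u -> measurable_on D u.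
Proof.
move=> oD [ex _]; have [al al0 w0] := word0 (Num.truncn s).
have [|g] := ex al; first by rewrite al0.
by rewrite w0 => -[iu _ _]; exact: (loc_integrable_measurable oD iu).
Qed.

(** The passage from squares to norms: [n] stands for the norm of the extension, bounded in turn by
    the norm [Y] on the domain. *)
Lemma lee_norm_bound (R : realType) (X Y : \bar R) (a b n C C' : R) : (0 <= X)%E -> (0 <= Y)%E ->
  0 <= a -> 0 <= n -> (X ^+ 2 <= b%:E)%E -> b <= (a * n) ^+ 2 ->
  (n%:E <= C%:E * Y)%E -> C <= C' -> (X <= (a * C')%:E * Y)%E.
Proof.
move=> X0 Y0 a0 n0 Xb ban nY CC.
have an0 : 0 <= a * n by exact: mulr_ge0.
apply: (@le_trans _ _ (a * n)%:E).
  apply: (lee_sqre X0); first by rewrite lee_fin.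
  by rewrite [leRHS]expe2E -EFinM -expr2; apply: le_trans Xb _; rewrite lee_fin.
rewrite !EFinM -muleA; apply: lee_pmul => //; apply: le_trans nY _.
by apply: lee_wpmul2r => //; rewrite lee_fin.
Qed.

Theorem lemma4 (R : realType) (Om : set (R3 R))
    (E : (R3 R -> R) -> R3 R -> R) (gamma1 gamma2 CG : R) :
  open Om -> bounded_set Om -> smooth_boundary Om ->
  extension_operator [set s | [\/ s = 2, s = 2 + 1 / 4 | s = 2 + 3 / 4]] Om E ->
  0 < gamma1 -> 0 < gamma2 ->
  exists C h0 : R, [/\ 0 < C, 0 < h0 &
    forall (h : R) (M : set (polyhedron R)) (G : R3 R -> R3 R),
      0 < h -> h < h0 ->
      bulk_surface_mesh Om gamma1 gamma2 h M ->
      exterior_bulk M `<=` fermi_stripe Om ->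
      lifting_map Om M CG h G ->
      (forall u, in_H Om (2 + 1 / 4) u ->
         let w := fun x => E u x - inverse_lift Om G u x in
         measurable_on (bulk M) w /\
         (L2norm (bulk M) w <=
            (C * h ^+ 2)%:E * Hnorm Om (2 + 1 / 4) u)%E) /\
      (forall u, in_H Om (2 + 3 / 4) u ->
         let w := fun x => E u x - inverse_lift Om G u x in
         in_H (interior (bulk M)) 1 w /\
         (H1seminorm (interior (bulk M)) w <=
            (C * h `^ (3 / 2))%:E * Hnorm Om 2 u +
            (C * h)%:E * Hnorm Om (2 + 3 / 4) u)%E)].
Proof.
move=> oOm _ sOm ext _ _.
have [_ ae1 [C1 bound1]] := ext _ (Or32 _ _ (erefl (2 + 1 / 4))).
have [_ ae2 [C2 bound2]] := ext _ (Or33 _ _ (erefl (2 + 3 / 4))).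
have est h M G := @lifting_estimate R Om gamma1 gamma2 CG h M G oOm sOm.
have z0 : 0 <= 396 * 3 ^+ 6 :> R := mulr_ge0 (ler0n R 396) (exprn_ge0 6 (ler0n R 3)).
have y0 : 0 <= 585 :> R := ler0n R 585.
(* From here on the two numerical constants are variables, known to be nonnegative. *)
move: (396 * 3 ^+ 6) (585) z0 y0 est => z y z0 y0 est.
pose c := z + y + 1; pose C := `|C1| + `|C2| + 1.
have c1 : 1 <= c by rewrite lerDr addr_ge0.
have yc : z + y <= c by rewrite lerDl.
have zc : z <= c by apply: le_trans yc; rewrite lerDl.
have CG1 : 0 < `|CG| + 1 by rewrite ltr_wpDl.
have C0 : 0 < C by rewrite ltr_wpDl ?addr_ge0.
have c0 : 0 < c by exact: lt_le_trans c1.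
have C1C : C1 <= C by rewrite (le_trans (ler_norm _))// /C -addrA lerDl addr_ge0.
have C2C : C2 <= C by rewrite (le_trans (ler_norm _))// /C addrAC lerDr addr_ge0.
have k0 : 0 < 9 * c * (`|CG| + 1) by rewrite !mulr_gt0.
(* [c] dominates the numerical constants, the third factor comes from the bounds on [G], and [C]
   dominates the extension constants of both orders, which may have any sign. *)
exists (9 * c * (`|CG| + 1) * C), (6 * (`|CG| + 1))^-1; split.
- by rewrite mulr_gt0.
- by rewrite invr_gt0 mulr_gt0.
move=> h M G h0 hs mesh _ lift; have [h_small h1] := small_mesh (normr_ge0 CG) h0 hs.
have {}est s u := est h M G mesh lift h0 h_small s u (E u).
have ae s u : (in_H Om s u -> {ae @leb3 R, forall x, Om x -> E u x = u x}) -> in_H Om s u ->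
    (@leb3 R).-negligible [set x | Om x /\ E u x <> u x].
  by move=> h' uH; apply: negligibleS (h' uH) => x [Ox ne] E'; exact: ne (E' Ox).
have fin f s : in_H setT s f -> (fine (Hnorm setT s f))%:E = Hnorm setT s f.
  by move=> [_ fin]; rewrite fineK// ge0_fin_numE// Hnorm_ge0.
split => u uH w.
  have [fH fB] := bound1 u uH.
  have t2 : Num.truncn (2 + 1 / 4 : R) = 2%N by apply: truncn_def; apply/andP; split; lra.
  have [mw L2 _ _] := est _ _ (in_H_measurable oOm uH) t2 fH (ae _ _ (ae1 u) uH).
  split => //; rewrite (_ : _ * h ^+ 2 = 9 * c * (`|CG| + 1) * h ^+ 2 * C); last by ring.
  apply: (lee_norm_bound (L2norm_ge0 _ _) (Hnorm_ge0 _ _ _) _ _ L2 _ _ C1C (n := fine (Hnorm setT (2 + 1 / 4) (E u)))).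
  - by rewrite mulr_ge0 ?(ltW k0)// exprn_ge0// ltW.
  - exact: fine_ge0 (Hnorm_ge0 _ _ _).
  - exact: L2_constant.
  - by rewrite fin.
have [fH fB] := bound2 u uH.
have t2 : Num.truncn (2 + 3 / 4 : R) = 2%N by apply: truncn_def; apply/andP; split; lra.
have [_ _ wH H1] := est _ _ (in_H_measurable oOm uH) t2 fH (ae _ _ (ae2 u) uH).
split => //; rewrite (_ : _ * h = 9 * c * (`|CG| + 1) * h * C); last by ring.
(* The gradient error is bounded by the second summand, of order [h]; the first is nonnegative and
   is added. *)
apply: (@le_trans _ _ ((9 * c * (`|CG| + 1) * h * C)%:E * Hnorm Om (2 + 3 / 4) u)%E); last first.
  rewrite leeDr// mule_ge0 ?Hnorm_ge0// lee_fin mulr_ge0 ?powR_ge0//.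
  by rewrite mulr_ge0 ?ltW.
apply: (lee_norm_bound _ (Hnorm_ge0 _ _ _) _ _ H1 _ _ C2C (n := fine (Hnorm setT (2 + 3 / 4) (E u)))).
- exact: poweR_ge0.
- by rewrite mulr_ge0 ?ltW.
- exact: fine_ge0 (Hnorm_ge0 _ _ _).
- exact: H1_constant.
- by rewrite fin.
Qed.
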